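(* Let $T>0$ and let $u\in C([0,T];H^3_{\rm p}(\Omega))$ be a real-valued solution of the periodic Korteweg--de Vries equation $$u_t+u_{xxx}+uu_x=0,\quad x\in\Omega=(-\pi,\pi),\ t\in(0,T],\qquad u(x,0)=u_0(x).$$ Let $C_S>0$ be an absolute constant such that $\|P_Nv\|_{L^\infty}\le C_S\|v\|_1$ for all $v\in H^1_{\rm p}(\Omega)$ and all positive integers $N$, put $M_1:=C_S\|u\|_{L^\infty(0,T;H^1_{\rm p}(\Omega))}$ and $c_0:=\sqrt2\,M_1$, and assume $c_0>0$. Let $c>c_0$. Then there exist constants $h_0>0$ and $M>0$, both depending only on $T$, $c$ and $\|u\|_{L^\infty(0,T;H^3_{\rm p}(\Omega))}$ in the sense that they are independent of $\tau$, $h$ and $n$, such that the following holds. For every mesh size $h=2\pi/(2N+1)$ ($N$ a positive integer) with $h\le h_0$ and every time step $\tau>0$ with $\tau\le h/c$, the sequence $(u_N^n)_{n\ge0}$ defined by $$u_N^0=I_N(u_0),\qquad u_N^{n+1}=e^{-\tau\partial_x^3}u_N^n-\frac{\tau}{2}e^{-\tau\partial_x^3}I_N\delta_x^0\big((u_N^n)^2\big)+\frac{c\tau h}{2}e^{-\tau\partial_x^3}\delta_x^2u_N^n,\quad n\ge0,$$ satisfies $$\|u_N^n-u(t_n)\|\le M(\tau+h)\qquad\text{for all integers } n\ge0 \text{ with } n\tau\le T,$$ where $t_n=n\tau$.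
   Context: $\|\cdot\|$ is the norm of $L^2(\Omega)$, $\Omega=(-\pi,\pi)$. For $m\in\mathbb N$, $H^m_{\rm p}(\Omega)$ is the Sobolev space of $H^m$ functions on the one-dimensional torus $\Omega$ ($2\pi$-periodic functions), with standard norm $\|\cdot\|_m$. Functions on $\Omega$ are extended $2\pi$-periodically. For a positive integer $N$, let $h=2\pi/(2N+1)$, $x_j=-\pi+jh$ for $j=0,\dots,2N$, and $X_N=\mathrm{span}\{e^{ikx}:|k|\le N\}$. $P_N:L^2(\Omega)\to X_N$ is the $L^2$-orthogonal projection. $I_N$ maps a continuous periodic function $v$ to the unique trigonometric polynomial $I_Nv\in X_N$ with $(I_Nv)(x_j)=v(x_j)$ for $j=0,\dots,2N$. The difference operators are $$\delta_x^0v(x)=\frac{v(x+h)-v(x-h)}{2h},\qquad \delta_x^2v(x)=\frac{v(x+h)-2v(x)+v(x-h)}{h^2}.$$ For $t\in\mathbb R$, $e^{-t\partial_x^3}$ is the linear isometry of $L^2(\Omega)$ acting on Fourier modes by $e^{-t\partial_x^3}e^{ikx}=e^{itk^3}e^{ikx}$. An absolute constant is one independent of $N$, $h$, $\tau$ and $u$; a constant $C_S$ as in the claim exists by the Sobolev embedding $H^1_{\rm p}(\Omega)\hookrightarrow L^\infty(\Omega)$. *)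

(* Defs.v *)
From HB Require Import structures.
From mathcomp Require Import all_boot all_order all_algebra.
From mathcomp Require Import all_classical all_reals all_analysis.
From mathcomp Require Import complex.

Set Implicit Arguments.
Unset Strict Implicit.
Unset Printing Implicit Defensive.

Import Order.TTheory GRing.Theory Num.Theory.
Import numFieldNormedType.Exports.

Local Open Scope classical_set_scope.
Local Open Scope ring_scope.
Local Open Scope complex_scope.

(* An element of a space of functions on the torus is represented by a        *)
(* 2pi-periodic function R -> R[i]. Two representatives of the same class may *)
(* differ on a null set; where pointwise values matter (nodal values of the   *)
(* initial datum), the continuous representative is asked for explicitly.     *)

Section L2.
Context {R : realType}.
Implicit Types (f g v w : R -> R[i]).

Definition Omega : set R := `]- pi, pi[%classic.

Definition periodic {V : Type} (f : R -> V) := forall x, f (x + 2 * pi) = f x.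

Definition toC (f : R -> R) : R -> R[i] := fun x => (f x)%:C.

(* The norm of L^p(A), of a function on R that is only looked at on A.        *)
Definition LpE (A : set R) (p : \bar R) (f : R -> R) : \bar R :=
  'N[lebesgue_measure]_p[(EFin \o f) \_ A].

Definition Linfty (A : set R) (f : R -> R) : \bar R := LpE A +oo%E f.

Definition L2 : set (R -> R[i]) := [set f : R -> R[i] |
  [/\ measurable_fun Omega (fun x => complex.Re (f x)),
      measurable_fun Omega (fun x => complex.Im (f x)) &
      (LpE Omega 2%:E (fun x => Normc.normc (f x)) < +oo)%E]].

Definition normL2 f : R := fine (LpE Omega 2%:E (fun x => Normc.normc (f x))).

Definition cintegral f : R[i] :=
  (\int[lebesgue_measure]_(x in Omega) complex.Re (f x))
  +i* (\int[lebesgue_measure]_(x in Omega) complex.Im (f x)).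

Definition inner f g : R[i] := cintegral (fun x => f x * (g x)^*).

End L2.

Section Sobolev.
Context {R : realType}.
Implicit Types (v g : R -> R[i]) (m : nat).

Definition smooth_periodic (phi : R -> R) :=
  periodic phi /\ forall n x, derivable (derive1n n phi) x 1.

Definition is_weak_derivative m v g := forall phi : R -> R,
  smooth_periodic phi ->
  cintegral (fun x => v x * toC (derive1n m phi) x) =
  (-1) ^+ m * cintegral (fun x => g x * toC phi x).

(* An arbitrary representative of the m-th weak derivative (unique up to null *)
(* sets), or 0 if there is none in L^2.                                       *)
Definition weak_derivative m v : R -> R[i] :=
  xget (fun=> 0) [set g : R -> R[i] | L2 g /\ is_weak_derivative m v g].

Definition Hp m : set (R -> R[i]) := [set v : R -> R[i] |
  [/\ periodic v, L2 v &
      forall j, (j <= m)%N -> exists2 g, L2 g & is_weak_derivative j v g]].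

Definition normH m v : R :=
  Num.sqrt (\sum_(j < m.+1) normL2 (weak_derivative j v) ^+ 2).

(* The norm of L^oo(0, T; H^m_p), for u : time -> space -> R[i].              *)
Definition LinftyH T m (u : R -> R -> R[i]) : \bar R :=
  Linfty `]0, T[%classic (fun t => normH m (u t)).

Definition C_Hp T m (u : R -> R -> R[i]) :=
  forall t, t \in `[0, T] -> Hp m (u t) /\
    (fun s => normH m (u s \- u t)) @ within `[0, T]%classic (nbhs t) --> (0 : R).

End Sobolev.

Section KdV.
Context {R : realType}.

(* u_t + u_xxx + u u_x = 0 on (0, T], where u_t(t) is the limit in L^2 of the *)
(* difference quotients at t (one-sided for t = T).                           *)
Definition KdV_solution T (u : R -> R -> R[i]) :=
  forall t, t \in `]0, T] ->
    (fun s => normL2 (fun x =>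
        (u s x - u t x) / (s - t)%:C
        + weak_derivative 3 (u t) x + u t x * weak_derivative 1 (u t) x))
      @ within `[0, T]%classic t^' --> (0 : R).

End KdV.

Section TrigonometricPolynomials.
Context {R : realType}.
Implicit Types (N : nat) (v w : R -> R[i]).

Definition cexpi (y : R) : R[i] := cos y +i* sin y.

Definition mode (k : int) : R -> R[i] := fun x => cexpi (k%:~R * x).

(* The coefficient of mode k is a k, and the i-th frequency is i - N.         *)
Definition trig_poly N (a : int -> R[i]) : R -> R[i] := fun x =>
  \sum_(i < (2 * N).+1) a (i%:Z - N%:Z) * mode (i%:Z - N%:Z) x.

Definition XN N : set (R -> R[i]) := [set w | exists a, w = trig_poly N a].

Definition mesh N : R := 2 * pi / (2 * N + 1)%:R.

Definition node N (j : nat) : R := - pi + j%:R * mesh N.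

(* P_N: the w in X_N such that v - w is orthogonal to X_N                     *)
Definition projN N v : R -> R[i] :=
  xget (fun=> 0) [set w : R -> R[i] | XN N w /\
    forall phi, XN N phi -> inner (v \- w) phi = 0].

(* I_N: the w in X_N that agrees with v at the nodes                          *)
Definition interpN N v : R -> R[i] :=
  xget (fun=> 0) [set w : R -> R[i] | XN N w /\
    forall j, (j <= 2 * N)%N -> w (node N j) = v (node N j)].

Definition fourier_coef v (k : int) : R[i] :=
  inner v (mode k) / (2 * pi)%:C.

(* The restriction of exp(- t d_x^3) to X_N, which it leaves invariant.       *)
Definition airyN N (t : R) w : R -> R[i] :=
  trig_poly N (fun k => cexpi (t * k%:~R ^+ 3) * fourier_coef w k).

Definition delta0 (h : R) v : R -> R[i] := fun x =>
  (v (x + h) - v (x - h)) / (2 * h)%:C.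

Definition delta2 (h : R) v : R -> R[i] := fun x =>
  (v (x + h) - 2 * v x + v (x - h)) / (h ^+ 2)%:C.

Fixpoint uN N (c tau : R) (u0 : R -> R[i]) (n : nat) : R -> R[i] :=
  if n is n'.+1 then
    let w := uN N c tau u0 n' in
    let h := mesh N in
    fun x =>
      airyN N tau w x
      - (tau / 2)%:C *
          airyN N tau (interpN N (delta0 h (fun y => w y ^+ 2))) x
      + (c * tau * h / 2)%:C * airyN N tau (delta2 h w) x
  else interpN N u0.

End TrigonometricPolynomials.

(* Main.v *)
(** In Fourier variables the Airy flow only rotates the coefficients, so a step of
    the scheme is compared with the exact flow in l^2(Z).

    Consistency.  The twisted coefficients e^{-ik^3 s} of u(t + s) have the Fourier
    coefficients of -u u_x, rotated, as time derivative.  Since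
    k^3 - j^3 - (k - j)^3 = 3 k j (k - j), freezing them at time t costs O(s) once
    three derivatives of u are square summable; truncating to X_N, aliasing and the
    replacement of ik by i sin(kh)/h cost O(h) each, by Young's inequality for
    convolutions l^1 * l^2 -> l^2.  The local error is thus O(tau (tau + h)).

    Stability.  On nodal values the error obeys a Lax-Friedrichs type scheme.  Its
    numerical viscosity controls the nonlinear flux as soon as
    2 ||P_N u||_oo^2 <= c^2 and tau c <= h, up to a growth factor 1 + C tau, as long
    as the error is small compared with powers of h; the Agmon inequality converts
    smallness in l^2 into smallness in the maximum norm.  An induction on n closes
    the argument. *)

Require Import Defs.
From HB Require Import structures.
From mathcomp Require Import all_boot all_order all_algebra.
From mathcomp Require Import all_classical all_reals all_analysis.
From mathcomp Require Import measurable_realfun ess_sup_inf complex.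
From mathcomp Require Import ring lra zify.

Set Implicit Arguments.
Unset Strict Implicit.
Unset Printing Implicit Defensive.

Import Order.TTheory GRing.Theory Num.Theory.
Import numFieldNormedType.Exports.

Local Open Scope classical_set_scope.
Local Open Scope ring_scope.
Local Open Scope complex_scope.

(** The danger is a circle between the growth rate and the error constant. By induction the squared
    error summed over the nodes is [E = O(h)], with a constant exponential in the growth rate;
    bounding the maximum norm by [E] alone would feed that constant back into the rate. With the
    Agmon bound one part is absorbed by leftover dissipation, and the rest only uses [E <= 1] and
    [E ^+ 2 <= h], which small [h] guarantees. The rate thus depends on [c] and the H^3 bound alone,
    and [h0] is chosen last. The solution is known only through L2 limits in time and essential
    bounds, so everything is reduced to Fourier coefficients, differentiable scalar functions of
    time. Sums run over finite lists with bounds uniform in the list; the mean value theorem and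
    Bessel's inequality replace time integrals and series. The product [u u_x] enters through finite
    convolutions, up to an arbitrary [eps]. Uniform convergence of [P_N u] comes from a positive
    kernel and serves the initial error, the product and the final L2 error. *)

Local Notation nc := Normc.normc.
Local Notation Re := complex.Re.
Local Notation Im := complex.Im.

(** * Modulus, real part and imaginary part of complex numbers *)

Section ComplexModulus.
Context {R : realType}.
Implicit Types (z w : R[i]) (x y : R).

Lemma nc_ge0 z : 0 <= nc z.
Proof. by case: z => a b; exact: sqrtr_ge0. Qed.

Lemma nc_sqr z : nc z ^+ 2 = Re z ^+ 2 + Im z ^+ 2.
Proof. by case: z => a b; rewrite /= sqr_sqrtr// addr_ge0// sqr_ge0. Qed.

Lemma nc0 : nc (0 : R[i]) = 0. Proof. exact: Normc.normc0. Qed.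

Lemma ncM z w : nc (z * w) = nc z * nc w. Proof. exact: Normc.normcM. Qed.

Lemma ncD z w : nc (z + w) <= nc z + nc w. Proof. exact: le_normcD. Qed.

Lemma ncN z : nc (- z) = nc z. Proof. exact: normcN. Qed.

Lemma ncB z w : nc (z - w) <= nc z + nc w.
Proof. by rewrite -(ncN w); exact: ncD. Qed.

Lemma nc_real x : nc x%:C = `|x|.
Proof. by rewrite /= expr0n addr0 sqrtr_sqr. Qed.

Lemma ncJ z : nc (conjc z) = nc z.
Proof. by case: z => a b; rewrite /= sqrrN. Qed.

Lemma nc_Re z : `|Re z| <= nc z.
Proof.
rewrite -sqrtr_sqr; case: z => a b /=.
by rewrite ler_sqrt ?lerDl ?sqr_ge0// addr_ge0// sqr_ge0.
Qed.

Lemma nc_Im z : `|Im z| <= nc z.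
Proof.
rewrite -sqrtr_sqr; case: z => a b /=.
by rewrite ler_sqrt ?lerDr ?sqr_ge0// addr_ge0// sqr_ge0.
Qed.

Lemma nc_sum (I : Type) (s : seq I) (P : pred I) (F : I -> R[i]) :
  nc (\sum_(i <- s | P i) F i) <= \sum_(i <- s | P i) nc (F i).
Proof.
elim/big_ind2 : _ => [|z x w y zx wy|//]; first by rewrite nc0.
by apply: (le_trans (ncD _ _)); exact: lerD.
Qed.

Lemma ReD z w : Re (z + w) = Re z + Re w. Proof. by case: z; case: w. Qed.
Lemma ImD z w : Im (z + w) = Im z + Im w. Proof. by case: z; case: w. Qed.
Lemma ReN z : Re (- z) = - Re z. Proof. by case: z. Qed.
Lemma ImN z : Im (- z) = - Im z. Proof. by case: z. Qed.
Lemma ReM z w : Re (z * w) = Re z * Re w - Im z * Im w.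
Proof. by case: z; case: w. Qed.
Lemma ImM z w : Im (z * w) = Re z * Im w + Im z * Re w.
Proof. by case: z; case: w. Qed.

Lemma Re_sum (I : Type) (s : seq I) (P : pred I) (F : I -> R[i]) :
  Re (\sum_(i <- s | P i) F i) = \sum_(i <- s | P i) Re (F i).
Proof. by elim/big_ind2 : _ => [//|z x w y <- <-|//]; rewrite ReD. Qed.

Lemma Im_sum (I : Type) (s : seq I) (P : pred I) (F : I -> R[i]) :
  Im (\sum_(i <- s | P i) F i) = \sum_(i <- s | P i) Im (F i).
Proof. by elim/big_ind2 : _ => [//|z x w y <- <-|//]; rewrite ImD. Qed.

Lemma complex_ext z w : Re z = Re w -> Im z = Im w -> z = w.
Proof. by case: z w => [a b] [c d] /= -> ->. Qed.

Lemma conjcD z w : conjc (z + w) = conjc z + conjc w. Proof. exact: rmorphD. Qed.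
Lemma conjcM z w : conjc (z * w) = conjc z * conjc w. Proof. exact: rmorphM. Qed.

Lemma mulcJ z : z * conjc z = (nc z ^+ 2)%:C.
Proof.
by rewrite nc_sqr; case: z => a b; apply: complex_ext => /=; ring.
Qed.

Lemma cplxM x y : (x * y)%:C = x%:C * y%:C :> R[i].
Proof. exact: rmorphM. Qed.
Lemma cplx_sum (I : Type) (s : seq I) (F : I -> R) :
  (\sum_(i <- s) F i)%:C = \sum_(i <- s) (F i)%:C :> R[i].
Proof. exact: rmorph_sum. Qed.

Lemma conjc_sumM (I : Type) (s : seq I) (F G : I -> R[i]) :
  conjc (\sum_(i <- s) F i * G i) = \sum_(i <- s) conjc (F i) * conjc (G i).
Proof.
elim: s => [|i s IH]; first by rewrite !big_nil conjc0.
by rewrite !big_cons conjcD conjcM IH.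
Qed.

End ComplexModulus.

(** * Elementary bounds for sine and cosine *)

Section ElementaryTrigonometry.
Context {R : realType}.
Implicit Types (x y : R).

Lemma abs_sin_le x : `|sin x| <= `|x|.
Proof.
wlog x0 : x / 0 <= x => [H|].
  case: (lerP 0 x) => [/H//|x0].
  by rewrite -normrN -sinN -(normrN x); apply: H; lra.
have [c _ E] := @MVT_segment R (@sin R) (@cos R) 0 x x0
  (fun z _ => is_derive_sin z) (continuous_subspaceT (@continuous_sin R)).
rewrite sin0 !subr0 in E; rewrite E normrM.
by apply: ler_piMl => //; exact: cos_max.
Qed.

Lemma oneBcos x : 1 - cos x = 2 * sin (x / 2) ^+ 2.
Proof.
have {1}-> : x = (x / 2) *+ 2 by rewrite mulr2n; lra.
by rewrite cos_mulr2n cos2sin2; ring.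
Qed.

Lemma oneBcos_ge0 x : 0 <= 1 - cos x.
Proof. by rewrite subr_ge0 cos_le1. Qed.

Lemma oneBcos_le x : 1 - cos x <= x ^+ 2 / 2.
Proof.
rewrite oneBcos; have := abs_sin_le (x / 2).
rewrite -(@ler_pXn2r _ 2%N) ?nnegrE// !real_normK ?num_real//; lra.
Qed.

(** A quadratic bound costs only two powers of the frequency when the symbol [sin (k h) / h] is
    compared with [k]; the cubic Taylor bound would cost three. *)
Lemma sin_sub_le x : `|x - sin x| <= x ^+ 2.
Proof.
wlog x0 : x / 0 <= x => [H|].
  case: (lerP 0 x) => [/H//|x0].
  have -> : x - sin x = - ((- x) - sin (- x)) by rewrite sinN; ring.
  by rewrite normrN -(sqrrN x); apply: H; lra.
have dx z : z \in `]0, x[%R -> is_derive z 1 (fun y => y - sin y) (1 - cos z).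
  by move=> _; apply: is_deriveB.
have cx : {within `[0, x], continuous (fun y : R => y - sin y)}.
  apply: continuous_subspaceT => z.
  by apply: cvgB; [exact: cvg_id|exact: (@continuous_sin R)].
have [c cI E] := MVT_segment x0 dx cx.
rewrite sin0 !subr0 in E; rewrite E normrM !ger0_norm ?oneBcos_ge0//.
move: cI; rewrite in_itv/= => /andP[c0 cX].
(* The mean value theorem leaves [1 - cos c <= x]. For [x <= 2] this follows from [c ^+ 2 / 2 <= c],
   beyond from [1 - cos c <= 2]. *)
case: (lerP x 2) => x2.
  rewrite expr2 ler_wpM2r//; apply: le_trans (oneBcos_le c) _; nra.
rewrite expr2 ler_wpM2r//; have := cos_geN1 c; lra.
Qed.

End ElementaryTrigonometry.

(** * Unit exponentials and Fourier modes *)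

Section Exponentials.
Context {R : realType}.
Implicit Types (x y : R) (k l : int).

Lemma cexpiD x y : cexpi (x + y) = cexpi x * cexpi y.
Proof. by rewrite /cexpi cosD sinD; apply: complex_ext => /=; ring. Qed.

Lemma cexpi0 : cexpi 0 = 1 :> R[i].
Proof. by rewrite /cexpi cos0 sin0. Qed.

Lemma cexpiJ x : conjc (cexpi x) = cexpi (- x).
Proof. by rewrite /cexpi cosN sinN. Qed.

Lemma nc_cexpi x : nc (cexpi x) = 1.
Proof. by rewrite /= cos2Dsin2 sqrtr1. Qed.

Lemma cexpiNK x : cexpi (- x) * cexpi x = 1.
Proof. by rewrite -cexpiD addNr cexpi0. Qed.

Lemma cexpi_sub1 x : nc (cexpi x - 1) <= `|x|.
Proof.
rewrite -(@ler_pXn2r _ 2%N) ?nnegrE ?nc_ge0// nc_sqr real_normK ?num_real//=.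
have := oneBcos_le x; have := cos2Dsin2 x; lra.
Qed.

Lemma mode0 x : mode 0 x = 1.
Proof. by rewrite /mode mul0r cexpi0. Qed.

Lemma modeM k l x : mode k x * mode l x = mode (k + l) x.
Proof. by rewrite /mode -cexpiD -mulrDl -intrD. Qed.

Lemma modeD k x y : mode k (x + y) = mode k x * mode k y.
Proof. by rewrite /mode mulrDr cexpiD. Qed.

Lemma modeN k x : mode (- k) x = conjc (mode k x).
Proof. by rewrite /mode cexpiJ mulrNz mulNr. Qed.

Lemma nc_mode k x : nc (mode k x) = 1.
Proof. exact: nc_cexpi. Qed.

Lemma cexpi2pi : cexpi (2 * pi) = 1 :> R[i].
Proof. by rewrite mulr_natl /cexpi cos2pi sin2pi. Qed.

Lemma cexpi2pin k : cexpi (k%:~R * (2 * pi)) = 1 :> R[i].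
Proof.
have nat_case n : cexpi (n%:R * (2 * pi)) = 1 :> R[i].
  elim: n => [|n IH]; first by rewrite mul0r cexpi0.
  by rewrite -natr1 mulrDl mul1r cexpiD IH cexpi2pi mulr1.
case: k => n; first exact: nat_case.
rewrite NegzE mulrNz mulNr -cexpiJ; have -> := nat_case n.+1.
exact: conjc1.
Qed.

Lemma mode_periodic k : Defs.periodic (mode k : R -> R[i]).
Proof. by move=> x; rewrite modeD /mode cexpi2pin mulr1. Qed.

End Exponentials.

(** * Cauchy-Schwarz and Minkowski inequalities for finite sums *)

Section FiniteSums.
Context {R : realType}.

Lemma sum_sub_le (I : eqType) (s t : seq I) (f : I -> R) : uniq s ->
  {subset s <= t} -> (forall i, 0 <= f i) ->
  \sum_(i <- s) f i <= \sum_(i <- t) f i.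
Proof.
move=> + + f0; elim: s t => [|x s IH] t /=.
  by move=> _ _; rewrite big_nil sumr_ge0.
move=> /andP[xs us] st.
have xt : x \in t by apply: st; rewrite mem_head.
rewrite big_cons (perm_big _ (perm_to_rem xt)) big_cons lerD2l.
apply: IH => // y ys; have := st y; rewrite inE ys orbT => /(_ isT) yt.
have := perm_mem (perm_to_rem xt) y; rewrite yt inE => /esym/orP[/eqP yx|//].
by rewrite -yx ys in xs.
Qed.

Lemma cauchy_schwarz (I : Type) (s : seq I) (f g : I -> R) :
  (\sum_(i <- s) f i * g i) ^+ 2 <=
  (\sum_(i <- s) f i ^+ 2) * (\sum_(i <- s) g i ^+ 2).
Proof.
set F := \sum_(i <- s) f i ^+ 2; set G := \sum_(i <- s) g i ^+ 2.
set H := \sum_(i <- s) f i * g i.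
have q t : 0 <= F - 2 * t * H + t ^+ 2 * G.
  suff <- : \sum_(i <- s) (f i - t * g i) ^+ 2 = F - 2 * t * H + t ^+ 2 * G.
    by apply: sumr_ge0 => i _; exact: sqr_ge0.
  rewrite /F /G /H !mulr_sumr -sumrB -big_split/=.
  by apply: eq_bigr => i _; ring.
have G0 : 0 <= G by apply: sumr_ge0 => i _; exact: sqr_ge0.
have [G0'|Gn0] := eqVneq G 0.
  rewrite G0' mulr0; have [->|H0] := eqVneq H 0; first by rewrite expr0n.
  (* With [G = 0] the nonnegative quadratic is affine in [t]; this [t] would give it the value
     -1. *)
  have := q ((F + 1) / (2 * H)); rewrite G0' mulr0 addr0.
  have -> : F - 2 * ((F + 1) / (2 * H)) * H = - 1 by field.
  by rewrite lerNr oppr0 ler10.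
have := q (H / G); have -> : F - 2 * (H / G) * H + (H / G) ^+ 2 * G = F - H ^+ 2 / G.
  by field.
by rewrite subr_ge0 ler_pdivrMr// lt_def Gn0.
Qed.

Lemma cauchy_schwarz_le (I : Type) (s : seq I) (f g : I -> R) (A B : R) :
  0 <= A -> 0 <= B -> \sum_(i <- s) f i ^+ 2 <= A ^+ 2 ->
  \sum_(i <- s) g i ^+ 2 <= B ^+ 2 -> \sum_(i <- s) f i * g i <= A * B.
Proof.
move=> A0 B0 fA gB.
rewrite (le_trans (ler_norm _))// -(@ler_pXn2r _ 2%N) ?nnegrE ?mulr_ge0//.
rewrite real_normK ?num_real// (le_trans (cauchy_schwarz _ _ _))// exprMn.
by apply: ler_pM => //; apply: sumr_ge0 => i _; exact: sqr_ge0.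
Qed.

Lemma minkowski_le (I : Type) (s : seq I) (f g : I -> R) (A B : R) :
  0 <= A -> 0 <= B -> \sum_(i <- s) f i ^+ 2 <= A ^+ 2 ->
  \sum_(i <- s) g i ^+ 2 <= B ^+ 2 ->
  \sum_(i <- s) (f i + g i) ^+ 2 <= (A + B) ^+ 2.
Proof.
move=> A0 B0 fA gB; have fg := cauchy_schwarz_le A0 B0 fA gB.
have -> : \sum_(i <- s) (f i + g i) ^+ 2 = \sum_(i <- s) f i ^+ 2
    + 2 * (\sum_(i <- s) f i * g i) + \sum_(i <- s) g i ^+ 2.
  by rewrite mulr_sumr -!big_split/=; apply: eq_bigr => i _; ring.
lra.
Qed.

Lemma weighted_cauchy_schwarz (I : Type) (s : seq I) (a f : I -> R) :
  (forall i, 0 <= a i) -> (\sum_(i <- s) a i * f i) ^+ 2 <=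
  (\sum_(i <- s) a i) * (\sum_(i <- s) a i * f i ^+ 2).
Proof.
move=> a0.
have E i : a i * f i = Num.sqrt (a i) * (Num.sqrt (a i) * f i).
  by rewrite mulrA -expr2 sqr_sqrtr.
under eq_bigr do rewrite E; apply: (le_trans (cauchy_schwarz _ _ _)).
under eq_bigr do rewrite sqr_sqrtr//.
by under [X in _ * X]eq_bigr do rewrite exprMn sqr_sqrtr//.
Qed.

End FiniteSums.

(** * Summability on the integers and Young's inequalities for convolutions *)

Section BoundedSums.
Context {R : realType}.
Implicit Types (f g a b : int -> R) (A B : R) (s : seq int).

(** Summability is expressed by a bound common to all duplicate-free finite lists, so that sums can
    be shifted, reflected and exchanged without series. The condition [0 <= A] in [l2b] allows
    squares of bounds to be compared. *)
Definition l1b f A := forall s, uniq s -> \sum_(k <- s) f k <= A.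

Definition l2b f A := 0 <= A /\ forall s, uniq s -> \sum_(k <- s) f k ^+ 2 <= A ^+ 2.

Definition conv s a b (k : int) := \sum_(j <- s) a j * b (k - j).

(** The weight is [1 + |k|] rather than [sqrt (1 + k^2)]; it satisfies [jb k <= jb j + jb (k - j)],
    which distributes weights over the factors of a convolution. *)
Definition jb (k : int) : R := 1 + `|k%:~R|.

Lemma jb_ge1 k : 1 <= jb k. Proof. by rewrite lerDl. Qed.

Lemma jb_gt0 k : 0 < jb k. Proof. exact: lt_le_trans (jb_ge1 k). Qed.

Lemma jb_ge0 k : 0 <= jb k. Proof. exact: ltW (jb_gt0 k). Qed.

Lemma abs_le_jb k : `|k%:~R| <= jb k. Proof. by rewrite lerDr. Qed.

Lemma jb_split k j : jb k <= jb j + jb (k - j).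
Proof.
have := ler_normD (j%:~R : R) (k - j)%:~R; rewrite -intrD subrKC /jb; lra.
Qed.

Lemma l1b_ge0 f A : l1b f A -> 0 <= A.
Proof. by move=> /(_ [::] isT); rewrite big_nil. Qed.

Lemma l1b_le f g A : (forall k, f k <= g k) -> l1b g A -> l1b f A.
Proof. by move=> fg gA s us; apply: le_trans (gA s us); exact: ler_sum. Qed.

Lemma l2b_le f g A : (forall k, `|f k| <= g k) -> l2b g A -> l2b f A.
Proof.
move=> fg [A0 gA]; split=> // s us; apply: le_trans (gA s us).
apply: ler_sum => k _; rewrite -(@real_normK _ (f k)) ?num_real//.
by rewrite ler_pXn2r ?nnegrE// (le_trans _ (fg k)).
Qed.

Lemma l2b_scale c f A : 0 <= c -> l2b f A -> l2b (fun k => c * f k) (c * A).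
Proof.
move=> c0 [A0 fA]; split; first exact: mulr_ge0.
move=> s us; under eq_bigr do rewrite exprMn.
by rewrite -mulr_sumr exprMn ler_wpM2l ?sqr_ge0// fA.
Qed.

Lemma l2b_add f g A B : l2b f A -> l2b g B -> l2b (fun k => f k + g k) (A + B).
Proof.
move=> [A0 fA] [B0 gB]; split; first exact: addr_ge0.
by move=> s us; apply: minkowski_le => //; [exact: fA|exact: gB].
Qed.

Lemma l2b_weaken f A B : A <= B -> l2b f A -> l2b f B.
Proof.
move=> AB [A0 fA]; split; first exact: le_trans AB.
move=> s us; apply: (le_trans (fA s us)).
by rewrite ler_pXn2r ?nnegrE// (le_trans A0).
Qed.

Lemma sum_shift_le f s (p : int) A : (forall s, uniq s -> \sum_(k <- s) f k <= A) ->
  uniq s -> \sum_(k <- s) f (k + p) <= A.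
Proof.
move=> fA us.
have -> : \sum_(k <- s) f (k + p) = \sum_(k <- [seq k + p | k <- s]) f k.
  by rewrite big_map.
by apply: fA; rewrite map_inj_uniq// => x y; exact: addIr.
Qed.

Lemma sum_refl_le f s (p : int) A : (forall s, uniq s -> \sum_(k <- s) f k <= A) ->
  uniq s -> \sum_(k <- s) f (p - k) <= A.
Proof.
move=> fA us.
have -> : \sum_(k <- s) f (p - k) = \sum_(k <- [seq p - k | k <- s]) f k.
  by rewrite big_map.
by apply: fA; rewrite map_inj_uniq// => x y /addrI/oppr_inj.
Qed.

Lemma l2b_shift f A (p : int) : l2b f A -> l2b (fun k => f (k + p)) A.
Proof.
move=> [A0 fA]; split=> // s us.
exact: (@sum_shift_le (fun k => f k ^+ 2)).
Qed.

(** Cauchy-Schwarz with weight [a] bounds the square of the convolution by [A] times the convolution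
    of [a] with the square of [b]; after exchanging the sums, translation invariance bounds the
    inner one. The result is uniform in [s]. *)
Lemma young12 s a b A B : uniq s -> (forall k, 0 <= a k) -> l1b a A -> l2b b B ->
  l2b (conv s a b) (A * B).
Proof.
move=> us a0 aA [B0 bB]; have A0 := l1b_ge0 aA.
split; first exact: mulr_ge0.
move=> t ut; apply: (@le_trans _ _
   (\sum_(k <- t) A * \sum_(j <- s) a j * b (k - j) ^+ 2)).
  apply: ler_sum => k _; rewrite /conv.
  apply: (le_trans (weighted_cauchy_schwarz _ _ a0)).
  rewrite ler_wpM2r//; last exact: aA.
  by apply: sumr_ge0 => j _; rewrite mulr_ge0// sqr_ge0.
rewrite -mulr_sumr exchange_big/= exprMn expr2 -mulrA ler_wpM2l//.
apply: (@le_trans _ _ (\sum_(j <- s) a j * B ^+ 2)).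
  apply: ler_sum => j _; rewrite -mulr_sumr ler_wpM2l//.
  exact: (@sum_shift_le (fun k => b k ^+ 2)).
by rewrite -mulr_suml ler_wpM2r ?sqr_ge0// aA.
Qed.

(** The weight in Cauchy-Schwarz is now [b (k - j)]: summed over [j] it is a reflected sum of [b],
    summed over [k] a translated one. *)
Lemma young21 s a b A B : uniq s -> (forall k, 0 <= b k) -> l2b a A -> l1b b B ->
  l2b (conv s a b) (A * B).
Proof.
move=> us b0 [A0 aA] bB; have B0 := l1b_ge0 bB.
split; first exact: mulr_ge0.
move=> t ut; apply: (@le_trans _ _
   (\sum_(k <- t) B * \sum_(j <- s) b (k - j) * a j ^+ 2)).
  apply: ler_sum => k _; rewrite /conv; under eq_bigr do rewrite mulrC.
  apply: (le_trans (weighted_cauchy_schwarz s a (fun j => b0 (k - j)))).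
  rewrite ler_wpM2r//; last exact: sum_refl_le.
  by apply: sumr_ge0 => j _; rewrite mulr_ge0// sqr_ge0.
rewrite -mulr_sumr exchange_big/= exprMn mulrCA ler_wpM2l//.
under eq_bigr do rewrite -mulr_suml.
apply: (@le_trans _ _ (\sum_(j <- s) B * a j ^+ 2)).
  apply: ler_sum => j _; rewrite ler_wpM2r ?sqr_ge0//.
  exact: sum_shift_le.
by rewrite -mulr_sumr mulrC ler_wpM2r// aA.
Qed.

Lemma sum_inv_sqr (n : nat) : \sum_(i < n) (i.+1%:R ^- 2 : R) <= 2.
Proof.
(* The bound [2 - 1 / (n + 1)] telescopes, whereas the bare constant 2 does not pass through the
   induction. *)
suff H : \sum_(i < n.+1) (i.+1%:R ^- 2 : R) <= 2 - n.+1%:R^-1.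
  apply: (@le_trans _ _ (\sum_(i < n.+1) (i.+1%:R ^- 2 : R))).
    by rewrite big_ord_recr/= lerDl invr_ge0 exprn_ge0.
  by apply: (le_trans H); rewrite gerBl invr_ge0.
elim: n => [|n IH]; first by rewrite big_ord1 expr1n invr1; lra.
rewrite big_ord_recr/=; apply: (le_trans (lerD IH (lexx _))).
rewrite -[n.+2%:R]natr1; have : 1 <= n.+1%:R :> R by rewrite ler1n.
move: n.+1%:R => x x1; rewrite -subr_ge0.
have -> : 2 - (x + 1)^-1 - (2 - x^-1 + (x + 1) ^- 2) =
   1 / (x * (x + 1) ^+ 2) by field; apply/andP; split; apply/eqP; lra.
by rewrite divr_ge0// mulr_ge0 ?exprn_ge0//; lra.
Qed.

(** Any list lies in the union of the two half lines, each of which contributes at most 2; zero is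
    counted twice, and [4 = 2 ^+ 2]. *)
Lemma jb_inv_l2b : l2b (fun k => (jb k)^-1) 2.
Proof.
split=> // s us.
have [n sn] : exists n, forall k, k \in s -> (absz k < n)%N.
  by exists (\max_(k <- s) absz k).+1 => k ks; rewrite ltnS; exact: leq_bigmax_seq.
pose t := [seq i%:Z | i <- iota 0 n] ++ [seq - i%:Z | i <- iota 0 n].
apply: (@le_trans _ _ (\sum_(k <- t) (jb k)^-1 ^+ 2)).
  apply: sum_sub_le => //; last by move=> k; exact: sqr_ge0.
  move=> k ks; rewrite mem_cat.
  have kn := sn k ks.
  case: (leP 0 k) => k0; apply/orP; [left|right]; apply/mapP;
    by exists (absz k); rewrite ?mem_iota//; lia.
rewrite /t big_cat/= !big_map.
have iE : iota 0 n = index_iota 0 n by rewrite /index_iota subn0.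
rewrite iE !big_mkord.
have E (i : 'I_n) : (jb i%:Z)^-1 ^+ 2 = i.+1%:R ^- 2.
  by rewrite /jb exprVn ger0_norm ?ler0z// -natr1 addrC.
have E' (i : 'I_n) : (jb (- i%:Z))^-1 ^+ 2 = i.+1%:R ^- 2.
  by rewrite -E /jb mulrNz normrN.
under eq_bigr do rewrite E; under [X in _ + X]eq_bigr do rewrite E'.
have := sum_inv_sqr n; lra.
Qed.

(** The Sobolev embedding on the Fourier side: Cauchy-Schwarz against [1 / jb] pays one weight to
    pass from l^2 to l^1. *)
Lemma l1b_of_l2b f A : l2b (fun k => jb k * f k) A -> l1b f (2 * A).
Proof.
move=> [A0 fA] s us.
have -> : \sum_(k <- s) f k = \sum_(k <- s) (jb k)^-1 * (jb k * f k).
  by apply: eq_bigr => k _; rewrite mulKf// gt_eqF// jb_gt0.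
by apply: cauchy_schwarz_le => //; [exact: jb_inv_l2b.2|exact: fA].
Qed.

End BoundedSums.

(** * Sums over one period and a discrete Agmon inequality *)

Section PeriodicSums.
Context {R : realType}.
Variable P : nat.
Implicit Types (f g e v : int -> R) (i j : int).

Definition nsum f : R := \sum_(i < P) f i%:Z.

Definition nper f := forall j, f (j + P%:Z) = f j.

Lemma nsumD f g : nsum (fun j => f j + g j) = nsum f + nsum g.
Proof. exact: big_split. Qed.

Lemma nsumZ (k : R) f : nsum (fun j => k * f j) = k * nsum f.
Proof. by rewrite /nsum mulr_sumr. Qed.

Lemma nsum_le f g : (forall j, f j <= g j) -> nsum f <= nsum g.
Proof. by move=> fg; apply: ler_sum. Qed.

Lemma nsum_ge0 f : (forall j, 0 <= f j) -> 0 <= nsum f.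
Proof. by move=> f0; apply: sumr_ge0. Qed.

Lemma eq_nsum f g : (forall j, f j = g j) -> nsum f = nsum g.
Proof. by move=> fg; apply: eq_bigr. Qed.

Lemma nsum_shift1 f : nper f -> nsum (fun j => f (j + 1)) = nsum f.
Proof.
move=> pf; rewrite /nsum; case E : P => [|n]; first by rewrite !big_ord0.
rewrite big_ord_recr big_ord_recl/= [RHS]addrC; congr (_ + _).
  by apply: eq_bigr => i _; congr f; rewrite /bump; lia.
by rewrite -(pf 0) E; congr f; lia.
Qed.

Lemma nper_shift f i : nper f -> nper (fun j => f (j + i)).
Proof. by move=> pf j; rewrite addrAC pf. Qed.

Lemma nsum_shift f i : nper f -> nsum (fun j => f (j + i)) = nsum f.
Proof.
have nat_case n g : nper g -> nsum (fun j => g (j + n%:Z)) = nsum g.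
  move=> pg; elim: n => [|n IH]; first by apply: eq_nsum => j; rewrite addr0.
  rewrite -IH -(nsum_shift1 (nper_shift n%:Z pg)); apply: eq_nsum => j.
  by congr g; lia.
move=> pf; case: i => n; first exact: nat_case.
rewrite -(nat_case n.+1 _ (nper_shift (Negz n) pf)).
by apply: eq_nsum => j; congr f; lia.
Qed.

(* As [P] is odd, steps of length two reach every node. *)
Lemma two_step_variation f i (k : nat) : odd P -> (k < P)%N -> nper f ->
  `|f (i + k%:Z) - f i| <= 2 * nsum (fun j => `|f (j + 2) - f j|).
Proof.
move=> oP kP pf; pose g j := `|f (j + 2) - f j|.
have g0 j : 0 <= g j by exact: normr_ge0.
have pg : nper g by move=> j; rewrite /g pf addrAC pf.
have tele m : `|f (i + (2 * m)%:Z) - f i| <= \sum_(l < 2 * m) g (i + l%:Z).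
  elim: m => [|m IH]; first by rewrite addr0 subrr normr0 big_ord0.
  have -> : (2 * m.+1 = (2 * m).+2)%N by lia.
  rewrite !big_ord_recr/=; apply: (@le_trans _ _ (`|f (i + (2 * m)%:Z) - f i| + g (i + (2 * m)%:Z))).
    rewrite /g -[X in X <= _](_ : `|(f (i + (2 * m)%:Z) - f i) +
       (f (i + (2 * m)%:Z + 2) - f (i + (2 * m)%:Z))| = _); first exact: ler_normD.
    congr `| _ |; have -> : i + (2 * m).+2%:Z = i + (2 * m)%:Z + 2 by lia.
    by ring.
  by apply: (le_trans (lerD IH (lexx _))); rewrite lerDl.
have bound m : (2 * m <= 2 * P)%N ->
    `|f (i + (2 * m)%:Z) - f i| <= 2 * nsum g.
  move=> mP; apply: (le_trans (tele m)).
  apply: (@le_trans _ _ (\sum_(l < 2 * P) g (i + l%:Z))).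
    move: (2 * m)%N (2 * P)%N mP => p q pq; rewrite -(subnKC pq).
    by rewrite big_split_ord/= lerDl sumr_ge0.
  have -> : (2 * P = P + P)%N by lia.
  rewrite big_split_ord/= mulr_natl mulr2n -(nsum_shift i pg) lerD//.
    by apply: ler_sum => l _; rewrite addrC.
  apply: ler_sum => l _; have -> : i + (P + l)%N%:Z = l%:Z + i + P%:Z by lia.
  by rewrite pg.
case: (boolP (odd k)) => ok.
  have -> : f (i + k%:Z) = f (i + (2 * (k + P)./2)%:Z).
    by rewrite -(pf (i + k%:Z)); congr f; lia.
  by apply: bound; lia.
have {1}-> : k = (2 * k./2)%N by lia.
by apply: bound; lia.
Qed.

(** Averaging the variation bound over all nodes compares a point value with the mean. The variation
    uses distance two because, for [f] the square of the error, it factors through the central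
    difference, the only difference for which some dissipation is left over. *)
Lemma nper_le_mean f i : odd P -> nper f ->
  P%:R * f i <= nsum f + P%:R * (2 * nsum (fun j => `|f (j + 2) - f j|)).
Proof.
move=> oP pf.
set V := 2 * _.
have -> : P%:R * f i = \sum_(k < P) f i by rewrite sumr_const card_ord mulr_natl.
have -> : P%:R * V = \sum_(k < P) V by rewrite sumr_const card_ord mulr_natl.
rewrite -(nsum_shift i pf) -big_split/=; apply: ler_sum => k _.
have := two_step_variation i oP (ltn_ord k) pf; rewrite -/V ler_norml.
by rewrite [k%:Z + i]addrC => /andP[]; lra.
Qed.

End PeriodicSums.

(** * Energy estimate for one nonlinear Lax-Friedrichs step *)

Section Stability.
Context {R : realType}.

(* The error [e] of a step around the profile [v], with [lam = tau / h]; the linear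
   part of the difference of squares (v + e)^2 - v^2 is [2 v e]. *)
Definition lf_step (lam c : R) (v e : int -> R) (j : int) : R :=
  let F i := 2 * v i * e i + e i ^+ 2 in
  e j - lam / 4 * (F (j + 1) - F (j - 1))
  + c * lam / 2 * (e (j + 1) - 2 * e j + e (j - 1)).

(** The multiple of [B] is 1 + 2 + 4 + 2: two summations by parts, the cross term on the
    differences, and the cross term on the two neighbours. [B ^+ 2 / c] is the square of the
    variation term. Next, [136 = 4 (2 + 8 * 4)] comes from the cubic terms with [Sd <= 4 E],
    [544 = 4 * 136] from the factor 4 in Agmon's bound, and the last term from a second use of
    [amgm]. *)
Definition stab_const (B c : R) : R := 9 * B + B ^+ 2 / c + 136 / c + 16 * 544 ^+ 2 / c ^+ 3.

(** In the squared step, the cross terms with [e] and the mixed term [v d m] are kept exactly, since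
    they gain only after summation by parts. Of the rest, the condition [c * lam <= 1] turns the
    squares into at most [c * lam] times [d ^+ 2] and [3 / 4 * m ^+ 2], and every term due to the
    variation of [v] carries a factor [h]. *)
Lemma lf_pointwise (lam c v vp vm e ep em B h M1 eps : R) :
  0 < c -> 0 <= lam -> c * lam <= 1 -> 0 < h <= 1 -> 0 <= B -> 0 <= M1 ->
  `|v| <= M1 -> `|vp - v| <= B * h -> `|v - vm| <= B * h ->
  0 <= eps -> `|ep| <= eps -> `|em| <= eps -> (M1 + eps) ^+ 2 <= 3 / 4 * c ^+ 2 ->
  let F w x := 2 * w * x + x ^+ 2 in
  let m := (ep - em) / 2 in
  let d := (ep - 2 * e + em) / 2 in
  is_true ((e - lam / 4 * (F vp ep - F vm em) + c * lam / 2 * (ep - 2 * e + em)) ^+ 2 <=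
  (e ^+ 2 - lam / 2 * (e * (F vp ep - F vm em)) + 2 * c * lam * (e * d)
     - 2 * c * lam ^+ 2 * (v * d * m))
  + c * lam * d ^+ 2 + 3 / 4 * c * lam * m ^+ 2 + 2 * lam * eps * (`|d| * `|m|)
  + lam * h * B * (d ^+ 2 + m ^+ 2 + ep ^+ 2 + em ^+ 2)
  + lam * h * (B ^+ 2 / (2 * c)) * (ep ^+ 2 + em ^+ 2)).
Proof.
move=> c0 l0 cl /andP[h0 h1] B0 M0 vM vpB vmB eps0 epe eme Me F m d.
(* [a] is the local speed: the flux difference equals [4 * a * m + rho], with [rho] collecting the
   variation of the profile. The step is then [e + Y - lam / 4 * rho]. *)
pose a := v + (ep + em) / 2.
pose rho := 2 * (vp - v) * ep + 2 * (v - vm) * em.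
pose Y := lam * (c * d - a * m).
have aM : `|a| <= M1 + eps.
  apply: (le_trans (ler_normD _ _)); rewrite lerD//.
  rewrite normrM (@ger0_norm _ 2^-1) ?invr_ge0//.
  have := ler_normD ep em; lra.
have a2 : a ^+ 2 <= 3 / 4 * c ^+ 2.
  apply: le_trans Me; rewrite -(@real_normK _ a) ?num_real//.
  by rewrite ler_pXn2r ?nnegrE// addr_ge0.
have ac : `|a| <= c.
  rewrite -(@ler_pXn2r _ 2%N) ?nnegrE ?(ltW c0)// real_normK ?num_real//.
  apply: (le_trans a2); have := sqr_ge0 c; lra.
have E : e - lam / 4 * (F vp ep - F vm em) + c * lam / 2 * (ep - 2 * e + em)
   = e + (Y - lam / 4 * rho) by rewrite /Y /F /rho /a /d /m; field.
have L : e ^+ 2 - lam / 2 * (e * (F vp ep - F vm em)) + 2 * c * lam * (e * d)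
   = e ^+ 2 + 2 * e * (Y - lam / 4 * rho) by rewrite /Y /F /rho /a /d /m; field.
rewrite E L; clear E L; clearbody F m d.
have -> : (e + (Y - lam / 4 * rho)) ^+ 2 = e ^+ 2 + 2 * e * (Y - lam / 4 * rho)
   + Y ^+ 2 - lam / 2 * (Y * rho) + lam ^+ 2 * rho ^+ 2 / 16 by field.
have Y2 : Y ^+ 2 <= - 2 * c * lam ^+ 2 * (v * d * m) + c * lam * d ^+ 2
    + 3 / 4 * c * lam * m ^+ 2 + 2 * lam * eps * (`|d| * `|m|).
  have -> : Y ^+ 2 = - 2 * c * lam ^+ 2 * (v * d * m)
     + (c * lam) * (c * lam) * d ^+ 2
     + lam ^+ 2 * a ^+ 2 * m ^+ 2 - (c * lam) * lam * ((ep + em) * (d * m)).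
    by rewrite /Y /a; field.
  have t1 : (c * lam) * (c * lam) * d ^+ 2 <= c * lam * d ^+ 2.
    rewrite ler_wpM2r ?sqr_ge0// ler_piMr// mulr_ge0//; exact: ltW.
  have t2 : lam ^+ 2 * a ^+ 2 * m ^+ 2 <= 3 / 4 * c * lam * m ^+ 2.
    rewrite ler_wpM2r ?sqr_ge0//.
    apply: (@le_trans _ _ (lam ^+ 2 * (3 / 4 * c ^+ 2))).
      by rewrite ler_wpM2l// sqr_ge0.
    have := mulr_ge0 (ltW c0) l0; nra.
  have t3 : - ((c * lam) * lam * ((ep + em) * (d * m))) <= 2 * lam * eps * (`|d| * `|m|).
    apply: (le_trans (ler_norm _)); rewrite normrN !normrM.
    rewrite (@ger0_norm _ c) ?(ltW c0)// (@ger0_norm _ lam)//.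
    have s2 : `|ep + em| <= 2 * eps by have := ler_normD ep em; lra.
    apply: (@le_trans _ _ (1 * lam * ((2 * eps) * (`|d| * `|m|)))); last lra.
    apply: ler_pM; rewrite ?mulr_ge0//; try exact: ltW.
    - by rewrite ler_wpM2r.
    - by rewrite ler_wpM2r// mulr_ge0.
  lra.
have rhoB : `|rho| <= 2 * (B * h) * (`|ep| + `|em|).
  apply: (le_trans (ler_normD _ _)); rewrite !normrM !(@ger0_norm _ 2)//.
  have := ler_wpM2r (normr_ge0 ep) vpB; have := ler_wpM2r (normr_ge0 em) vmB; lra.
have Yb : `|Y| <= lam * c * (`|d| + `|m|).
  rewrite /Y normrM (@ger0_norm _ lam)// -mulrA ler_wpM2l//.
  apply: (le_trans (ler_normB _ _)); rewrite !normrM (@ger0_norm _ c) ?(ltW c0)//.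
  by rewrite mulrDr lerD2l ler_wpM2r.
have sq (x : R) : `|x| ^+ 2 = x ^+ 2 by rewrite real_normK ?num_real.
have Yr : - (lam / 2 * (Y * rho)) <= lam * h * B * (d ^+ 2 + m ^+ 2 + ep ^+ 2 + em ^+ 2).
  apply: (@le_trans _ _ (lam / 2 * (`|Y| * `|rho|))).
    rewrite -mulrN ler_wpM2l ?divr_ge0// -normrM -normrN; exact: ler_norm.
  apply: (@le_trans _ _ (lam / 2 * ((`|d| + `|m|) * (2 * (B * h) * (`|ep| + `|em|))))).
    rewrite ler_wpM2l ?divr_ge0//; apply: ler_pM => //.
    apply: (le_trans Yb); rewrite ler_piMl ?addr_ge0//; lra.
  have -> : lam / 2 * ((`|d| + `|m|) * (2 * (B * h) * (`|ep| + `|em|))) =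
    lam * h * B * ((`|d| + `|m|) * (`|ep| + `|em|)) by field.
  rewrite ler_wpM2l ?mulr_ge0 ?(ltW h0)//.
  rewrite -(sq d) -(sq m) -(sq ep) -(sq em).
  have := sqr_ge0 (`|d| + `|m| - (`|ep| + `|em|)).
  have := sqr_ge0 (`|d| - `|m|); have := sqr_ge0 (`|ep| - `|em|); lra.
have rr : lam ^+ 2 * rho ^+ 2 / 16 <= lam * h * (B ^+ 2 / (2 * c)) * (ep ^+ 2 + em ^+ 2).
  have r2 : rho ^+ 2 <= 8 * (B * h) ^+ 2 * (ep ^+ 2 + em ^+ 2).
    rewrite -(sq rho); apply: (@le_trans _ _ ((2 * (B * h) * (`|ep| + `|em|)) ^+ 2)).
      by rewrite ler_pXn2r ?nnegrE// !mulr_ge0 ?addr_ge0// ltW.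
    rewrite exprMn exprMn -(sq ep) -(sq em).
    have -> : 2 ^+ 2 * (B * h) ^+ 2 * (`|ep| + `|em|) ^+ 2 =
       (B * h) ^+ 2 * (4 * (`|ep| + `|em|) ^+ 2) by ring.
    have -> : 8 * (B * h) ^+ 2 * (`|ep| ^+ 2 + `|em| ^+ 2) =
       (B * h) ^+ 2 * (8 * (`|ep| ^+ 2 + `|em| ^+ 2)) by ring.
    rewrite ler_wpM2l ?sqr_ge0//; have := sqr_ge0 (`|ep| - `|em|); lra.
  have lc : lam <= 1 / c by rewrite ler_pdivlMr// mulrC.
  have s0 : 0 <= ep ^+ 2 + em ^+ 2 by rewrite addr_ge0 ?sqr_ge0.
  apply: (@le_trans _ _ (lam * (1 / c) * (8 * (B * h) ^+ 2 * (ep ^+ 2 + em ^+ 2)) / 16)).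
    rewrite ler_wpM2r ?invr_ge0//; apply: ler_pM; rewrite ?sqr_ge0//.
    by rewrite expr2 ler_wpM2l.
  have -> : lam * (1 / c) * (8 * (B * h) ^+ 2 * (ep ^+ 2 + em ^+ 2)) / 16 =
    h * (lam * h * (B ^+ 2 / (2 * c)) * (ep ^+ 2 + em ^+ 2)) by field; exact: lt0r_neq0.
  rewrite ler_piMl// !mulr_ge0 ?sqr_ge0 ?invr_ge0//; try exact: ltW.
  by rewrite mulr_ge0// ltW.
lra.
Qed.

End Stability.

Section StabilityTheorem.
Context {R : realType}.

(** A quarter of the dissipation of [m], that is [c / 4], is left over in the energy estimate; two
    uses with weight [c / 16] stay below it. *)
Lemma amgm (c x y : R) : 0 < c -> x * y <= c / 16 * x ^+ 2 + 4 / c * y ^+ 2.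
Proof.
move=> c0; rewrite -subr_ge0.
have -> : c / 16 * x ^+ 2 + 4 / c * y ^+ 2 - x * y = (c / 4 * x - 2 * y) ^+ 2 / c.
  by field; exact: lt0r_neq0.
by rewrite divr_ge0 ?sqr_ge0// ltW.
Qed.

(** Summation by parts turns [2 c lam (e, d)] into the dissipation [- c lam (Sm + Sd)]. The squares
    of [lf_pointwise] consume all of [Sd] and three quarters of [Sm]. Differences falling on [v]
    cost [O(lam h)]; the cubic terms, of size [eps], are absorbed by the remaining quarter of [Sm]
    up to a multiple of [lam h E] that is independent of the size of the error. *)
Lemma lf_stability (P : nat) (lam c h B M1 : R) (v e : int -> R) :
  odd P -> 0 < c -> 0 <= lam -> c * lam <= 1 -> 0 < h <= 1 -> P%:R^-1 <= h ->
  0 <= B -> 0 <= M1 -> 2 * M1 ^+ 2 <= c ^+ 2 ->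
  nper P v -> nper P e ->
  (forall j, `|v j| <= M1) -> (forall j, `|v (j + 1) - v j| <= B * h) ->
  let E := nsum P (fun j => e j ^+ 2) in
  E <= 1 -> 40 * E <= c ^+ 2 -> E ^+ 2 <= h ->
  nsum P (fun j => lf_step lam c v e j ^+ 2) <=
    (1 + stab_const B c * (lam * h)) * E.
Proof.
move=> oP c0 l0 cl h01 Ph B0 M0 Mc pv pe vM vB E E1 Ec Eh.
have P0 : (0 < P)%N by case: P oP {Ph pv pe E E1 Ec Eh}.
have [h0 h1] := andP h01.
pose ep j := e (j + 1); pose em j := e (j - 1).
pose vp j := v (j + 1); pose vm j := v (j - 1).
pose F (w x : R) := 2 * w * x + x ^+ 2.
pose m j := (ep j - em j) / 2.
pose d j := (ep j - 2 * e j + em j) / 2.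
pose S := @nsum R P.
have shift1 f : nper P f -> S f = S (fun j => f (j + 1)).
  by move=> pf; rewrite /S nsum_shift1.
have pep : nper P ep by exact: nper_shift.
have pem : nper P em by exact: nper_shift.
have pvp : nper P vp by exact: nper_shift.
have pvm : nper P vm by exact: nper_shift.
have E0 : 0 <= E by apply: nsum_ge0 => j; exact: sqr_ge0.
have Eep : S (fun j => ep j ^+ 2) = E.
  by rewrite /S /E -(@nsum_shift1 _ P (fun j => e j ^+ 2))// => j; rewrite pe.
have Eem : S (fun j => em j ^+ 2) = E.
  by rewrite /S /E -(@nsum_shift _ P (fun j => e j ^+ 2) (-1))// => j; rewrite pe.
pose Sm := S (fun j => m j ^+ 2); pose Sd := S (fun j => d j ^+ 2).
pose C1 := S (fun j => e j * ep j).
have Sm0 : 0 <= Sm by apply: nsum_ge0 => j; exact: sqr_ge0.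
have Sd0 : 0 <= Sd by apply: nsum_ge0 => j; exact: sqr_ge0.
have C1' : S (fun j => e j * em j) = C1.
  rewrite shift1 /C1; last by move=> j; rewrite pe pem.
  by apply: eq_nsum => j; rewrite /em addrK /ep mulrC.
have Sed : S (fun j => e j * d j) = C1 - E.
  have -> : S (fun j => e j * d j) = 2^-1 * C1 + (-1) * E + 2^-1 * S (fun j => e j * em j).
    by rewrite /S /C1 /E -!nsumZ -!nsumD; apply: eq_nsum => j; rewrite /d; field.
  by rewrite C1'; field.
have Smd : Sm + Sd = 2 * E - 2 * C1.
  have -> : Sm + Sd = 2^-1 * S (fun j => ep j ^+ 2) + 2^-1 * S (fun j => em j ^+ 2)
     + 1 * E + (-1) * C1 + (-1) * S (fun j => e j * em j).
    rewrite /Sm /Sd /S /C1 /E -!nsumZ -!nsumD; apply: eq_nsum => j.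
    by rewrite /m /d; field.
  by rewrite C1' Eep Eem; field.
have C1E : - C1 <= E.
  have -> : E = 2^-1 * E + 2^-1 * S (fun j => ep j ^+ 2) by rewrite Eep; field.
  rewrite -mulN1r /C1 /S /E -!nsumZ -!nsumD; apply: nsum_le => j.
  have := sqr_ge0 (e j + ep j); lra.
have Smd4 : Sm + Sd <= 4 * E by lra.
have SeF : S (fun j => e j * (F (vp j) (ep j) - F (vm j) (em j))) =
    -2 * S (fun j => F (v j) (e j) * m j).
  have a1 : S (fun j => e j * F (vp j) (ep j)) = S (fun j => em j * F (v j) (e j)).
    rewrite [RHS]shift1; last by move=> j; rewrite pe pem pv.
    by apply: eq_nsum => j; rewrite /em addrK.
  have a2 : S (fun j => e j * F (vm j) (em j)) = S (fun j => ep j * F (v j) (e j)).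
    rewrite [LHS]shift1; last by move=> j; rewrite pe pem pvm.
    by apply: eq_nsum => j; rewrite /em /vm addrK.
  have -> : S (fun j => e j * (F (vp j) (ep j) - F (vm j) (em j))) =
      S (fun j => e j * F (vp j) (ep j)) + (-1) * S (fun j => e j * F (vm j) (em j)).
    by rewrite /S -!nsumZ -!nsumD; apply: eq_nsum => j; ring.
  rewrite a1 a2 /S -!nsumZ -!nsumD; apply: eq_nsum => j.
  by rewrite /m; field.
have SFm : S (fun j => F (v j) (e j) * m j) =
    (-1) * S (fun j => (vp j - v j) * (e j * ep j)) + S (fun j => e j ^+ 2 * m j).
  have a1 : S (fun j => v j * e j * em j) = S (fun j => vp j * (e j * ep j)).
    rewrite shift1; last by move=> j; rewrite pe pem pv.
    by apply: eq_nsum => j; rewrite /em addrK /vp /ep; ring.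
  have -> : S (fun j => F (v j) (e j) * m j) = S (fun j => v j * (e j * ep j))
      + (-1) * S (fun j => v j * e j * em j) + S (fun j => e j ^+ 2 * m j).
    by rewrite /S -!nsumZ -!nsumD; apply: eq_nsum => j; rewrite /F /m; field.
  by rewrite a1 /S -!nsumZ -!nsumD; apply: eq_nsum => j; ring.
(* [4 d m] is the difference of the squares of two consecutive forward differences of [e], so
   summation by parts moves the difference to [v]. *)
have Svdm : S (fun j => v j * d j * m j) =
    - 4^-1 * S (fun j => (vp j - v j) * (ep j - e j) ^+ 2).
  have a1 : S (fun j => v j * (e j - em j) ^+ 2) = S (fun j => vp j * (ep j - e j) ^+ 2).
    rewrite shift1; last by move=> j; rewrite pe pem pv.
    by apply: eq_nsum => j; rewrite /em addrK.
  have -> : S (fun j => v j * d j * m j) = 4^-1 * S (fun j => v j * (ep j - e j) ^+ 2)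
      + - 4^-1 * S (fun j => v j * (e j - em j) ^+ 2).
    by rewrite /S -!nsumZ -!nsumD; apply: eq_nsum => j; rewrite /d /m; field.
  by rewrite a1 /S -!nsumZ -!nsumD; apply: eq_nsum => j; field.
have Sp : S (fun j => (ep j - e j) ^+ 2) = Sm + Sd.
  have -> : S (fun j => (ep j - e j) ^+ 2) =
      1 * S (fun j => ep j ^+ 2) + (-2) * C1 + 1 * E.
    by rewrite /S /C1 /E -!nsumZ -!nsumD; apply: eq_nsum => j; ring.
  by rewrite Eep Smd; ring.
have b1 : (-1) * S (fun j => (vp j - v j) * (e j * ep j)) <= B * h * E.
  have -> : B * h * E = B * h / 2 * E + B * h / 2 * S (fun j => ep j ^+ 2).
    by rewrite Eep; field.
  rewrite /S /E -!nsumZ -!nsumD; apply: nsum_le => j.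
  rewrite mulN1r; apply: (le_trans (ler_norm _)); rewrite normrN !normrM.
  apply: (@le_trans _ _ (B * h * (`|e j| * `|ep j|))).
    by rewrite ler_wpM2r ?mulr_ge0//; exact: vB.
  rewrite -!mulrDr -mulrA -mulrA -mulrA ler_wpM2l// ler_wpM2l ?(ltW h0)//.
  rewrite -(@real_normK _ (e j)) ?num_real// -(@real_normK _ (ep j)) ?num_real//.
  have := sqr_ge0 (`|e j| - `|ep j|); lra.
have b2 : S (fun j => (vp j - v j) * (ep j - e j) ^+ 2) <= B * h * (4 * E).
  apply: (@le_trans _ _ (B * h * (Sm + Sd))); last first.
    by rewrite ler_wpM2l ?mulr_ge0// ltW.
  rewrite -Sp /S -!nsumZ; apply: nsum_le => j; rewrite ler_wpM2r ?sqr_ge0//.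
  by apply: (le_trans (ler_norm _)); exact: vB.
pose W := S (fun j => `|ep j + em j| * `|m j|).
have W0 : 0 <= W by apply: nsum_ge0 => j; rewrite mulr_ge0.
(* [eps] bounds the maximum norm of [e] in two ways: by [E], for the bound on the local speed, and
   by Agmon's inequality, for the growth rate. *)
pose eps := Num.sqrt (Num.min E (E / P%:R + 4 * W)).
have PR : 0 < P%:R :> R by rewrite ltr0n.
have mn0 : 0 <= Num.min E (E / P%:R + 4 * W).
  by rewrite le_min E0 addr_ge0 ?mulr_ge0 ?invr_ge0 ?(ltW PR).
have eps2 : eps ^+ 2 = Num.min E (E / P%:R + 4 * W) by rewrite sqr_sqrtr.
have eps0 : 0 <= eps by exact: sqrtr_ge0.
have epsE : eps ^+ 2 <= E by rewrite eps2 ge_min lexx.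
have epsA : eps ^+ 2 <= E / P%:R + 4 * W by rewrite eps2 ge_min lexx orbT.
have pe2 : nper P (fun j => e j ^+ 2) by move=> j; rewrite pe.
have eB j : `|e j| <= eps.
  rewrite -(@ler_pXn2r _ 2%N) ?nnegrE// eps2 real_normK ?num_real// le_min.
  apply/andP; split.
    rewrite /E -(nsum_shift j pe2) /nsum.
    case: (P) P0 => // n _; rewrite big_ord_recl/= add0r lerDl.
    by apply: sumr_ge0 => i _; exact: sqr_ge0.
  have := nper_le_mean j oP pe2; rewrite -/E.
  set V := nsum P _; have -> : V = 2 * W.
    rewrite /V -(nsum_shift (-1)); last first.
      by move=> i; rewrite pe addrAC pe.
    rewrite /W /S -nsumZ; apply: eq_nsum => i.
    rewrite -addrA -[-1 + 2]/(1 : int) -/(ep i) -/(em i) subr_sqr normrM mulrC.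
    rewrite mulrCA; congr (_ * _); rewrite /m normrM (@ger0_norm _ 2^-1) ?invr_ge0//.
    by field.
  move=> H; rewrite -(ler_pM2l PR); apply: (le_trans H).
  by rewrite mulrDr [_ * (E / _)]mulrCA divff ?gt_eqF// mulr1; lra.
(* Here [(M1 + eps) ^+ 2 <= 5 / 4 * M1 ^+ 2 + 5 * eps ^+ 2], and [5 / 8 + 5 / 40 = 3 / 4]: this is
   the origin of the factor 40 in the smallness condition. *)
have Meps : (M1 + eps) ^+ 2 <= 3 / 4 * c ^+ 2.
  have := sqr_ge0 (M1 / 2 - 2 * eps); lra.
have key j : lf_step lam c v e j ^+ 2 <=
  (e j ^+ 2 - lam / 2 * (e j * (F (vp j) (ep j) - F (vm j) (em j)))
     + 2 * c * lam * (e j * d j) - 2 * c * lam ^+ 2 * (v j * d j * m j))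
  + c * lam * d j ^+ 2 + 3 / 4 * c * lam * m j ^+ 2 + 2 * lam * eps * (`|d j| * `|m j|)
  + lam * h * B * (d j ^+ 2 + m j ^+ 2 + ep j ^+ 2 + em j ^+ 2)
  + lam * h * (B ^+ 2 / (2 * c)) * (ep j ^+ 2 + em j ^+ 2).
  apply: (@lf_pointwise _ lam c (v j) (vp j) (vm j) (e j) (ep j) (em j) B h M1 eps) => //.
  - exact: vB.
  - by have := vB (j - 1); rewrite subrK.
  - exact: eB.
  - exact: eB.
pose Q2 := S (fun j => `|d j| * `|m j|).
apply: (le_trans (nsum_le P key)).
have -> : nsum P (fun j =>
  (e j ^+ 2 - lam / 2 * (e j * (F (vp j) (ep j) - F (vm j) (em j)))
     + 2 * c * lam * (e j * d j) - 2 * c * lam ^+ 2 * (v j * d j * m j))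
  + c * lam * d j ^+ 2 + 3 / 4 * c * lam * m j ^+ 2 + 2 * lam * eps * (`|d j| * `|m j|)
  + lam * h * B * (d j ^+ 2 + m j ^+ 2 + ep j ^+ 2 + em j ^+ 2)
  + lam * h * (B ^+ 2 / (2 * c)) * (ep j ^+ 2 + em j ^+ 2)) =
  1 * E + (- (lam / 2)) * S (fun j => e j * (F (vp j) (ep j) - F (vm j) (em j)))
  + (2 * c * lam) * S (fun j => e j * d j)
  + (- (2 * c * lam ^+ 2)) * S (fun j => v j * d j * m j)
  + (c * lam + lam * h * B) * Sd + (3 / 4 * c * lam + lam * h * B) * Sm
  + (2 * lam * eps) * Q2
  + (lam * h * B + lam * h * (B ^+ 2 / (2 * c))) * S (fun j => ep j ^+ 2)
  + (lam * h * B + lam * h * (B ^+ 2 / (2 * c))) * S (fun j => em j ^+ 2).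
  rewrite /S /Sd /Sm /Q2 /E /S -!nsumZ -!nsumD; apply: eq_nsum => j.
  by ring.
rewrite SeF SFm Sed Svdm Eep Eem.
set T1 := (-1) * S (fun j => (vp j - v j) * (e j * ep j)) in b1 *.
set T2 := S (fun j => (vp j - v j) * (ep j - e j) ^+ 2) in b2 *.
pose Q1 := S (fun j => `|e j| * `|m j|).
have b3 : S (fun j => e j ^+ 2 * m j) <= eps * Q1.
  rewrite /Q1 /S -nsumZ; apply: nsum_le => j.
  apply: (le_trans (ler_norm _)); rewrite normrM mulrA ler_wpM2r// expr2 normrM.
  by rewrite ler_wpM2r.
set T3 := S (fun j => e j ^+ 2 * m j) in b3 *.
have Q12 : eps * Q1 + 2 * eps * Q2 <= c / 16 * Sm + 136 / c * eps ^+ 2 * E.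
  apply: (@le_trans _ _ (c / 16 * Sm + 4 / c * eps ^+ 2 * (2 * E) + 4 / c * eps ^+ 2 * (8 * Sd))).
    rewrite /Q1 /Q2 /Sm /Sd /E /S -!nsumZ -!nsumD; apply: nsum_le => j.
    have := amgm (`|m j|) (eps * (`|e j| + 2 * `|d j|)) c0.
    rewrite -(@real_normK _ (m j)) ?num_real// -(@real_normK _ (e j)) ?num_real//.
    rewrite -(@real_normK _ (d j)) ?num_real//.
    move=> H; rewrite [X in X <= _](_ : _ = `|m j| * (eps * (`|e j| + 2 * `|d j|))); last by ring.
    apply: (le_trans H); rewrite -addrA lerD2l exprMn.
    have K0 : 0 <= 4 / c * eps ^+ 2 by rewrite mulr_ge0 ?sqr_ge0// divr_ge0// ltW.
    have K1 : (`|e j| + 2 * `|d j|) ^+ 2 <= 2 * `|e j| ^+ 2 + 8 * `|d j| ^+ 2.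
      have := sqr_ge0 (`|e j| - 2 * `|d j|); lra.
    have := ler_wpM2l K0 K1; lra.
  rewrite -addrA lerD2l.
  have K0 : 0 <= eps ^+ 2 / c by rewrite divr_ge0 ?sqr_ge0// ltW.
  have SdE : Sd <= 4 * E by lra.
  have := ler_wpM2l K0 SdE; lra.
have W1k (k : R) : k * W <= c / 16 * Sm + 4 / c * k ^+ 2 *
    (2 * S (fun j => ep j ^+ 2) + 2 * S (fun j => em j ^+ 2)).
  rewrite [X in _ <= _ + X]mulrDr !mulrA /W /Sm /S -!nsumZ -!nsumD.
  apply: nsum_le => j.
  have := amgm (`|m j|) (k * `|ep j + em j|) c0.
  rewrite [(k * _) ^+ 2]exprMn !real_normK ?num_real// => H.
  rewrite [X in X <= _](_ : _ = `|m j| * (k * `|ep j + em j|)); last by ring.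
  apply: (le_trans H).
  have K0 : 0 <= 4 / c * k ^+ 2 by rewrite mulr_ge0 ?sqr_ge0// divr_ge0// ltW.
  have K1 : (ep j + em j) ^+ 2 <= 2 * ep j ^+ 2 + 2 * em j ^+ 2.
    by have := sqr_ge0 (ep j - em j); lra.
  have := ler_wpM2l K0 K1; lra.
have W1 : 544 / c * E * W <= c / 16 * Sm + 16 * 544 ^+ 2 / c ^+ 3 * E ^+ 2 * E.
  apply: (le_trans (W1k _)).
  rewrite Eep Eem lerD2l le_eqVlt; apply/orP; left; apply/eqP; field.
  exact: lt0r_neq0.
have c1 : 0 <= c^-1 by rewrite invr_ge0 ltW.
(* In Agmon's bound the mean is at most [h] because [E <= 1] and [1 / P <= h]; the part with [W]
   costs another [c / 16] of [Sm] and leaves [E ^+ 2 * E], where [E ^+ 2 <= h]. *)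
have epsF : 136 / c * eps ^+ 2 * E <=
    c / 16 * Sm + (136 / c + 16 * 544 ^+ 2 / c ^+ 3) * (h * E).
  apply: (@le_trans _ _ (136 / c * (E / P%:R + 4 * W) * E)).
    by rewrite ler_wpM2r// ler_wpM2l// mulr_ge0.
  have u1 : 136 / c * (E / P%:R) * E <= 136 / c * (h * E).
    rewrite -mulrA ler_wpM2l ?mulr_ge0// ler_wpM2r//.
    apply: (@le_trans _ _ (1 * h)); last by rewrite mul1r.
    by apply: ler_pM => //; rewrite invr_ge0 ltW.
  have u2 : 16 * 544 ^+ 2 / c ^+ 3 * E ^+ 2 * E <= 16 * 544 ^+ 2 / c ^+ 3 * (h * E).
    rewrite -mulrA; apply: ler_wpM2l; last exact: ler_wpM2r.
    apply: mulr_ge0; last by rewrite invr_ge0 exprn_ge0// ltW.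
    by apply: mulr_ge0; [exact: ler0n|apply: exprn_ge0; exact: ler0n].
  have -> : 136 / c * (E / P%:R + 4 * W) * E =
     136 / c * (E / P%:R) * E + 544 / c * E * W by ring.
  lra.
have tot : T1 + T3 + 2 * eps * Q2 <= B * h * E + c / 8 * Sm
    + (136 / c + 16 * 544 ^+ 2 / c ^+ 3) * (h * E) by lra.
have tot' := ler_wpM2l l0 tot.
have cl2 : c * lam ^+ 2 / 2 * T2 <= lam / 2 * (B * h * (4 * E)).
  apply: (@le_trans _ _ (c * lam ^+ 2 / 2 * (B * h * (4 * E)))).
    by rewrite ler_wpM2l// divr_ge0// mulr_ge0 ?sqr_ge0// ltW.
  have K0 : 0 <= lam / 2 * (B * h * (4 * E)).
    by rewrite !mulr_ge0// ltW.
  have := ler_wpM2r K0 cl; rewrite mul1r; apply: le_trans.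
  by rewrite le_eqVlt; apply/orP; left; apply/eqP; ring.
have K1 : 0 <= lam * h * B by rewrite !mulr_ge0// ltW.
have mdl := ler_wpM2l K1 Smd4.
have K2 : 0 <= lam * c * Sm by rewrite !mulr_ge0// ltW.
have clC : 2 * c * lam * (C1 - E) = - (c * lam * (Sm + Sd)) by rewrite Smd; ring.
rewrite /stab_const clC.
have -> : lam * h * (B ^+ 2 / (2 * c)) = lam * h * (B ^+ 2 / c) / 2.
  by field; exact: lt0r_neq0.
lra.
Qed.

End StabilityTheorem.

(** * Real integrable and square-integrable functions on one period *)

Section RealL2.
Context {R : realType}.
Implicit Types (f g b : R -> R).

Local Notation mu := (@lebesgue_measure R).
Local Notation Om := (@Omega R).

Definition intg f := mu.-integrable Om (EFin \o f).
Definition Int f : R := \int[mu]_(x in Om) f x.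
Definition L2r f := measurable_fun Om f /\ intg (fun x => f x ^+ 2).

Lemma measurable_Omega : @measurable _ (measurableTypeR R) Om.
Proof. exact: measurable_itv. Qed.
Hint Resolve measurable_Omega : core.

Lemma intgD f g : intg f -> intg g -> intg (fun x => f x + g x).
Proof. exact: integrableD. Qed.

Lemma intgB f g : intg f -> intg g -> intg (fun x => f x - g x).
Proof. exact: integrableB. Qed.

Lemma intgZ k f : intg f -> intg (fun x => k * f x).
Proof. exact: integrableZl. Qed.

Lemma intg_sum (I : Type) (s : seq I) (F : I -> R -> R) :
  (forall i, intg (F i)) -> intg (fun x => \sum_(i <- s) F i x).
Proof.
move=> iF; elim: s => [|i s IH].
  rewrite (_ : (fun x => _) = cst 0); first exact: integrable0.
  by apply/funext => x; rewrite big_nil.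
rewrite (_ : (fun x => _) = fun x => F i x + \sum_(j <- s) F j x); first exact: intgD.
by apply/funext => x; rewrite big_cons.
Qed.

Lemma IntD f g : intg f -> intg g -> Int (fun x => f x + g x) = Int f + Int g.
Proof. exact: RintegralD. Qed.

Lemma IntB f g : intg f -> intg g -> Int (fun x => f x - g x) = Int f - Int g.
Proof. exact: RintegralB. Qed.

Lemma IntZ k f : intg f -> Int (fun x => k * f x) = k * Int f.
Proof. exact: RintegralZl. Qed.

Lemma eq_Int f g : (forall x, f x = g x) -> Int f = Int g.
Proof. by move=> fg; congr Int; apply/funext. Qed.

Lemma Int_le f g : intg f -> intg g -> (forall x, Om x -> f x <= g x) -> Int f <= Int g.
Proof. exact: le_Rintegral. Qed.

Lemma Int_ge0 f : (forall x, 0 <= f x) -> 0 <= Int f.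
Proof. by move=> f0; apply: Rintegral_ge0. Qed.

Lemma le_intg f g : measurable_fun Om f -> (forall x, Om x -> `|f x| <= g x) -> intg g -> intg f.
Proof.
move=> mf fg; apply: le_integrable => //; first exact/measurable_EFinP.
move=> x Ox; rewrite /= lee_fin (le_trans (fg x Ox))//; exact: ler_norm.
Qed.

Lemma L2r_mul f g : L2r f -> L2r g -> intg (fun x => f x * g x).
Proof.
move=> [mf f2] [mg g2]; apply: (@le_intg _ (fun x => f x ^+ 2 + g x ^+ 2)).
- exact: measurable_funM.
- move=> x _; rewrite normrM -(@real_normK _ (f x)) ?num_real//.
  rewrite -(@real_normK _ (g x)) ?num_real//.
  have := sqr_ge0 (`|f x| - `|g x|); have := sqr_ge0 (`|f x| + `|g x|); nra.
- exact: intgD.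
Qed.

Lemma cont_intg f : continuous f -> intg f.
Proof.
move=> cf; rewrite /intg; apply: (@integrableS _ _ _ mu `[- pi, pi]%classic) => //.
  by apply: subset_itvW; rewrite ?lexx.
apply: continuous_compact_integrable; first exact: segment_compact.
exact: continuous_subspaceT.
Qed.

Lemma cont_measurable f : continuous f -> measurable_fun Om f.
Proof. by move=> cf; apply: measurable_funTS; exact: continuous_measurable_fun. Qed.

Lemma cont_L2r f : continuous f -> L2r f.
Proof.
move=> cf; split; first exact: cont_measurable.
apply: cont_intg => x; under eq_fun do rewrite expr2.
by apply: cvgM; exact: cf.
Qed.

Lemma cont_bounded f : continuous f -> exists2 C, 0 <= C & forall x, Om x -> `|f x| <= C.
Proof.
move=> cf; have [] : bounded_set (f @` `[- pi, pi]).
  apply: compact_bounded; apply: continuous_compact; last exact: segment_compact.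
  exact: continuous_subspaceT.
move=> M [_ /(_ (`|M| + 1))] H.
exists (`|M| + 1); first by rewrite addr_ge0.
move=> x; rewrite /Omega/= in_itv/= => /andP[x1 x2]; apply: H.
  by have := ler_norm M; lra.
by exists x => //=; rewrite in_itv/= !ltW.
Qed.

Lemma L2r_add f g : L2r f -> L2r g -> L2r (fun x => f x + g x).
Proof.
move=> Lf Lg; split; first by apply: measurable_funD; [exact: Lf.1|exact: Lg.1].
have -> : (fun x => (f x + g x) ^+ 2) =
  (fun x => (f x ^+ 2 + g x ^+ 2) + 2 * (f x * g x)) by apply/funext => x; ring.
by apply: intgD; [apply: intgD; [exact: Lf.2|exact: Lg.2]|apply: intgZ; exact: L2r_mul].
Qed.

Lemma L2r_mulcont b f : continuous b -> L2r f -> L2r (fun x => b x * f x).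
Proof.
move=> cb [mf f2]; have mbf : measurable_fun Om (fun x => b x * f x).
  by apply: measurable_funM => //; exact: cont_measurable.
have [C C0 bC] := cont_bounded cb; split => //.
apply: (@le_intg _ (fun x => C ^+ 2 * f x ^+ 2)); last exact: intgZ.
  exact: measurable_funX.
move=> x Ox; rewrite ger0_norm ?sqr_ge0// exprMn ler_wpM2r ?sqr_ge0//.
rewrite -(@real_normK _ (b x)) ?num_real// ler_pXn2r ?nnegrE//; exact: bC.
Qed.

Lemma L2r_scale k f : L2r f -> L2r (fun x => k * f x).
Proof. by move=> Lf; apply: (@L2r_mulcont (fun=> k)) => //; exact: cst_continuous. Qed.

Lemma LpE2 f : (forall x, 0 <= f x) ->
  LpE Om 2%:E f = ((\int[mu]_(x in Om) (f x ^+ 2)%:E) `^ 2^-1)%E.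
Proof.
move=> f0; rewrite /LpE unlock; congr (_ `^ _)%E.
rewrite [RHS]integral_mkcond; apply: eq_integral => x _.
rewrite /patch; case: ifPn => _ /=; last by rewrite normr0 powR0// pnatr_eq0.
by rewrite ger0_norm// powR_mulrn.
Qed.

End RealL2.
#[global] Hint Resolve measurable_Omega : core.

(** * Complex square-integrable functions through real and imaginary parts *)

Section ComplexL2.
Context {R : realType}.
Implicit Types (f g : R -> R[i]).

Local Notation mu := (@lebesgue_measure R).
Local Notation Om := (@Omega R).

Definition re f : R -> R := fun x => Re (f x).
Definition im f : R -> R := fun x => Im (f x).
Definition cintg f := intg (re f) /\ intg (im f).
Definition ccont f := continuous (re f) /\ continuous (im f).

Lemma L2P f : L2 f <-> L2r (re f) /\ L2r (im f).
Proof.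
rewrite /L2/= LpE2; last by move=> x; exact: nc_ge0.
have E : (\int[mu]_(x in Om) (nc (f x) ^+ 2)%:E)%E =
         (\int[mu]_(x in Om) (re f x ^+ 2 + im f x ^+ 2)%:E)%E.
  by apply: eq_integral => x _; rewrite nc_sqr.
have I0 : (0 <= \int[mu]_(x in Om) (re f x ^+ 2 + im f x ^+ 2)%:E)%E.
  by apply: integral_ge0 => x _; rewrite lee_fin addr_ge0// sqr_ge0.
rewrite E; split.
  move=> [mr mi fin].
  have i2 : intg (fun x => re f x ^+ 2 + im f x ^+ 2).
    apply/integrableP; split.
      apply/measurable_EFinP; apply: measurable_funD; exact: measurable_funX.
    under eq_integral => x _.
      rewrite /= ger0_norm; last by rewrite addr_ge0// sqr_ge0.
      over.
    move: fin; case: (integral _ _ _) I0 => [r r0 _|_|//]; first exact: ltry.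
    by rewrite poweRyr// invr_eq0 pnatr_eq0.
  split; split => //; apply: le_intg i2; try exact: measurable_funX.
    by move=> x _; rewrite ger0_norm ?sqr_ge0// lerDl sqr_ge0.
  by move=> x _; rewrite ger0_norm ?sqr_ge0// lerDr sqr_ge0.
move=> [[mr r2] [mi i2]]; split => //.
have /integrableP[_] := intgD r2 i2.
under eq_integral => x _.
  rewrite /= ger0_norm; last by rewrite addr_ge0// sqr_ge0.
  over.
by move=> fin; apply: poweR_lty.
Qed.

Lemma normL2_ge0 f : 0 <= normL2 f.
Proof. by rewrite /normL2 fine_ge0// LpE2 ?poweR_ge0// => x; exact: nc_ge0. Qed.

Lemma normL2_sqr f : L2 f -> normL2 f ^+ 2 = Int (fun x => re f x ^+ 2 + im f x ^+ 2).
Proof.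
move=> /L2P[[mr r2] [mi i2]]; rewrite /normL2 LpE2; last by move=> x; exact: nc_ge0.
have E : (\int[mu]_(x in Om) (nc (f x) ^+ 2)%:E)%E =
         (\int[mu]_(x in Om) (re f x ^+ 2 + im f x ^+ 2)%:E)%E.
  by apply: eq_integral => x _; rewrite nc_sqr.
have fin : (\int[mu]_(x in Om) (re f x ^+ 2 + im f x ^+ 2)%:E)%E \is a fin_num.
  by apply: integrable_fin_num => //; exact: (intgD r2 i2).
rewrite E -(fineK fin) poweR_EFin/= -/(Int _).
have I0 : 0 <= Int (fun x => re f x ^+ 2 + im f x ^+ 2).
  by apply: Int_ge0 => x; rewrite addr_ge0// sqr_ge0.
by rewrite -powR_mulrn ?powR_ge0// -powRrM mulVf ?pnatr_eq0// powRr1.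
Qed.

Lemma cintegralE f : cintegral f = Int (re f) +i* Int (im f). Proof. by []. Qed.

Lemma eq_cintegral f g : (forall x, f x = g x) -> cintegral f = cintegral g.
Proof. by move=> fg; congr cintegral; apply/funext. Qed.

Lemma cintegralD f g : cintg f -> cintg g ->
  cintegral (fun x => f x + g x) = cintegral f + cintegral g.
Proof.
move=> [fr fi] [gr gi]; rewrite !cintegralE; apply: complex_ext => /=.
  by rewrite -IntD//; apply: eq_Int => x; rewrite /re ReD.
by rewrite -IntD//; apply: eq_Int => x; rewrite /im ImD.
Qed.

Lemma cintgZ (a : R[i]) f : cintg f -> cintg (fun x => a * f x).
Proof.
move=> [fr fi]; split.
  rewrite (_ : re _ = fun x => Re a * re f x - Im a * im f x).
    by apply: intgB; exact: intgZ.
  by apply/funext => x; rewrite /re ReM.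
rewrite (_ : im _ = fun x => Re a * im f x + Im a * re f x).
  by apply: intgD; exact: intgZ.
by apply/funext => x; rewrite /im ImM.
Qed.

Lemma cintegralZ (a : R[i]) f : cintg f ->
  cintegral (fun x => a * f x) = a * cintegral f.
Proof.
move=> [fr fi]; rewrite !cintegralE; apply: complex_ext.
  rewrite ReM/= -!IntZ// -IntB ?intgZ//; apply: eq_Int => x; exact: ReM.
rewrite ImM/= -!IntZ// -IntD ?intgZ//; apply: eq_Int => x; exact: ImM.
Qed.

Lemma cintg_sum (I : Type) (s : seq I) (F : I -> R -> R[i]) :
  (forall i, cintg (F i)) -> cintg (fun x => \sum_(i <- s) F i x).
Proof.
move=> iF; split.
  rewrite (_ : re _ = fun x => \sum_(i <- s) re (F i) x).
    by apply: intg_sum => i; exact: (iF i).1.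
  by apply/funext => x; rewrite /re Re_sum.
rewrite (_ : im _ = fun x => \sum_(i <- s) im (F i) x).
  by apply: intg_sum => i; exact: (iF i).2.
by apply/funext => x; rewrite /im Im_sum.
Qed.

Lemma cintegral0 : cintegral (fun=> 0 : R[i]) = 0 :> R[i].
Proof.
have -> : cintegral (fun=> 0 : R[i]) = 0%:C * cintegral (fun=> 0 : R[i]).
  rewrite -cintegralZ; first by apply: eq_cintegral => x; rewrite mulr0.
  by split; apply: cont_intg; exact: cst_continuous.
by rewrite mul0r.
Qed.

Lemma cintegral_sum (I : Type) (s : seq I) (F : I -> R -> R[i]) :
  (forall i, cintg (F i)) ->
  cintegral (fun x => \sum_(i <- s) F i x) = \sum_(i <- s) cintegral (F i).
Proof.
move=> iF; elim: s => [|i s IH].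
  rewrite big_nil -[RHS]cintegral0; apply: eq_cintegral => x; exact: big_nil.
rewrite big_cons -IH -cintegralD//; last exact: cintg_sum.
by apply: eq_cintegral => x; exact: big_cons.
Qed.

Lemma L2_cintg_mul f g : L2 f -> L2 g -> cintg (fun x => f x * g x).
Proof.
move=> /L2P[fr fi] /L2P[gr gi]; split.
  rewrite (_ : re _ = fun x => re f x * re g x - im f x * im g x).
    by apply: intgB; exact: L2r_mul.
  by apply/funext => x; rewrite /re ReM.
rewrite (_ : im _ = fun x => re f x * im g x + im f x * re g x).
  by apply: intgD; exact: L2r_mul.
by apply/funext => x; rewrite /im ImM.
Qed.

Lemma L2J f : L2 f -> L2 (fun x => conjc (f x)).
Proof.
move=> /L2P[fr fi]; apply/L2P; split.
  rewrite (_ : re _ = re f)//; apply/funext => x; rewrite /re; by case: (f x).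
rewrite (_ : im _ = fun x => -1 * im f x); first exact: L2r_scale.
by apply/funext => x; rewrite /im mulN1r; case: (f x).
Qed.

Lemma ccont_L2 f : ccont f -> L2 f.
Proof. by move=> [fr fi]; apply/L2P; split; exact: cont_L2r. Qed.

Lemma L2D f g : L2 f -> L2 g -> L2 (fun x => f x + g x).
Proof.
move=> /L2P[fr fi] /L2P[gr gi]; apply/L2P; split.
  rewrite (_ : re _ = fun x => re f x + re g x); first exact: L2r_add.
  by apply/funext => x; rewrite /re ReD.
rewrite (_ : im _ = fun x => im f x + im g x); first exact: L2r_add.
by apply/funext => x; rewrite /im ImD.
Qed.

Lemma L2_mulcont f g : ccont f -> L2 g -> L2 (fun x => f x * g x).
Proof.
move=> [fr fi] /L2P[gr gi]; apply/L2P; split.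
  rewrite (_ : re _ = fun x => re f x * re g x + -1 * (im f x * im g x)).
    by apply: L2r_add; [|apply: L2r_scale]; exact: L2r_mulcont.
  by apply/funext => x; rewrite /re ReM mulN1r.
rewrite (_ : im _ = fun x => re f x * im g x + im f x * re g x).
  by apply: L2r_add; exact: L2r_mulcont.
by apply/funext => x; rewrite /im ImM.
Qed.

Lemma ccont_cst (a : R[i]) : ccont (fun=> a).
Proof. by split; exact: cst_continuous. Qed.

Lemma L2Z (a : R[i]) f : L2 f -> L2 (fun x => a * f x).
Proof. by move=> Lf; apply: (@L2_mulcont (fun=> a)) => //; exact: ccont_cst. Qed.

Lemma L2B f g : L2 f -> L2 g -> L2 (fun x => f x - g x).
Proof.
move=> Lf Lg; rewrite (_ : (fun x => _) = fun x => f x + (-1) * g x).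
  by apply: L2D => //; exact: L2Z.
by apply/funext => x; rewrite mulN1r.
Qed.

Lemma ccontD f g : ccont f -> ccont g -> ccont (fun x => f x + g x).
Proof.
move=> [fr fi] [gr gi]; split => x.
  rewrite (_ : re _ = fun x => re f x + re g x).
    by apply: cvgD; [exact: fr|exact: gr].
  by apply/funext => y; rewrite /re ReD.
rewrite (_ : im _ = fun x => im f x + im g x).
  by apply: cvgD; [exact: fi|exact: gi].
by apply/funext => y; rewrite /im ImD.
Qed.

Lemma ccontM f g : ccont f -> ccont g -> ccont (fun x => f x * g x).
Proof.
move=> [fr fi] [gr gi]; split => x.
  rewrite (_ : re _ = fun x => re f x * re g x - im f x * im g x).
    by apply: cvgB; apply: cvgM; [exact: fr|exact: gr|exact: fi|exact: gi].
  by apply/funext => y; rewrite /re ReM.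
rewrite (_ : im _ = fun x => re f x * im g x + im f x * re g x).
  by apply: cvgD; apply: cvgM; [exact: fr|exact: gi|exact: fi|exact: gr].
by apply/funext => y; rewrite /im ImM.
Qed.

Lemma ccontZ (a : R[i]) f : ccont f -> ccont (fun x => a * f x).
Proof. by apply: ccontM; exact: ccont_cst. Qed.

Lemma ccontB f g : ccont f -> ccont g -> ccont (fun x => f x - g x).
Proof.
move=> cf cg; rewrite (_ : (fun x => _) = fun x => f x + (-1) * g x).
  by apply: ccontD => //; exact: ccontZ.
by apply/funext => x; rewrite mulN1r.
Qed.

Lemma ccont_sum (I : Type) (s : seq I) (F : I -> R -> R[i]) :
  (forall i, ccont (F i)) -> ccont (fun x => \sum_(i <- s) F i x).
Proof.
move=> cF; elim: s => [|i s IH].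
  rewrite (_ : (fun x => _) = fun=> 0); first exact: ccont_cst.
  by apply/funext => x; rewrite big_nil.
rewrite (_ : (fun x => _) = fun x => F i x + \sum_(j <- s) F j x); first exact: ccontD.
by apply/funext => x; rewrite big_cons.
Qed.

Lemma ccont_toC (f : R -> R) : continuous f -> ccont (toC f).
Proof. by move=> cf; split => // x; exact: cvg_cst. Qed.

Lemma ccont_cexpi (f : R -> R) : continuous f -> ccont (fun x => cexpi (f x)).
Proof.
move=> cf; split => x; rewrite /re /im/=.
  by apply: continuous_comp; [exact: cf|exact: continuous_cos].
by apply: continuous_comp; [exact: cf|exact: continuous_sin].
Qed.

Lemma ccont_mode (k : int) : ccont (mode k : R -> R[i]).
Proof. by apply: ccont_cexpi => x; apply: cvgM; [exact: cvg_cst|exact: cvg_id]. Qed.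

Lemma normL2D_sqr f g : L2 f -> L2 g ->
  normL2 (fun x => f x + g x) ^+ 2 <= 2 * normL2 f ^+ 2 + 2 * normL2 g ^+ 2.
Proof.
move=> Lf Lg; rewrite !normL2_sqr//; last exact: L2D.
have/L2P[[_ fr] [_ fi]] := Lf; have/L2P[[_ gr] [_ gi]] := Lg.
have/L2P[[_ hr] [_ hi]] := L2D Lf Lg.
rewrite -!IntZ; try exact: intgD.
rewrite -IntD; try (apply: intgZ; exact: intgD).
apply: Int_le; first exact: intgD.
  by apply: intgD; apply: intgZ; exact: intgD.
move=> x _; rewrite /re /im ReD ImD.
have := sqr_ge0 (Re (f x) - Re (g x)); have := sqr_ge0 (Im (f x) - Im (g x)); lra.
Qed.

Lemma normL2_sup f (C : R) : ccont f -> 0 <= C -> (forall x, nc (f x) <= C) ->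
  normL2 f ^+ 2 <= 2 * pi * C ^+ 2.
Proof.
move=> cf C0 fC; have Lf := ccont_L2 cf; rewrite normL2_sqr//.
have/L2P[[_ fr] [_ fi]] := Lf.
have -> : 2 * pi * C ^+ 2 = Int (fun=> C ^+ 2).
  have muO : mu Om = (2 * pi)%:E.
    rewrite /Omega lebesgue_measure_itv/= lte_fin ifT; last by have := pi_gt0 R; lra.
    by congr EFin; ring.
  by rewrite /Int Rintegral_cst// mulrC -[2 * pi]/(fine (2 * pi)%:E) -muO.
apply: Int_le; [exact: intgD|by apply: cont_intg; exact: cst_continuous|].
by move=> x _; rewrite -nc_sqr ler_pXn2r ?nnegrE ?nc_ge0.
Qed.

End ComplexL2.

(** * Fourier coefficients: orthogonality, Bessel's inequality, weak derivatives *)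

Section FourierCoefficients.
Context {R : realType}.
Implicit Types (f g v : R -> R[i]) (a : int -> R[i]) (k j : int) (s : seq int).

Lemma pi2_neq0 : (2 * pi)%:C != 0 :> R[i].
Proof. by rewrite eq_complex/= negb_and mulf_neq0// gt_eqF// pi_gt0. Qed.

Lemma Int_FTC (F G : R -> R) : (forall x : R, is_derive x 1 F (G x)) -> continuous G ->
  Int G = F pi - F (- pi).
Proof.
move=> dF cG.
have cF : continuous F.
  move=> x; have [dFx _] := dF x.
  exact/differentiable_continuous/derivable1_diffP.
have pi0 : - pi < pi :> R by have := pi_gt0 R; lra.
have iG (i : interval R) : [set` i] `<=` `[- pi, pi]%classic ->
    lebesgue_measure.-integrable [set` i] (EFin \o G).
  move=> sub; apply: (@integrableS _ _ _ lebesgue_measure `[- pi, pi]%classic) => //.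
  apply: continuous_compact_integrable; first exact: segment_compact.
  exact: continuous_subspaceT.
rewrite /Int /Omega Rintegral_itv_obnd_cbnd; last first.
  by apply: iG => x /=; rewrite !in_itv/= => /andP[x1 x2]; lra.
rewrite Rintegral_itv_bndo_bndc; last first.
  by apply: iG => x /=; rewrite !in_itv/= => /andP[x1 x2]; lra.
rewrite /Rintegral (@continuous_FTC2 _ G F)//.
- exact: continuous_subspaceT.
- split.
  + by move=> x _; have [] := dF x.
  + by apply: cvg_at_right_filter; exact: cF.
  + by apply: cvg_at_left_filter; exact: cF.
- by move=> x _; rewrite derive1E; have [] := dF x.
Qed.

Lemma is_derive_scaled (F G : R -> R) (c x : R) :
  (forall y : R, is_derive y 1 F (G y)) -> is_derive x 1 (fun y => F (c * y)) (c * G (c * x)).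
Proof.
move=> dF; rewrite mulrC.
have dc : is_derive x 1 (fun y : R => c * y) c.
  have -> : (fun y : R => c * y) = c \*: (id : R -> R) by [].
  by apply: is_derive_eq; rewrite /GRing.scale/= mulr1.
exact: (@is_derive1_comp _ F (fun y => c * y) x (G (c * x)) c).
Qed.

Lemma cintegral_mode k : cintegral (mode k : R -> R[i]) = if k == 0 then (2 * pi)%:C else 0.
Proof.
case: eqVneq => [->|k0].
  have -> : mode 0 = fun=> 1 :> R[i] by apply/funext => x; exact: mode0.
  rewrite cintegralE.
  have H (c : R) : Int (fun=> c) = c * pi - c * (- pi).
    have dF (x : R) : is_derive x 1 (fun x => c * x) c.
      have -> : (fun y : R => c * y) = c \*: (id : R -> R) by [].
      by apply: is_derive_eq; rewrite /GRing.scale/= mulr1.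
    exact: (Int_FTC dF (@cst_continuous _ _ c)).
  by rewrite /re /im/= !H; apply: complex_ext => /=; ring.
have k0R : k%:~R != 0 :> R by rewrite intr_eq0.
have P := @mode_periodic R k (- pi).
have {}P : mode k pi = mode k (- pi) :> R[i].
  by rewrite -P; congr mode; ring.
case: P => [Pc Ps].
rewrite cintegralE; apply: complex_ext => /=.
  have dF (x : R) : is_derive x 1 (fun x => k%:~R^-1 * sin (k%:~R * x)) (cos (k%:~R * x)).
    have -> : (fun y => k%:~R^-1 * sin (k%:~R * y)) =
      k%:~R^-1 \*: (fun y : R => sin (k%:~R * y)) by [].
    have := @is_derive_scaled sin cos k%:~R x (@is_derive_sin R) => H.
    by apply: is_derive_eq; rewrite /GRing.scale/= mulKf.
  by rewrite (Int_FTC dF (@ccont_mode R k).1) Ps subrr.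
have dF (x : R) : is_derive x 1 (fun x => - k%:~R^-1 * cos (k%:~R * x)) (sin (k%:~R * x)).
  have -> : (fun y => - k%:~R^-1 * cos (k%:~R * y)) =
    - k%:~R^-1 \*: (fun y : R => cos (k%:~R * y)) by [].
  have := @is_derive_scaled cos (fun x => - sin x) k%:~R x (@is_derive_cos R) => H.
  by apply: is_derive_eq; rewrite /GRing.scale/= mulNr !mulrN opprK mulKf.
by rewrite (Int_FTC dF (@ccont_mode R k).2) Pc subrr.
Qed.

Lemma L2_mode k : L2 (mode k : R -> R[i]).
Proof. exact: ccont_L2 (ccont_mode k). Qed.
Hint Resolve L2_mode : core.

(* [inner] is stated with [Num.conj]; on [R[i]] it is convertible to [conjc]. *)
Lemma innerE f g : inner f g = cintegral (fun x => f x * conjc (g x)).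
Proof. by []. Qed.

Lemma innerZl (c : R[i]) f g : L2 f -> L2 g -> inner (fun x => c * f x) g = c * inner f g.
Proof.
move=> Lf Lg; rewrite !innerE -cintegralZ; last by apply: L2_cintg_mul => //; exact: L2J.
by apply: eq_cintegral => x; rewrite mulrA.
Qed.

Lemma innerDl f g v : L2 f -> L2 g -> L2 v ->
  inner (fun x => f x + g x) v = inner f v + inner g v.
Proof.
move=> Lf Lg Lv; rewrite !innerE -cintegralD; try (apply: L2_cintg_mul => //; exact: L2J).
by apply: eq_cintegral => x; rewrite mulrDl.
Qed.

Lemma innerBl f g v : L2 f -> L2 g -> L2 v ->
  inner (fun x => f x - g x) v = inner f v - inner g v.
Proof.
move=> Lf Lg Lv; rewrite -[- inner g v]mulN1r -innerZl// -innerDl//; last exact: L2Z.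
by apply: eq_cintegral => x; rewrite mulN1r.
Qed.

Lemma innerJ f g : L2 f -> L2 g -> inner g f = conjc (inner f g).
Proof.
move=> Lf Lg; rewrite !innerE !cintegralE; apply: complex_ext => /=.
  by apply: eq_Int => x; rewrite /re; case: (f x) => a b; case: (g x) => c d /=; ring.
have [_ ci] : cintg (fun x => f x * conjc (g x)) by apply: L2_cintg_mul => //; exact: L2J.
rewrite -mulN1r -IntZ//; apply: eq_Int => x.
by rewrite /im; case: (f x) => a b; case: (g x) => c d /=; ring.
Qed.

Lemma inner_sumr s a f : L2 f ->
  inner f (fun x => \sum_(k <- s) a k * mode k x) =
  \sum_(k <- s) conjc (a k) * inner f (mode k).
Proof.
move=> Lf; rewrite !innerE.
have cI k : cintg (fun x => f x * conjc (mode k x)) by apply: L2_cintg_mul => //; exact: L2J.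
under [RHS]eq_bigr do rewrite innerE -cintegralZ//.
rewrite -cintegral_sum; last by move=> k; exact: cintgZ.
apply: eq_cintegral => x.
have -> : conjc (\sum_(k <- s) a k * mode k x) =
    \sum_(k <- s) conjc (a k) * conjc (mode k x).
  exact: conjc_sumM.
by rewrite mulr_sumr; apply: eq_bigr => k _; rewrite mulrCA.
Qed.

Lemma inner_self f : L2 f -> inner f f = (normL2 f ^+ 2)%:C.
Proof.
move=> Lf; rewrite normL2_sqr// !innerE cintegralE; apply: complex_ext => /=.
  by apply: eq_Int => x; rewrite /re mulcJ nc_sqr.
have -> : im (fun x => f x * conjc (f x)) = fun=> 0 by apply/funext => x; rewrite /im mulcJ.
by have := congr1 (@complex.Im R) (@cintegral0 R); rewrite cintegralE.
Qed.

Local Notation fc := fourier_coef.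

Lemma inner_fc f k : inner f (mode k) = (2 * pi)%:C * fc f k.
Proof. by rewrite /fc mulrC divfK// pi2_neq0. Qed.

Lemma fcD f g k : L2 f -> L2 g -> fc (fun x => f x + g x) k = fc f k + fc g k.
Proof. by move=> Lf Lg; rewrite /fc innerDl// mulrDl. Qed.

Lemma fcB f g k : L2 f -> L2 g -> fc (fun x => f x - g x) k = fc f k - fc g k.
Proof. by move=> Lf Lg; rewrite /fc innerBl// mulrBl. Qed.

Lemma fcZ (c : R[i]) f k : L2 f -> fc (fun x => c * f x) k = c * fc f k.
Proof. by move=> Lf; rewrite /fc innerZl// mulrA. Qed.

Lemma fc_modeM j f k : fc (fun x => mode j x * f x) k = fc f (k - j).
Proof.
rewrite /fc !innerE; congr (_ / _); apply: eq_cintegral => x.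
by rewrite -!modeN opprB -modeM; ring.
Qed.

Lemma fc_mode j k : fc (mode j) k = (j == k)%:R :> R[i].
Proof.
rewrite /fc !innerE.
have -> : cintegral (fun x => mode j x * conjc (mode k x)) = cintegral (mode (j - k)) :> R[i].
  by apply: eq_cintegral => x; rewrite -modeN modeM.
rewrite cintegral_mode subr_eq0; case: eqP => _; last by rewrite mul0r.
by rewrite divff// pi2_neq0.
Qed.

Lemma fc_sum (I : Type) (r : seq I) (F : I -> R -> R[i]) k : (forall i, L2 (F i)) ->
  fc (fun x => \sum_(i <- r) F i x) k = \sum_(i <- r) fc (F i) k.
Proof.
move=> LF; rewrite /fc -mulr_suml; congr (_ / _); rewrite !innerE -cintegral_sum.
  by apply: eq_cintegral => x; rewrite mulr_suml.
by move=> i; apply: L2_cintg_mul => //; exact: L2J.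
Qed.

(** The frequencies form an arbitrary list because the square of an element of X_N has frequencies
    up to [2 N]. *)
Definition tp s a : R -> R[i] := fun x => \sum_(k <- s) a k * mode k x.

Lemma ccont_tp s a : ccont (tp s a).
Proof. by apply: ccont_sum => k; apply: ccontZ; exact: ccont_mode. Qed.

Lemma L2_tp s a : L2 (tp s a). Proof. exact: ccont_L2 (ccont_tp s a). Qed.
Hint Resolve L2_tp : core.

Lemma fc_tp s a k : uniq s -> fc (tp s a) k = if k \in s then a k else 0.
Proof.
move=> us; rewrite fc_sum; last by move=> j; exact: L2Z.
under eq_bigr do rewrite fcZ// fc_mode.
case: ifPn => ks.
  rewrite (bigD1_seq k)//= eqxx mulr1 big1 ?addr0// => j /negPf ->.
  by rewrite mulr0.
apply: big1_seq => j /= js; case: eqP => [jk|_]; last by rewrite mulr0.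
by rewrite -jk js in ks.
Qed.

Lemma eq_tp s a b : {in s, a =1 b} -> tp s a = tp s b.
Proof.
by move=> ab; apply/funext => x; apply: eq_big_seq => k ks; rewrite ab.
Qed.

Lemma parseval_tp s a : uniq s -> normL2 (tp s a) ^+ 2 = 2 * pi * \sum_(k <- s) nc (a k) ^+ 2.
Proof.
move=> us; apply: complexI; rewrite -inner_self// inner_sumr//.
rewrite mulr_sumr cplx_sum; apply: eq_big_seq => k ks.
by rewrite inner_fc fc_tp// ks (cplxM (2 * pi)) -mulcJ; ring.
Qed.

Lemma bessel_pi f s : L2 f -> uniq s -> 2 * pi * \sum_(k <- s) nc (fc f k) ^+ 2 <= normL2 f ^+ 2.
Proof.
move=> Lf us; pose p := tp s (fc f).
have Lp : L2 p by exact: L2_tp.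
have Lfp : L2 (fun x => f x - p x) by exact: L2B.
have o1 : inner (fun x => f x - p x) p = 0.
  rewrite inner_sumr//; apply: big1_seq => k /= ks.
  by rewrite inner_fc fcB// fc_tp// ks subrr !mulr0.
have o2 : inner f p = (2 * pi * \sum_(k <- s) nc (fc f k) ^+ 2)%:C.
  rewrite inner_sumr// mulr_sumr cplx_sum; apply: eq_big_seq => k ks.
  by rewrite inner_fc (cplxM (2 * pi)) -mulcJ; ring.
have o3 : inner p p = inner f p.
  by apply/eqP; rewrite eq_sym -subr_eq0 -innerBl// o1.
have o4 : inner p f = (2 * pi * \sum_(k <- s) nc (fc f k) ^+ 2)%:C.
  by rewrite (innerJ Lf Lp) o2; exact: conjc_real.
have o5 : inner (fun x => f x - p x) (fun x => f x - p x) =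
    (normL2 f ^+ 2 - 2 * pi * \sum_(k <- s) nc (fc f k) ^+ 2)%:C.
  rewrite innerBl// (innerJ Lfp Lf) (innerJ Lfp Lp) o1 conjc0 subr0.
  rewrite innerBl// o4 inner_self// rmorphB/=.
  by apply: complex_ext => /=; ring.
rewrite -subr_ge0; rewrite inner_self// in o5.
by have := congr1 (@complex.Re R) o5; rewrite /= => <-; exact: sqr_ge0.
Qed.

Lemma bessel f s : L2 f -> uniq s -> \sum_(k <- s) nc (fc f k) ^+ 2 <= normL2 f ^+ 2.
Proof.
move=> Lf us; apply: le_trans (bessel_pi Lf us); rewrite ler_peMl//.
  by apply: sumr_ge0 => k _; exact: sqr_ge0.
by have := pi_ge2 R; lra.
Qed.

Lemma fc_le f k : L2 f -> nc (fc f k) <= normL2 f.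
Proof.
move=> Lf; have := @bessel f [:: k] Lf isT.
by rewrite big_seq1 ler_pXn2r ?nnegrE ?nc_ge0 ?normL2_ge0.
Qed.

(* [x |-> Re (z e^{-ikx})] is closed under differentiation, which multiplies [z] by [-ik]. *)
Definition wave k (z : R[i]) : R -> R := fun x => Re (z * mode (- k) x).

Lemma is_derive_wave k z (x : R) :
  is_derive x 1 (wave k z) (wave k ((0 -i* k%:~R) * z) x).
Proof.
have kN : (- k)%:~R = - k%:~R :> R by rewrite mulrNz.
have -> : wave k z = Re z \*: (fun y : R => cos ((- k)%:~R * y)) -
    Im z \*: (fun y : R => sin ((- k)%:~R * y)).
  by apply/funext => y; rewrite /wave ReM.
have Hc := @is_derive_scaled cos (fun x => - sin x) (- k)%:~R x (@is_derive_cos R).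
have Hs := @is_derive_scaled sin cos (- k)%:~R x (@is_derive_sin R).
apply: is_derive_eq; rewrite /wave !ReM ImM /GRing.scale/= kN; ring.
Qed.

Lemma derive1n_wave k z n : derive1n n (wave k z) = wave k ((0 -i* k%:~R) ^+ n * z).
Proof.
elim: n => [|n IH]; first by rewrite derive1n0 expr0 mul1r.
rewrite derive1nS IH exprS -mulrA; apply/funext => x.
by rewrite derive1E; have [_ ->] := is_derive_wave k ((0 -i* k%:~R) ^+ n * z) x.
Qed.

Lemma wave_smooth k z : smooth_periodic (wave k z).
Proof.
split=> [x|n x]; first by rewrite /wave mode_periodic.
rewrite derive1n_wave.
by have [] := is_derive_wave k ((0 -i* k%:~R) ^+ n * z) x.
Qed.

Lemma ccont_wave k z : ccont (toC (wave k z)).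
Proof.
apply: ccont_toC => x; have [dx _] := is_derive_wave k z x.
exact/differentiable_continuous/derivable1_diffP.
Qed.

(** Test functions are real, while a coefficient needs the complex exponential. It is recovered from
    two of them, [z e^{-ikx}] being the wave of [z] plus ['i] times the wave of [- 'i z]. The signs
    of the [m] derivatives and of the weak formulation combine to [(ik)^m]. *)
Lemma fc_weak_derivative m v g k : L2 v -> L2 g -> is_weak_derivative m v g ->
  fc g k = (0 +i* k%:~R) ^+ m * fc v k.
Proof.
move=> Lv Lg vg; rewrite /fc mulrA; congr (_ / _).
pose w z := toC (wave k z).
have wE (z : R[i]) x : w z x + 'i * w (- 'i * z) x = z * mode (- k) x.
  by rewrite /w /toC /wave !ReM ImM; apply: complex_ext => /=; rewrite ?ReM ?ImM/=; ring.
have cI f z : L2 f -> cintg (fun x => f x * w z x).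
  by move=> Lf; apply: L2_cintg_mul => //; apply: ccont_L2; exact: ccont_wave.
have IE f z : L2 f -> z * inner f (mode k) =
    cintegral (fun x => f x * w z x) + 'i * cintegral (fun x => f x * w (- 'i * z) x).
  move=> Lf; rewrite !innerE -!cintegralZ//; try exact: cI; last first.
    by apply: L2_cintg_mul => //; exact: L2J.
  rewrite -cintegralD; [|exact: cI|apply: cintgZ; exact: cI].
  by apply: eq_cintegral => x; rewrite -modeN mulrCA -wE; ring.
have E := IE g 1 Lg; rewrite mul1r mulr1 in E.
have vg' z : cintegral (fun x => v x * w ((0 -i* k%:~R) ^+ m * z) x) =
   (-1) ^+ m * cintegral (fun x => g x * w z x).
  by rewrite -(vg _ (wave_smooth k z)) derive1n_wave.
have E' : inner g (mode k) = (-1) ^+ m * ((0 -i* k%:~R) ^+ m * inner v (mode k)).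
  have e1 : cintegral (fun x => v x * w ((0 -i* k%:~R) ^+ m) x) =
      (-1) ^+ m * cintegral (fun x => g x * w 1 x) by rewrite -vg' mulr1.
  have e2 : cintegral (fun x => v x * w (- 'i * (0 -i* k%:~R) ^+ m) x) =
      (-1) ^+ m * cintegral (fun x => g x * w (- 'i) x) by rewrite -vg' mulrC.
  by rewrite IE// E e1 e2 mulrDr [X in _ = _ + X]mulrCA !signrMK.
rewrite E' mulrA -exprMn; congr (_ ^+ _ * _).
by apply: complex_ext => /=; ring.
Qed.

End FourierCoefficients.

(** * A maximum bound from Fourier coefficients, by a positive kernel *)

Section ApproximateIdentity.
Context {R : realType}.
Implicit Types (w : R -> R) (x y : R) (k : int).

Local Notation fc := fourier_coef.

Lemma periodic_int (V : Type) (f : R -> V) x (m : int) : Defs.periodic f ->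
  f (x + m%:~R * (2 * pi)) = f x.
Proof.
move=> pf; have natc n z : f (z + n%:R * (2 * pi)) = f z.
  elim: n => [|n IH]; first by rewrite mul0r addr0.
  by rewrite -natr1 mulrDl mul1r addrA pf.
case: m => n; first exact: natc.
by rewrite -[LHS](natc n.+1) NegzE; congr f; rewrite mulrNz; ring.
Qed.

Lemma shift_into_period (t : R) : exists m : int, `|t + m%:~R * (2 * pi)| <= pi.
Proof.
have pi0 : 0 < 2 * pi :> R by have := pi_gt0 R; lra.
pose m := Num.floor ((t + pi) / (2 * pi)).
exists (- m).
have := Num.Theory.floor_itv ((t + pi) / (2 * pi)); rewrite -/m => /andP[].
rewrite ler_pdivlMr// ltr_pdivrMr// intrD mulrNz => m1 m2.
by rewrite ler_norml; apply/andP; split; lra.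
Qed.

(** Korovkin's argument: near [x] continuity suffices, and away from [x] modulo the period the
    function [1 - cos] is bounded below. It reduces the convergence of a positive kernel to the mean
    of [1 - cos]. *)
Lemma cos_kernel_control w x (eps : R) : continuous w -> Defs.periodic w -> 0 < eps ->
  exists C, forall y, w x - eps - C * (1 - cos (x - y)) <= w y.
Proof.
move=> cw pw e0.
have [B B0 wB] : exists2 B, 0 <= B & forall y, `|w y| <= B.
  have [B B0 wB] := cont_bounded cw.
  exists (B + `|w pi|); first by rewrite addr_ge0.
  move=> y; have [m Hm] := shift_into_period y; rewrite -(periodic_int y m pw).
  move: Hm; set z := y + _; rewrite ler_norml => /andP[z1 z2].
  have wpi : w (- pi) = w pi by rewrite -pw; congr w; ring.
  have := normr_ge0 (w pi); case: (ltrP z pi) => z3; last first.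
    have -> : z = pi by lra.
    lra.
  case: (ltrP (- pi) z) => z4; last first.
    have -> : z = - pi by lra.
    rewrite wpi; lra.
  by have := wB z; rewrite /Omega/= in_itv/= z3 z4 => /(_ isT); lra.
have /cvgrPdist_lt/(_ _ e0)[d /= d0 Hd] := cw x.
pose d' := Num.min (d / 2) pi.
have d'0 : 0 < d' by rewrite lt_min divr_gt0//= pi_gt0.
have d'pi : d' <= pi by rewrite ge_min lexx orbT.
have d'd : d' < d by apply: (@le_lt_trans _ _ (d / 2)); [rewrite ge_min lexx|lra].
have cd : 0 < 1 - cos d'.
  rewrite subr_gt0 -cos0 ltr_cos// in_itv/= ?lexx ?pi_ge0//.
  by rewrite (ltW d'0).
(* At distance at least [d'] the drop of [w] is at most [2 * B], while [1 - cos] is at least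
   [1 - cos d']; [d' <= pi] keeps the cosine monotone. *)
exists (2 * B / (1 - cos d')) => y.
have [m Hm] := shift_into_period (x - y).
pose z := y - m%:~R * (2 * pi).
have wz : w z = w y by rewrite /z -mulNr -mulrNz periodic_int.
have cz : cos (x - y) = cos (x - z).
  have pc : Defs.periodic (@cos R) by move=> t; rewrite mulr_natl; exact: cosD2pi.
  by rewrite -(periodic_int (x - y) m pc); congr cos; rewrite /z; ring.
rewrite -wz cz; have {}Hm : `|x - z| <= pi.
  by move: Hm; congr (`| _ | <= _); rewrite /z; ring.
have C0 : 0 <= 2 * B / (1 - cos d') by rewrite divr_ge0 ?mulr_ge0// ltW.
case: (ltrP `|x - z| d') => xz.
  have := Hd z (lt_trans xz d'd); rewrite ltr_norml => /andP[h1 h2].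
  have := mulr_ge0 C0 (oneBcos_ge0 (x - z)); lra.
have cc : 1 - cos d' <= 1 - cos (x - z).
  rewrite lerD2l lerN2 -(cos_norm (x - z)).
  move: xz; rewrite le_eqVlt => /predU1P[->//|xz].
  by apply/ltW; rewrite ltr_cos// in_itv/= ?Hm ?normr_ge0// (ltW d'0).
have : 2 * B <= 2 * B / (1 - cos d') * (1 - cos (x - z)).
  by rewrite mulrAC ler_pdivlMr// ler_wpM2l// mulr_ge0.
have := wB x; have := wB z; rewrite !ler_norml => /andP[a1 a2] /andP[a3 a4]; lra.
Qed.

(** The de la Vallee Poussin kernel up to normalisation: positive, and a trigonometric polynomial
    with explicit binomial coefficients. *)
Definition kern (n : nat) y : R := (1 + cos y) ^+ n.

Lemma kern_ge0 n y : 0 <= kern n y.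
Proof. by rewrite exprn_ge0//; have := cos_geN1 y; lra. Qed.

Lemma cont_kern n x : continuous (fun y => kern n (x - y)).
Proof.
move=> y; apply: (@continuous_comp _ _ _ (fun y => 1 + cos (x - y)) (fun z => z ^+ n)).
  apply: cvgD; first exact: cvg_cst.
  apply: (@continuous_comp _ _ _ (fun y => x - y) cos); last exact: continuous_cos.
  by apply: cvgB; [exact: cvg_cst|exact: cvg_id].
exact: exprn_continuous.
Qed.

Definition kcoef (n : nat) (j : nat) : R := 'C(2 * n, j)%:R / 2 ^+ n.

(** [1 + cos y] is half of [e^{-iy} (1 + e^{iy})^2], so the binomial theorem applies. *)
Lemma kernE n y : (kern n y)%:C =
  \sum_(j < (2 * n).+1) (kcoef n j)%:C * mode (j%:Z - n%:Z) y.
Proof.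
have m1 : (1 + cos y)%:C = (2^-1)%:C * (mode (-1) y * (1 + mode 1 y) ^+ 2).
  have Mm : mode (-1) y * mode 1 y = 1 by rewrite modeM addNr mode0.
  have -> : mode (-1) y * (1 + mode 1 y) ^+ 2 =
     mode (-1) y + 2 * (mode (-1) y * mode 1 y) + mode (-1) y * mode 1 y * mode 1 y by ring.
  have E2 : 2 = 2%:C :> R[i] by rewrite rmorph_nat.
  rewrite Mm E2 /mode /cexpi mulrNz mulN1r mul1r cosN sinN.
  by apply: complex_ext; rewrite !(ReM, ReD, ImM, ImD)/= mulr1z mul1r; field.
have modeX k (p : nat) : mode k y ^+ p = mode (k * p%:Z) y.
  elim: p => [|p IH]; first by rewrite mulr0 mode0.
  by rewrite exprS IH modeM; congr mode; lia.
have -> : (kern n y)%:C = (1 + cos y)%:C ^+ n by exact: rmorphXn.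
rewrite m1 exprMn [(mode _ _ * _) ^+ _]exprMn -exprM modeX exprDn mulr_sumr mulr_sumr.
apply: eq_bigr => j _; rewrite expr1n mul1r modeX -[mode _ _ *+ _]mulr_natr.
rewrite [mode _ _ * (_ * _)]mulrA modeM /kcoef cplxM.
have -> : (2^-1)%:C ^+ n = (2 ^+ n)^-1%:C :> R[i].
  by rewrite -exprVn; have := rmorphXn (real_complex R) n (2^-1) => ->.
have -> : 'C(2 * n, j)%:R = ('C(2 * n, j)%:R)%:C :> R[i] by rewrite rmorph_nat.
rewrite mulrCA mulrC [_%:C * _%:C]mulrC; congr (_ * mode _ _); lia.
Qed.

Lemma Int_kern w n x : continuous w ->
  (Int (fun y => w y * kern n (x - y)))%:C =
  \sum_(j < (2 * n).+1) (kcoef n j)%:C * mode (j%:Z - n%:Z) x *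
     ((2 * pi)%:C * fc (toC w) (j%:Z - n%:Z)).
Proof.
move=> cw; have Lw : L2 (toC w) by apply: ccont_L2; exact: ccont_toC.
have cI (j : nat) : cintg (fun y => toC w y * conjc (mode (j%:Z - n%:Z) y)).
  by apply: L2_cintg_mul => //; apply: L2J; exact: L2_mode.
under eq_bigr do rewrite -inner_fc innerE -cintegralZ//.
rewrite -cintegral_sum; last by move=> j; exact: cintgZ.
have -> : (Int (fun y => w y * kern n (x - y)))%:C =
    cintegral (fun y => (w y * kern n (x - y))%:C).
  have := congr1 (@complex.Im R) (@cintegral0 R); rewrite cintegralE/= => I0.
  by rewrite cintegralE; apply: complex_ext.
apply: eq_cintegral => y; rewrite cplxM kernE mulr_sumr; apply: eq_bigr => j _.
by rewrite modeD {2}/mode mulrN -[cexpi (- _)]cexpiJ -/(mode _ _) /toC; ring.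
Qed.

Lemma kcoef_ge0 n j : 0 <= kcoef n j.
Proof. by rewrite divr_ge0 ?exprn_ge0 ?ler0n. Qed.

Lemma Int_kern1 n x : Int (fun y => kern n (x - y)) = 2 * pi * kcoef n n.
Proof.
apply: complexI; have := @Int_kern (fun=> 1) n x (@cst_continuous R R (1 : R)).
have -> : (fun y => 1 * kern n (x - y)) = (fun y => kern n (x - y)).
  by apply/funext => y; rewrite mul1r.
move=> ->; have nn : (n < (2 * n).+1)%N by lia.
rewrite (bigD1 (Ordinal nn))//= big1 ?addr0.
  have -> : toC (fun=> 1) = mode 0 :> (R -> R[i]) by apply/funext => y; rewrite mode0.
  by rewrite /= subrr fc_mode eqxx mode0 !mulr1 (cplxM (2 * pi)) mulrC.
move=> j jn; have -> : toC (fun=> 1) = mode 0 :> (R -> R[i]).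
  by apply/funext => y; rewrite mode0.
rewrite fc_mode; case: eqP => [E|_]; last by rewrite !mulr0.
by case/eqP: jn; apply: val_inj => /=; lia.
Qed.

(** This ratio of successive masses makes the mean of [1 + cos] under the normalised kernel
    [(2n + 1) / (n + 1)], hence that of [1 - cos] equal to [1 / (n + 1)]. *)
Lemma kcoefS n : kcoef n.+1 n.+1 * n.+1%:R = kcoef n n * (2 * n + 1)%:R.
Proof.
have E : ('C(2 * n.+1, n.+1) * n.+1 = 2 * ('C(2 * n, n) * (2 * n + 1)))%N.
  have e1 := mul_bin_diag (2 * n.+1) n.
  have e2 := mul_bin_down (2 * n).+1 n.
  have h : (2 * n.+1 = (2 * n).+2)%N by lia.
  rewrite h/= in e1 *; rewrite /= in e2.
  have h2 : ((2 * n).+1 - n = n.+1)%N by lia.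
  rewrite h2 in e2; nia.
rewrite /kcoef mulrAC -natrM E natrM natrM exprS; field.
by rewrite expf_neq0.
Qed.

Lemma bin_middle n j : ('C(2 * n, j) <= 'C(2 * n, n))%N.
Proof.
have left i : (i <= n)%N -> ('C(2 * n, n - i) <= 'C(2 * n, n))%N.
  elim: i => [|i IH] i_n; first by rewrite subn0.
  apply: leq_trans (IH (ltnW i_n)).
  have h : (n - i = (n - i.+1).+1)%N by lia.
  have := mul_bin_left (2 * n) (n - i.+1); rewrite -h; nia.
case: (leqP j n) => jn; first by have := left (n - j)%N; rewrite subKn// leq_subr; apply.
case: (leqP j (2 * n)) => j2; last by rewrite bin_small.
rewrite -bin_sub//; have -> : (2 * n - j = n - (j - n))%N by lia.
by apply: left; lia.
Qed.

Lemma kcoef_max n j : kcoef n j <= kcoef n n.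
Proof. by rewrite /kcoef ler_wpM2r ?invr_ge0 ?exprn_ge0//; rewrite ler_nat bin_middle. Qed.

Lemma kcoef_gt0 n : 0 < kcoef n n.
Proof. by rewrite divr_gt0 ?exprn_gt0// ltr0n bin_gt0; lia. Qed.

(** The average of [w] under the kernel centred at [x] is at most [D], because the central
    coefficient of the kernel is its largest. By [cos_kernel_control] it is at least
    [w x - eps / 2 - C / (n + 1)]. No convergence of the Fourier series of [w] is involved. *)
Lemma fourier_sup_bound w (D : R) : continuous w -> Defs.periodic w ->
  (forall s : seq int, uniq s -> \sum_(k <- s) nc (fc (toC w) k) <= D) ->
  forall x, w x <= D.
Proof.
move=> cw pw wD x; apply/ler_addgt0Pr => eps e0.
have e2 : 0 < eps / 2 by rewrite divr_gt0.
have [C HC] := cos_kernel_control x cw pw e2.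
have D0 : 0 <= D by have := wD [::] isT; rewrite big_nil.
have pi0 := pi_gt0 R.
have main n : w x <= D + eps / 2 + C / n.+1%:R.
  have k0 := kcoef_gt0 n; have p0 : 0 < 2 * pi * kcoef n n by apply: mulr_gt0 => //; apply: mulr_gt0.
  have wk : continuous (fun y => w y * kern n (x - y)).
    by move=> y; apply: cvgM; [exact: cw|exact: cont_kern].
  have up : Int (fun y => w y * kern n (x - y)) <= 2 * pi * kcoef n n * D.
    apply: (le_trans (ler_norm _)); rewrite -nc_real Int_kern//.
    apply: (le_trans (nc_sum _ _ _)).
    have -> : 2 * pi * kcoef n n * D = 2 * pi * (kcoef n n * D) by ring.
    apply: (@le_trans _ _ (\sum_(j < (2 * n).+1) 2 * pi * (kcoef n n * nc (fc (toC w) (j%:Z - n%:Z))))).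
      apply: ler_sum => j _; rewrite 3!ncM nc_mode mulr1 !nc_real.
      rewrite (ger0_norm (kcoef_ge0 _ _)) ger0_norm ?mulr_ge0 ?(ltW pi0)//.
      rewrite mulrCA ler_wpM2l ?mulr_ge0 ?(ltW pi0)//.
      by rewrite ler_wpM2r ?nc_ge0// kcoef_max.
    rewrite -mulr_sumr ler_wpM2l ?mulr_ge0 ?(ltW pi0)//.
    rewrite -mulr_sumr ler_wpM2l ?kcoef_ge0//.
    have := wD [seq (j%:Z - n%:Z)%R | j <- iota 0 (2 * n).+1].
    rewrite map_inj_uniq ?iota_uniq; last by move=> i j /=; lia.
    move=> /(_ isT); rewrite big_map.
    have -> : iota 0 (2 * n).+1 = index_iota 0 (2 * n).+1 by rewrite /index_iota subn0.
    by rewrite big_mkord.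
  have lo : 2 * pi * kcoef n n * (w x - eps / 2 - C / n.+1%:R) <=
      Int (fun y => w y * kern n (x - y)).
    have kS : Int (fun y => kern n.+1 (x - y)) =
        2 * pi * kcoef n n * ((2 * n + 1)%:R / n.+1%:R).
      by rewrite Int_kern1 -[kcoef n.+1 _](@mulfK _ n.+1%:R) ?pnatr_eq0// kcoefS; ring.
    have -> : 2 * pi * kcoef n n * (w x - eps / 2 - C / n.+1%:R) =
       (w x - eps / 2 - 2 * C) * Int (fun y => kern n (x - y)) +
       C * Int (fun y => kern n.+1 (x - y)).
      rewrite kS Int_kern1 natrD natrM -[n.+1%:R]natr1.
      have : n%:R + 1 != 0 :> R by rewrite natr1 pnatr_eq0.
      by move: n%:R => z z0; field.
    have ik m : intg (fun y => kern m (x - y)) by apply: cont_intg; exact: cont_kern.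
    rewrite -!IntZ// -IntD; try exact: intgZ.
    apply: Int_le; [by apply: intgD; exact: intgZ|exact: cont_intg|].
    move=> y _.
    have -> : kern n.+1 (x - y) = (1 + cos (x - y)) * kern n (x - y) by exact: exprS.
    have := ler_wpM2r (kern_ge0 n (x - y)) (HC y).
    move: (kern n (x - y)) (cos (x - y)) (w y) (w x) => K c wy wx; nra.
  have := le_trans lo up; rewrite ler_pM2l//; move: (C / _) => z; lra.
pose n := Num.truncn (2 * `|C| / eps).
apply: (le_trans (main n)); rewrite -addrA lerD2l.
suff : C / n.+1%:R <= eps / 2 by move: (C / _) => z; lra.
rewrite ler_pdivrMr ?ltr0n// -[X in _ <= X]mulrC mulrA ler_pdivlMr//.
have : 2 * `|C| / eps < n.+1%:R by exact: truncnS_gt.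
rewrite ltr_pdivrMr//; have := ler_norm C; lra.
Qed.

End ApproximateIdentity.

(** * Discrete Fourier transform, interpolation and projection *)

Section DiscreteFourier.
Context {R : realType}.
Implicit Types (v w f g : R -> R[i]) (a b : int -> R[i]) (k l : int) (N : nat).

Local Notation fc := fourier_coef.

Definition idx N : seq int := [seq (i%:Z - N%:Z)%R | i <- iota 0 (2 * N).+1].

Lemma idx_uniq N : uniq (idx N).
Proof. by rewrite map_inj_uniq ?iota_uniq// => i j /=; lia. Qed.
Hint Resolve idx_uniq : core.

Lemma mem_idx N k : (k \in idx N) = (absz k <= N)%N.
Proof.
apply/mapP/idP => [[i +]|kN]; first by rewrite mem_iota => iN ->; lia.
by exists (absz (k + N%:Z)); rewrite ?mem_iota; lia.
Qed.

Lemma trig_polyE N a : trig_poly N a = tp (idx N) a.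
Proof.
apply/funext => x; rewrite /trig_poly /tp /idx big_map.
have -> : iota 0 (2 * N).+1 = index_iota 0 (2 * N).+1 by rewrite /index_iota subn0.
by rewrite big_mkord.
Qed.

(** Integer indices let neighbours at both ends of the grid be reached by periodicity, without
    reduction of the index. *)
Definition xnode N (j : int) : R := - pi + j%:~R * mesh N.

Lemma nodeE N (j : nat) : node N j = xnode N j%:Z. Proof. by []. Qed.

Lemma P_gt0 N : 0 < (2 * N + 1)%:R :> R. Proof. by rewrite ltr0n; lia. Qed.

Lemma mesh_gt0 N : 0 < mesh N :> R.
Proof. by rewrite divr_gt0 ?P_gt0// mulr_gt0// pi_gt0. Qed.

Lemma mesh_period N : (2 * N + 1)%:R * mesh N = 2 * pi :> R.
Proof. by rewrite mulrC divfK// gt_eqF// P_gt0. Qed.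

Lemma xnodeD N i j : xnode N (i + j) = xnode N i + j%:~R * mesh N.
Proof. by rewrite /xnode intrD; ring. Qed.

Lemma periodic_nper (V : Type) (f : R -> V) N (j : int) : Defs.periodic f ->
  f (xnode N (j + (2 * N + 1)%N%:Z)) = f (xnode N j).
Proof. by move=> pf; rewrite xnodeD -pmulrn mesh_period pf. Qed.

Lemma cexpi_eq1 (t : R) : `|t| < 2 * pi -> cexpi t = 1 -> t = 0.
Proof.
wlog t0 : t / 0 <= t => [H|].
  case: (lerP 0 t) => [/H//|t0] tp t1.
  suff : - t = 0 by lra.
  by apply: H; [lra|rewrite normrN|rewrite -cexpiJ t1 conjc1].
rewrite ger0_norm// => tp [c1 _]; apply/eqP; rewrite eq_le t0 andbT leNgt.
apply/negP => tgt0; have : 0 < sin (t / 2) by apply: sin_gt0_pi; apply/andP; split; lra.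
have := oneBcos t; rewrite c1 subrr => /esym/eqP.
by rewrite mulf_eq0 pnatr_eq0/= sqrf_eq0 => /eqP ->; rewrite ltxx.
Qed.

Lemma geom_root (z : R[i]) (n : nat) : z ^+ n = 1 -> z != 1 -> \sum_(j < n) z ^+ j = 0.
Proof.
move=> zn z1; have := subrX1 z n; rewrite zn subrr => /esym/eqP.
by rewrite mulf_eq0 subr_eq0 (negPf z1)/= => /eqP.
Qed.

Lemma cexpiX (t : R) (n : nat) : cexpi t ^+ n = cexpi (n%:R * t).
Proof.
elim: n => [|n IH]; first by rewrite mul0r cexpi0.
by rewrite exprS IH -cexpiD -natr1; congr cexpi; ring.
Qed.

Lemma dvdz_lt_eq0 (p m : int) : (p %| m)%Z -> (absz m < absz p)%N -> m = 0.
Proof.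
rewrite dvdzE => pm mp; case: (posnP (absz m)) => m0; first lia.
by have := dvdn_leq m0 pm; lia.
Qed.

Lemma root_of_unity N (m : int) :
  (cexpi (m%:~R * mesh N) : R[i]) ^+ (2 * N + 1) = 1.
Proof. by rewrite cexpiX mulrCA mesh_period cexpi2pin. Qed.

Lemma root_of_unity_eq1 N (m : int) :
  (cexpi (m%:~R * mesh N) == 1 :> R[i]) = ((2 * N + 1)%N%:Z %| m)%Z.
Proof.
have P0 : ((2 * N + 1)%N%:Z != 0 :> int) by lia.
have E := divz_eq m (2 * N + 1)%N%:Z.
have r0 := modz_ge0 m P0; have rP := ltz_mod m P0.
set q := (m %/ _)%Z in E; set r := (m %% _)%Z in E r0 rP.
have -> : cexpi (m%:~R * mesh N) = cexpi (r%:~R * mesh N) :> R[i].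
  rewrite {1}E intrD mulrDl cexpiD intrM -mulrA -pmulrn mesh_period cexpi2pin.
  by rewrite mul1r.
have -> : ((2 * N + 1)%N%:Z %| m)%Z = (r == 0) by apply/dvdz_mod0P/eqP.
apply/eqP/eqP => [H|->]; last by rewrite mul0r cexpi0.
apply/eqP; rewrite -(@intr_eq0 R); apply/eqP.
have hN := mesh_gt0 N.
have : r%:~R * mesh N = 0 :> R.
  apply: cexpi_eq1 H; rewrite -(mesh_period N).
  have r0R : 0 <= r%:~R :> R by rewrite ler0z.
  rewrite ger0_norm; last by apply: mulr_ge0 => //; exact: ltW.
  rewrite ltr_pM2r//.
  by rewrite pmulrn ltr_int; lia.
by move/eqP; rewrite mulf_eq0 (gt_eqF hN) orbF => /eqP.
Qed.

Lemma node_orth N (m : int) : \sum_(j < (2 * N + 1)%N) mode m (xnode N j%:Z) =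
  if ((2 * N + 1)%N%:Z %| m)%Z then (2 * N + 1)%:R * mode m (- pi) else 0 :> R[i].
Proof.
have E j : mode m (xnode N j%:Z) = mode m (- pi) * cexpi (m%:~R * mesh N) ^+ j :> R[i].
  by rewrite modeD cexpiX {2}/mode; congr (_ * cexpi _); rewrite -pmulrn; ring.
under eq_bigr do rewrite E.
rewrite -mulr_sumr -root_of_unity_eq1; case: eqP => [->|/eqP z1].
  under eq_bigr do rewrite expr1n.
  by rewrite sumr_const card_ord mulrC.
by rewrite geom_root ?mulr0// root_of_unity.
Qed.

Definition dft N v k : R[i] := (2 * N + 1)%:R^-1 *
  \sum_(j < (2 * N + 1)%N) v (xnode N j%:Z) * mode (- k) (xnode N j%:Z).

Lemma PC_neq0 N : (2 * N + 1)%:R != 0 :> R[i].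
Proof. by rewrite pnatr_eq0; lia. Qed.

Lemma dftE N v k : (2 * N + 1)%:R * dft N v k =
  \sum_(j < (2 * N + 1)%N) v (xnode N j%:Z) * mode (- k) (xnode N j%:Z).
Proof. by rewrite mulrA divff ?mul1r// PC_neq0. Qed.

(** Aliasing: frequencies congruent modulo [2N + 1] cannot be distinguished on the grid. The phase,
    of modulus one, appears because the nodes start at [- pi]. *)
Lemma dft_tp N s a k : dft N (tp s a) k =
  \sum_(l <- s | ((2 * N + 1)%N%:Z %| (l - k))%Z) a l * mode (l - k) (- pi).
Proof.
rewrite /dft /tp.
under eq_bigr => j _ do rewrite mulr_suml.
rewrite exchange_big/= mulr_sumr [RHS]big_mkcond; apply: eq_bigr => l _.
under eq_bigr => j _ do rewrite -mulrA modeM.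
rewrite -mulr_sumr node_orth; case: ifP => _; last by rewrite !mulr0.
by rewrite mulrCA [_ * (_ * mode _ _)]mulrA mulVf ?mul1r// PC_neq0.
Qed.

Lemma dft_tp_idx N a k : k \in idx N -> dft N (tp (idx N) a) k = a k.
Proof.
move=> kN; rewrite dft_tp big_mkcond (bigD1_seq k)// subrr dvdz0 mode0 mulr1.
rewrite big1_seq; first exact: addr0.
move=> l /andP[lk lN]; case: ifP => // /dvdz_lt_eq0 E.
by move: kN lN; rewrite !mem_idx => kN lN; case/eqP: lk; lia.
Qed.

Lemma tp_dft_node N v (j : nat) : (j <= 2 * N)%N ->
  tp (idx N) (dft N v) (xnode N j%:Z) = v (xnode N j%:Z).
Proof.
move=> jN; rewrite /tp /dft.
under eq_bigr => k _ do rewrite -mulrA mulr_suml.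
rewrite -mulr_sumr exchange_big/=.
have jP : (j < 2 * N + 1)%N by lia.
have E (i : nat) : \sum_(k <- idx N) v (xnode N i%:Z) * mode (- k) (xnode N i%:Z) *
    mode k (xnode N j%:Z) = if ((2 * N + 1)%N%:Z %| (j%:Z - i%:Z))%Z then
     (2 * N + 1)%:R * v (xnode N i%:Z) * cexpi (- N%:R * ((j%:Z - i%:Z)%:~R * mesh N)) else 0.
  under eq_bigr => k _.
    rewrite -mulrA.
    have -> : mode (- k) (xnode N i%:Z) * mode k (xnode N j%:Z) =
      cexpi (k%:~R * ((j%:Z - i%:Z)%:~R * mesh N)).
      by rewrite /mode -cexpiD /xnode intrB mulrNz; congr cexpi; ring.
    over.
  rewrite -mulr_sumr /idx big_map.
  have -> : iota 0 (2 * N).+1 = index_iota 0 (2 * N + 1) by rewrite /index_iota subn0 addn1.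
  rewrite big_mkord; set z := (_ * mesh N).
  under eq_bigr => l _.
    have -> : cexpi ((l%:Z - N%:Z)%:~R * z) = cexpi (- N%:R * z) * cexpi z ^+ l.
      by rewrite cexpiX -cexpiD intrB -!pmulrn; congr cexpi; ring.
    over.
  rewrite -mulr_sumr -root_of_unity_eq1 -/z; case: eqP => [->|/eqP z1].
    under eq_bigr do rewrite expr1n.
    by rewrite sumr_const card_ord; ring.
  by rewrite geom_root ?root_of_unity// !mulr0.
rewrite (bigD1 (Ordinal jP))//= (E j) subrr dvdz0 big1 ?addr0.
  by rewrite mul0r mulr0 cexpi0 mulr1 mulKf// PC_neq0.
move=> i ij; rewrite E; case: ifP => // /dvdz_lt_eq0 Q.
have iP := ltn_ord i; case/eqP: ij; apply: val_inj => /=; lia.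
Qed.

(** The discrete transform reads the coefficients of any candidate off its nodal values, which gives
    uniqueness; hence the chosen interpolant is this one. *)
Lemma interpN_dft N v : interpN N v = tp (idx N) (dft N v).
Proof.
rewrite /interpN; set Q := (X in xget _ X).
have QE w : Q w -> w = tp (idx N) (dft N v).
  move=> [[a ->] Ha]; rewrite trig_polyE; apply: eq_tp => k kN.
  rewrite -(dft_tp_idx a kN) /dft; congr (_ * _); apply: eq_bigr => j _.
  by rewrite -nodeE -trig_polyE Ha//; have := ltn_ord j; lia.
apply: QE; apply: (@xgetPex _ (fun=> 0) Q); exists (tp (idx N) (dft N v)); split.
  by exists (dft N v); rewrite trig_polyE.
by move=> j jN; rewrite nodeE tp_dft_node.
Qed.

Lemma projN_fc N v : L2 v -> projN N v = tp (idx N) (fc v).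
Proof.
move=> Lv; rewrite /projN; set Q := (X in xget _ X).
have XNmode k : k \in idx N -> XN N (mode k : R -> R[i]).
  move=> kN; exists (fun l => (l == k)%:R); apply/funext => x.
  rewrite trig_polyE /tp (bigD1_seq k)// eqxx mul1r big1; first exact/esym/addr0.
  by move=> l /negPf ->; rewrite mul0r.
have QE w : Q w -> w = tp (idx N) (fc v).
  move=> [[a ->] Ha]; rewrite trig_polyE in Ha *; apply: eq_tp => k kN.
  have := Ha _ (XNmode k kN); rewrite inner_fc => /eqP.
  rewrite mulf_eq0 (negPf pi2_neq0)/= fcB//; last exact: L2_tp.
  by rewrite fc_tp// kN subr_eq0 => /eqP.
apply: QE; apply: (@xgetPex _ (fun=> 0) Q); exists (tp (idx N) (fc v)); split.
  by exists (fc v); rewrite trig_polyE.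
move=> phi [a ->]; rewrite trig_polyE inner_sumr; last by apply: L2B => //; exact: L2_tp.
apply: big1_seq => k /= kN; rewrite inner_fc fcB//; last exact: L2_tp.
by rewrite fc_tp// kN subrr !mulr0.
Qed.

Lemma airyN_tp N (t : R) a : airyN N t (tp (idx N) a) =
  tp (idx N) (fun k => cexpi (t * k%:~R ^+ 3) * a k).
Proof.
by rewrite /airyN trig_polyE; apply: eq_tp => k kN; rewrite fc_tp// kN.
Qed.

(** The symbol of the second difference, [- 4 sin^2 (k h / 2) / h^2], bounded by [k ^+ 2] uniformly
    in [h]. *)
Definition sym2 (h : R) k : R := (2 * cos (k%:~R * h) - 2) / h ^+ 2.

Lemma delta2_tp (h : R) s a : delta2 h (tp s a) = tp s (fun k => (sym2 h k)%:C * a k).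
Proof.
apply/funext => x; rewrite /delta2 /tp mulr_sumr -sumrB -big_split/= mulr_suml.
apply: eq_bigr => k _; rewrite !modeD /sym2.
have -> : mode k (- h) = conjc (mode k h) :> R[i].
  by rewrite -modeN /mode mulrNz mulrN mulNr.
have -> : ((2 * cos (k%:~R * h) - 2) / h ^+ 2)%:C =
    (mode k h + conjc (mode k h) - 2) * (h ^+ 2)^-1%:C.
  rewrite cplxM; congr (_ * _); have -> : 2 = 2%:C :> R[i] by rewrite rmorph_nat.
  by apply: complex_ext => /=; ring.
have -> : (h ^+ 2)%:C^-1 = (h ^+ 2)^-1%:C by rewrite -fmorphV.
ring.
Qed.

Lemma discrete_parseval N a :
  \sum_(j < (2 * N + 1)%N) nc (tp (idx N) a (xnode N j%:Z)) ^+ 2 =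
  (2 * N + 1)%:R * \sum_(k <- idx N) nc (a k) ^+ 2.
Proof.
apply: complexI; rewrite cplx_sum cplxM cplx_sum mulr_sumr.
have -> : (2 * N + 1)%:R%:C = (2 * N + 1)%:R :> R[i] by rewrite rmorph_nat.
transitivity (\sum_(k <- idx N) conjc (a k) *
   \sum_(j < (2 * N + 1)%N) tp (idx N) a (xnode N j%:Z) * mode (- k) (xnode N j%:Z)).
  under [RHS]eq_bigr do rewrite mulr_sumr.
  rewrite exchange_big/=; apply: eq_bigr => j _; rewrite -mulcJ.
  have -> : conjc (tp (idx N) a (xnode N j%:Z)) =
     \sum_(k <- idx N) conjc (a k) * mode (- k) (xnode N j%:Z).
    by rewrite /tp conjc_sumM; apply: eq_bigr => k _; rewrite modeN.
  by rewrite mulr_sumr; apply: eq_bigr => k _; rewrite mulrCA.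
apply: eq_big_seq => k kN; rewrite -dftE dft_tp_idx// -mulcJ; ring.
Qed.

(** The symmetry of the coefficients of a real function. The scheme preserves it, so the energy
    estimate can be run on real nodal values. *)
Definition herm a := forall k, a (- k) = conjc (a k).

Lemma herm_real N a x : herm a -> Im (tp (idx N) a x) = 0.
Proof.
move=> ha; have E : conjc (tp (idx N) a x) = tp (idx N) a x.
  have -> : conjc (tp (idx N) a x) = \sum_(k <- idx N) conjc (a k) * conjc (mode k x).
    exact: conjc_sumM.
  have perm : perm_eq (idx N) [seq (- k)%R | k <- idx N].
    apply: uniq_perm => //; first by rewrite map_inj_uniq//; exact: oppr_inj.
    move=> k; rewrite mem_idx; apply/idP/mapP => [kN|[l +]].
      by exists (- k); rewrite ?opprK// mem_idx; lia.
    by rewrite mem_idx => lN ->; lia.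
  rewrite /tp [RHS](perm_big _ perm) [RHS]big_map.
  by apply: eq_bigr => k _; rewrite ha modeN.
by move: E; case: (tp _ _ _) => u v /= [] v0; lra.
Qed.

End DiscreteFourier.

(** * Complex functions of time: derivatives, mean value bound, essential bounds *)

Section ComplexDerivative.
Context {R : realType}.
Implicit Types (f : R -> R[i]) (t : R).

Definition cder f t (d : R[i]) :=
  is_derive t 1 (re f) (Re d) /\ is_derive t 1 (im f) (Im d).

Definition cwithin (A : set R) f :=
  {within A, continuous (re f)} /\ {within A, continuous (im f)}.

Lemma is_derive_sumseq (I : Type) (s : seq I) (F : I -> R -> R) (G : I -> R) t :
  (forall i, is_derive t 1 (F i) (G i)) ->
  is_derive t 1 (fun x => \sum_(i <- s) F i x) (\sum_(i <- s) G i).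
Proof.
move=> dF; elim: s => [|i s IH].
  rewrite big_nil (_ : (fun x => _) = cst 0); first exact: is_derive_cst.
  by apply/funext => x; rewrite big_nil.
rewrite big_cons (_ : (fun x => _) = F i \+ (fun x => \sum_(j <- s) F j x)).
  exact: is_deriveD.
by apply/funext => x; rewrite big_cons.
Qed.

Lemma within_sumseq (I : Type) (A : set R) (s : seq I) (F : I -> R -> R) :
  (forall i, {within A, continuous (F i)}) ->
  {within A, continuous (fun x => \sum_(i <- s) F i x)}.
Proof.
move=> cF; elim: s => [|i s IH].
  rewrite (_ : (fun x => _) = cst 0); first exact: cst_continuous.
  by apply/funext => x; rewrite big_nil.
rewrite (_ : (fun x => _) = F i \+ (fun x => \sum_(j <- s) F j x)).
  by move=> x; apply: cvgD; [exact: cF|exact: IH].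
by apply/funext => x; rewrite big_cons.
Qed.

(** The scalar mean value theorem is applied to the real inner product of [r t] with the fixed total
    increment; Cauchy-Schwarz then lets one factor of the norm of the increment cancel. *)
Lemma mean_value_l2 (I : Type) (s : seq I) (r dr : I -> R -> R[i]) (t0 t1 D : R) :
  t0 <= t1 -> 0 <= D ->
  (forall i, cwithin `[t0, t1]%classic (r i)) ->
  (forall i t, t0 < t < t1 -> cder (r i) t (dr i t)) ->
  (forall t, t0 < t < t1 -> \sum_(i <- s) nc (dr i t) ^+ 2 <= D ^+ 2) ->
  \sum_(i <- s) nc (r i t1 - r i t0) ^+ 2 <= (D * (t1 - t0)) ^+ 2.
Proof.
move=> t01 D0 cr ddr Db.
have [<-|t01n] := eqVneq t0 t1.
  rewrite big1 ?sqr_ge0// => i _.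
  by rewrite subrr nc0 expr0n.
have {t01n}t01' : t0 < t1 by rewrite lt_neqAle t01n.
pose x i := Re (r i t1 - r i t0); pose y i := Im (r i t1 - r i t0).
pose phi t := \sum_(i <- s) (x i * re (r i) t + y i * im (r i) t).
pose dphi t := \sum_(i <- s) (x i * Re (dr i t) + y i * Im (dr i t)).
have cphi : {within `[t0, t1], continuous phi}.
  apply: within_sumseq => i z; apply: cvgD; apply: cvgM.
  - exact: cvg_cst.
  - exact: (cr i).1.
  - exact: cvg_cst.
  - exact: (cr i).2.
have d1 t : t \in `]t0, t1[%R -> is_derive t 1 phi (dphi t).
  rewrite in_itv/= => tI.
  suff : forall i, is_derive t 1 (fun t => x i * re (r i) t + y i * im (r i) t)
      (x i * Re (dr i t) + y i * Im (dr i t)) by exact: is_derive_sumseq.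
  move=> i; have [h1 h2] := ddr i t tI.
  have -> : (fun t => x i * re (r i) t + y i * im (r i) t) =
    (x i \*: re (r i)) \+ (y i \*: im (r i)) by [].
  by apply: is_derive_eq.
have [xi xiI E] := MVT t01' d1 cphi.
set B2 := \sum_(i <- s) nc (r i t1 - r i t0) ^+ 2.
have EB : phi t1 - phi t0 = B2.
  rewrite /phi -sumrB; apply: eq_bigr => i _.
  by rewrite nc_sqr /x /y ReD ReN ImD ImN /re /im; ring.
have B20 : 0 <= B2 by apply: sumr_ge0 => i _; exact: sqr_ge0.
have dB : dphi xi <= Num.sqrt B2 * D.
  apply: (@le_trans _ _ (\sum_(i <- s) nc (r i t1 - r i t0) * nc (dr i xi))).
    apply: ler_sum => i _; rewrite -[nc (r i t1 - _)]ncJ -ncM.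
    apply: le_trans (le_trans (ler_norm _) (nc_Re _)).
    by rewrite ReM /x /y; case: (r i t1 - r i t0) => a b /=; lra.
  apply: cauchy_schwarz_le => //; last exact: Db.
  by rewrite sqr_sqrtr.
have B2D : B2 <= Num.sqrt B2 * (D * (t1 - t0)).
  by rewrite -{1}EB E mulrA ler_wpM2r ?subr_ge0.
have s0 := sqrtr_ge0 B2; have sB := sqr_sqrtr B20.
have sD : Num.sqrt B2 <= D * (t1 - t0).
  have [->|sn0] := eqVneq (Num.sqrt B2) 0; first by rewrite mulr_ge0 ?subr_ge0.
  have sgt0 : 0 < Num.sqrt B2 by rewrite lt_def sn0.
  by rewrite -(ler_pM2l sgt0) -expr2 sB.
by rewrite -sB ler_pXn2r ?nnegrE ?mulr_ge0 ?subr_ge0.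
Qed.

Lemma is_derive_quotient (f : R -> R) t d :
  (forall eps, 0 < eps -> exists2 del, 0 < del & forall s, s != t -> `|s - t| < del ->
     `|(f s - f t) / (s - t) - d| < eps) -> is_derive t 1 f d.
Proof.
move=> H.
have cv : (fun h => h^-1 *: (f (h *: (1 : R) + t) - f t)) @ 0^' --> d.
  apply/cvgrPdist_lt => eps e0; have [del d0 Hd] := H eps e0.
  apply/nbhs_ballP; exists del => //= h; rewrite /ball/= sub0r normrN => hd h0.
  have ht : h + t != t by rewrite -subr_eq0 addrK.
  have := Hd (h + t) ht; rewrite addrK => /(_ hd).
  by rewrite distrC /GRing.scale/= mulr1 mulrC.
apply: DeriveDef; first by apply/cvg_ex; exists d.
exact: cvg_lim.
Qed.

Lemma cder_rotation f t t0 (om : R) (d : R[i]) : cder f t d ->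
  cder (fun s => cexpi (- (om * (s - t0))) * f s) t
       (cexpi (- (om * (t - t0))) * (d - (0 +i* om) * f t)).
Proof.
move=> [dr di].
have dl : is_derive t 1 (fun s : R => om * (s - t0)) om.
  have -> : (fun s : R => om * (s - t0)) = om \*: ((id : R -> R) \- cst t0) by [].
  by apply: is_derive_eq; rewrite /GRing.scale/= subr0 mulr1.
have dc : is_derive t 1 (fun s : R => cos (om * (s - t0))) (- sin (om * (t - t0)) * om).
  exact: (@is_derive1_comp _ cos (fun s => om * (s - t0)) t (- sin (om * (t - t0))) om).
have ds : is_derive t 1 (fun s : R => sin (om * (s - t0))) (cos (om * (t - t0)) * om).
  exact: (@is_derive1_comp _ sin (fun s => om * (s - t0)) t (cos (om * (t - t0))) om).
split.
  have -> : re (fun s => cexpi (- (om * (s - t0))) * f s) =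
      (fun s : R => cos (om * (s - t0))) * re f + (fun s : R => sin (om * (s - t0))) * im f.
    by apply/funext => s; rewrite /re ReM /= cosN sinN /im mulNr opprK.
  apply: is_derive_eq; rewrite /GRing.scale/= !ReM/= cosN sinN.
  by rewrite ReD ReN ImD ImN ReM ImM/= /re /im; ring.
have -> : im (fun s => cexpi (- (om * (s - t0))) * f s) =
    (fun s : R => cos (om * (s - t0))) * im f - (fun s : R => sin (om * (s - t0))) * re f.
  by apply/funext => s; rewrite /im ImM /= cosN sinN /re mulNr.
apply: is_derive_eq; rewrite /GRing.scale/= !ImM/= cosN sinN.
by rewrite ReD ReN ImD ImN ReM ImM/= /re /im; ring.
Qed.

Lemma cwithin_rotation (A : set R) f t0 (om : R) : cwithin A f ->
  cwithin A (fun s => cexpi (- (om * (s - t0))) * f s).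
Proof.
move=> [cr ci].
have cl : continuous (fun s : R => om * (s - t0)).
  move=> s; apply: cvgM; first exact: cvg_cst.
  by apply: cvgB; [exact: cvg_id|exact: cvg_cst].
have cc : {within A, continuous (fun s : R => cos (om * (s - t0)))}.
  apply: continuous_subspaceT => s.
  by apply: continuous_comp; [exact: cl|exact: continuous_cos].
have cs : {within A, continuous (fun s : R => sin (om * (s - t0)))}.
  apply: continuous_subspaceT => s.
  by apply: continuous_comp; [exact: cl|exact: continuous_sin].
split.
  have -> : re (fun s => cexpi (- (om * (s - t0))) * f s) =
      (fun s : R => cos (om * (s - t0)) * re f s + sin (om * (s - t0)) * im f s).
    by apply/funext => s; rewrite /re ReM /= cosN sinN /im mulNr opprK.
  move=> x; apply: cvgD; apply: cvgM; [exact: cc|exact: cr|exact: cs|exact: ci].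
have -> : im (fun s => cexpi (- (om * (s - t0))) * f s) =
    (fun s : R => cos (om * (s - t0)) * im f s - sin (om * (s - t0)) * re f s).
  by apply/funext => s; rewrite /im ImM /= cosN sinN /re mulNr.
move=> x; apply: cvgB; apply: cvgM; [exact: cc|exact: ci|exact: cs|exact: cr].
Qed.

Lemma cder_affine f t t0 (b d : R[i]) : cder f t d ->
  cder (fun s => f s + (s - t0)%:C * b) t (d + b).
Proof.
move=> [dr di].
have dl : is_derive t 1 (fun s : R => s - t0) 1.
  have -> : (fun s : R => s - t0) = (id : R -> R) \- cst t0 by [].
  by apply: is_derive_eq; rewrite subr0.
split.
  have -> : re (fun s => f s + (s - t0)%:C * b) = re f + Re b \*: (fun s : R => s - t0).
    apply/funext => s; transitivity (re f s + Re b * (s - t0)); last by [].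
    by rewrite /re ReD ReM /=; ring.
  by apply: is_derive_eq; rewrite ReD /GRing.scale/= mulr1.
have -> : im (fun s => f s + (s - t0)%:C * b) = im f + Im b \*: (fun s : R => s - t0).
  apply/funext => s; transitivity (im f s + Im b * (s - t0)); last by [].
  by rewrite /im ImD ImM /=; ring.
by apply: is_derive_eq; rewrite ImD /GRing.scale/= mulr1.
Qed.

Lemma cwithin_affine (A : set R) f t0 (b : R[i]) : cwithin A f ->
  cwithin A (fun s => f s + (s - t0)%:C * b).
Proof.
move=> [cr ci].
have cl (c : R) : {within A, continuous (fun s : R => (s - t0) * c)}.
  apply: continuous_subspaceT => s; apply: cvgM; last exact: cvg_cst.
  by apply: cvgB; [exact: cvg_id|exact: cvg_cst].
split.
  have -> : re (fun s => f s + (s - t0)%:C * b) = fun s => re f s + (s - t0) * Re b.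
    by apply/funext => s; rewrite /re ReD ReM /=; ring.
  by move=> x; apply: cvgD; [exact: cr|exact: cl].
have -> : im (fun s => f s + (s - t0)%:C * b) = fun s => im f s + (s - t0) * Im b.
  by apply/funext => s; rewrite /im ImD ImM /=; ring.
by move=> x; apply: cvgD; [exact: ci|exact: cl].
Qed.

Lemma cwithin_subset (A B : set R) f : A `<=` B -> cwithin B f -> cwithin A f.
Proof.
by move=> AB [cr ci]; split; [apply: continuous_subspaceW cr|apply: continuous_subspaceW ci].
Qed.

(** If [phi] exceeded [L] at a point, it would do so on an interval, which would lie in the
    exceptional null set. This turns essential bounds into bounds at every point, endpoints
    included. *)
Lemma ae_le_closed (S T L : R) (phi : R -> R) (P : R -> Prop) : S < T ->
  {within `[S, T], continuous phi} ->
  {ae (@lebesgue_measure R), forall t, `]S, T[%classic t -> P t} ->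
  (forall t, S < t < T -> P t -> phi t <= L) ->
  forall t, S <= t <= T -> phi t <= L.
Proof.
move=> T0 /subspace_continuousP cphi [N [mN N0 PN]] HP t /andP[t0 tT].
rewrite leNgt; apply/negP => Lt.
have tI : `[S, T]%classic t by rewrite /= in_itv/= t0 tT.
have e0 : 0 < phi t - L by rewrite subr_gt0.
have := cphi t tI; move/cvgrPdist_lt => /(_ _ e0).
rewrite /prop_near1 /within/= => /nbhs_ballP[del /= d0 Hd].
(* The neighbourhood is clipped to the segment, since [t] may be an endpoint. *)
pose p := Num.max S (t - del); pose q := Num.min T (t + del).
have pq : p < q.
  by rewrite /p /q gt_max !lt_min; apply/andP; split; apply/andP; split; lra.
have sub : `]p, q[%classic `<=` N.
  move=> s /=; rewrite in_itv/= /p /q gt_max lt_min => /andP[/andP[s1 s2] /andP[s3 s4]].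
  apply: PN => /= H.
  have sI : S < s < T by rewrite s1 s3.
  have Ps : P s by apply: H; rewrite /= in_itv.
  have phis := HP s sI Ps.
  have ts : ball t del s by rewrite /ball/= ltr_norml; apply/andP; split; lra.
  have sST : s \in `[S, T] by rewrite in_itv/=; apply/andP; split; exact: ltW.
  have : `|phi t - phi s| < phi t - L := Hd s ts sST.
  by rewrite ltr_norml => /andP[_]; lra.
have : (lebesgue_measure (`]p, q[%classic : set R) <= lebesgue_measure N)%E.
  by apply: le_measure => //; rewrite inE//; exact: measurable_itv.
rewrite N0 lebesgue_measure_itv/= lte_fin pq -EFinB lee_fin; lra.
Qed.

End ComplexDerivative.

(** * Sobolev norms, essential suprema and Fourier tails *)

Section SobolevCoefficients.
Context {R : realType}.
Implicit Types (v w : R -> R[i]) (k : int) (s : seq int) (m j : nat).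

Local Notation fc := fourier_coef.
Local Notation wd := weak_derivative.

Lemma Hp_wd m v j : Hp m v -> (j <= m)%N -> L2 (wd j v) /\ is_weak_derivative j v (wd j v).
Proof.
move=> [_ _ H] jm; have [g Lg wg] := H j jm.
have := @xgetPex _ (fun=> 0) [set g : R -> R[i] | L2 g /\ is_weak_derivative j v g].
by apply; exists g.
Qed.

Lemma ncX (z : R[i]) n : nc (z ^+ n) = nc z ^+ n.
Proof.
elim: n => [|n IH]; first by rewrite !expr0 Normc.normc1.
by rewrite !exprS ncM IH.
Qed.

Lemma nc_imag (x : R) : nc (0 +i* x) = `|x|.
Proof. by rewrite /= expr0n add0r sqrtr_sqr. Qed.

Lemma normH_ge0 m v : 0 <= normH m v. Proof. exact: sqrtr_ge0. Qed.

Lemma Hp_coef m v j s : Hp m v -> (j <= m)%N -> uniq s ->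
  \sum_(k <- s) (`|k%:~R| ^+ j * nc (fc v k)) ^+ 2 <= normH m v ^+ 2.
Proof.
move=> Hv jm us; have [Lg wg] := Hp_wd Hv jm; have [_ Lv _] := Hv.
have -> : \sum_(k <- s) (`|k%:~R| ^+ j * nc (fc v k)) ^+ 2 =
    \sum_(k <- s) nc (fc (wd j v) k) ^+ 2.
  apply: eq_bigr => k _.
  by rewrite (fc_weak_derivative k Lv Lg wg) ncM ncX nc_imag.
apply: (le_trans (bessel Lg us)).
rewrite /normH sqr_sqrtr; last by apply: sumr_ge0 => i _; exact: sqr_ge0.
rewrite (bigD1 (Ordinal (jm : (j < m.+1)%N)))//= lerDl.
by apply: sumr_ge0 => i _; exact: sqr_ge0.
Qed.

Lemma Hp_coef0 m v k : Hp m v -> nc (fc v k) <= normH m v.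
Proof.
move=> Hv; have := @Hp_coef m v 0 [:: k] Hv (leq0n m) isT.
by rewrite big_seq1 expr0 mul1r ler_pXn2r ?nnegrE ?nc_ge0 ?normH_ge0.
Qed.

Lemma smooth_cont (phi : R -> R) n : smooth_periodic phi -> continuous (derive1n n phi).
Proof.
move=> [_ H] x; exact/differentiable_continuous/derivable1_diffP.
Qed.

Lemma weak_derivativeB m v w g1 g2 : L2 v -> L2 w -> L2 g1 -> L2 g2 ->
  is_weak_derivative m v g1 -> is_weak_derivative m w g2 ->
  is_weak_derivative m (fun x => v x - w x) (fun x => g1 x - g2 x).
Proof.
move=> Lv Lw L1 L2' vg wg phi sphi.
have cI f (p : R -> R) : L2 f -> continuous p -> cintg (fun x => f x * toC p x).
  by move=> Lf cp; apply: L2_cintg_mul => //; apply: ccont_L2; exact: ccont_toC.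
have c0 := @smooth_cont phi 0 sphi; rewrite derive1n0 in c0.
have cm := @smooth_cont phi m sphi.
have lin f g (p : R -> R) : L2 f -> L2 g -> continuous p ->
    cintegral (fun x => (f x - g x) * toC p x) =
    cintegral (fun x => f x * toC p x) - cintegral (fun x => g x * toC p x).
  move=> Lf Lg cp; rewrite -[- cintegral _]mulN1r -cintegralZ; last exact: cI.
  rewrite -cintegralD; [|exact: cI|by apply: cintgZ; exact: cI].
  by apply: eq_cintegral => x; rewrite mulrBl mulN1r.
by rewrite !lin// vg// wg// mulrBr.
Qed.

Lemma HpB m v w : Hp m v -> Hp m w -> Hp m (v \- w).
Proof.
move=> Hv Hw; have [pv Lv _] := Hv; have [pw Lw _] := Hw; split.
- by move=> x /=; rewrite pv pw.
- exact: L2B.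
- move=> j jm; have [L1 w1] := Hp_wd Hv jm; have [L2' w2] := Hp_wd Hw jm.
  exists (fun x => wd j v x - wd j w x); first exact: L2B.
  exact: weak_derivativeB.
Qed.

Lemma fc_toC_herm (f : R -> R) : continuous f -> herm (fc (toC f)).
Proof.
move=> cf k; have Lf : L2 (toC f) by apply: ccont_L2; exact: ccont_toC.
have E : inner (toC f) (mode (- k)) = conjc (inner (toC f) (mode k)).
  rewrite -innerJ//; last exact: L2_mode.
  rewrite !innerE; apply: eq_cintegral => x.
  by rewrite -modeN opprK mulrC; congr (_ * _); rewrite /toC conjc_real.
have hE l : (2 * pi)%:C * fc (toC f) l = inner (toC f) (mode l) by rewrite inner_fc.
have := E; rewrite -!hE conjcM conjc_real => /(mulfI pi2_neq0).
by [].
Qed.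

Lemma Linfty_ae (A : set R) (f : R -> R) (L : R) : (Linfty A f <= L%:E)%E ->
  {ae (@lebesgue_measure R), forall t, A t -> f t <= L}.
Proof.
rewrite /Linfty /LpE unlock.
have -> : (0 < lebesgue_measure (setT : set R))%E.
  apply: (@lt_le_trans _ _ (lebesgue_measure (`]0, 1[%classic : set R))).
    by rewrite lebesgue_measure_itv/= lte_fin ltr01 sube0 lte_fin ltr01.
  by apply: le_measure; rewrite ?inE//; exact: measurable_itv.
move/ess_supP; apply: filterS => t /= H At.
move: H; rewrite /patch; have -> : t \in A by rewrite inE.
by rewrite /= lee_fin; apply: le_trans; exact: ler_norm.
Qed.

Lemma normL2_mul_sup v w (C : R) : ccont v -> L2 w -> 0 <= C -> (forall x, nc (v x) <= C) ->
  normL2 (fun x => v x * w x) <= C * normL2 w.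
Proof.
move=> cv Lw C0 vC; have Lvw := L2_mulcont cv Lw.
rewrite -(@ler_pXn2r _ 2%N) ?nnegrE ?mulr_ge0 ?normL2_ge0// exprMn !normL2_sqr//.
have/L2P[[_ fr] [_ fi]] := Lw; have/L2P[[_ gr] [_ gi]] := Lvw.
rewrite -IntZ; last exact: intgD.
apply: Int_le; [exact: intgD|by apply: intgZ; exact: intgD|].
move=> x _; rewrite -!nc_sqr ncM exprMn ler_wpM2r ?sqr_ge0//.
by rewrite ler_pXn2r ?nnegrE ?nc_ge0.
Qed.

Lemma mesh_ge N : 1 <= mesh N * N.+1%:R :> R.
Proof.
rewrite /mesh mulrAC ler_pdivlMr ?P_gt0// mul1r.
have := pi_ge2 R; rewrite -[N.+1%:R]natr1 natrD natrM => p2.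
have n0 : 0 <= N%:R :> R by rewrite ler0n.
have := ler_wpM2r n0 p2; lra.
Qed.

(** A frequency discarded by the grid is worth a factor [h]: truncation and aliasing errors trade
    one weight for one power of [h] through this bound. *)
Lemma mesh_out N k : k \notin idx N -> 1 <= mesh N * `|k%:~R| :> R.
Proof.
rewrite mem_idx -ltnNge => kN; apply: (le_trans (mesh_ge N)).
rewrite ler_wpM2l ?(ltW (mesh_gt0 N))//.
by rewrite -intr_norm pmulrn ler_int; lia.
Qed.

(** The remainder is a continuous real function whose coefficients vanish on [idx N] and gain a
    factor [h] outside; [fourier_sup_bound] applies to it and to its negative. *)
Lemma tail_sup N (f : R -> R) (Q : R) : continuous f -> Defs.periodic f ->
  l1b (fun k => jb k * nc (fc (toC f) k)) Q ->
  forall x, nc (toC f x - tp (idx N) (fc (toC f)) x) <= mesh N * Q.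
Proof.
move=> cf pf fQ x; set a := fc (toC f).
have ha : herm a by exact: fc_toC_herm.
have ctp := ccont_tp (idx N) a.
pose w x := f x - re (tp (idx N) a) x.
have tpE y : tp (idx N) a y = (re (tp (idx N) a) y)%:C.
  by apply: complex_ext => //=; exact: herm_real.
have wE y : toC f y - tp (idx N) a y = toC w y.
  by rewrite {1}tpE /w /toC; apply: complex_ext => /=; ring.
have cw : continuous w by move=> y; apply: cvgB; [exact: cf|exact: ctp.1].
have ptp : Defs.periodic (tp (idx N) a).
  by move=> y; rewrite /tp; apply: eq_bigr => k _; rewrite mode_periodic.
have pw : Defs.periodic w by move=> y; rewrite /w /re pf ptp.
have Lf : L2 (toC f) by apply: ccont_L2; exact: ccont_toC.
have fw k : nc (fc (toC w) k) <= mesh N * (jb k * nc (a k)).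
  have -> : toC w = fun y => toC f y - tp (idx N) a y by apply/funext => y; rewrite wE.
  have h0 := ltW (mesh_gt0 N : 0 < mesh N :> R).
  rewrite fcB//; last exact: L2_tp.
  rewrite fc_tp ?idx_uniq//; case: ifPn => kN.
    by rewrite subrr nc0; apply: mulr_ge0 => //; rewrite mulr_ge0 ?nc_ge0 ?jb_ge0.
  rewrite subr0 mulrA ler_peMl ?nc_ge0//.
  apply: (le_trans (mesh_out kN)); rewrite ler_wpM2l//; exact: abs_le_jb.
have sw s : uniq s -> \sum_(k <- s) nc (fc (toC w) k) <= mesh N * Q.
  move=> us; apply: (@le_trans _ _ (\sum_(k <- s) mesh N * (jb k * nc (a k)))).
    by apply: ler_sum => k _; exact: fw.
  by rewrite -mulr_sumr ler_wpM2l ?(ltW (mesh_gt0 N))//; exact: fQ.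
have w1 := fourier_sup_bound cw pw sw x.
have cNw : continuous (fun y => - w y) by move=> y; apply: cvgN; exact: cw.
have pNw : Defs.periodic (fun y => - w y) by move=> y; rewrite pw.
have Lw : L2 (toC w) by apply: ccont_L2; exact: ccont_toC.
have sNw s : uniq s -> \sum_(k <- s) nc (fc (toC (fun y => - w y)) k) <= mesh N * Q.
  move=> us; have -> : toC (fun y => - w y) = fun y => (-1) * toC w y.
    by apply/funext => y; rewrite /toC; apply: complex_ext => /=; ring.
  under eq_bigr do rewrite fcZ// mulN1r ncN.
  exact: sw.
have w2 := fourier_sup_bound cNw pNw sNw x.
by rewrite wE nc_real ler_norml; apply/andP; split; lra.
Qed.

End SobolevCoefficients.

(** * The equation on the level of Fourier coefficients *)

Section KdVCoefficients.
Context {R : realType} (T : R) (u : R -> R -> R).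
Hypothesis T_gt0 : 0 < T.
Hypothesis u_cont : forall t, t \in `[0, T] -> continuous (u t).
Hypothesis u_Hp : C_Hp T 3 (fun t => toC (u t)).
Hypothesis u_KdV : KdV_solution T (fun t => toC (u t)).
Implicit Types (k : int) (t : R).

Local Notation fc := fourier_coef.
Local Notation wd := weak_derivative.

Definition ucoef t k : R[i] := fc (toC (u t)) k.

Definition nlcoef t k : R[i] := fc (fun x => toC (u t) x * wd 1 (toC (u t)) x) k.

(** A finite section of the convolution that represents a product with a derivative, [a b_x]. *)
Definition nlsum (a b : int -> R[i]) (s : seq int) k : R[i] :=
  \sum_(j <- s) a j * ((0 +i* (k - j)%:~R) * b (k - j)).

Lemma u_Hp3 t : 0 <= t <= T -> Hp 3 (toC (u t)).
Proof. by move=> tT; apply: (u_Hp _).1; rewrite in_itv. Qed.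

Lemma u_L2 t : 0 <= t <= T -> L2 (toC (u t)).
Proof. by move/u_Hp3 => -[]. Qed.

Lemma u_periodic t : 0 <= t <= T -> Defs.periodic (u t).
Proof. by move/u_Hp3 => -[pu _ _] x; have [] := pu x. Qed.

Lemma u_continuous t : 0 <= t <= T -> continuous (u t).
Proof. by move=> tT; apply: u_cont; rewrite in_itv. Qed.

Lemma ucoef_herm t : 0 <= t <= T -> herm (ucoef t).
Proof. by move=> tT; apply: fc_toC_herm; exact: u_continuous. Qed.

Lemma ucoef_diff (s t : R) k : 0 <= s <= T -> 0 <= t <= T ->
  nc (ucoef s k - ucoef t k) <= normH 3 (toC (u s) \- toC (u t)).
Proof.
move=> sT tT; rewrite /ucoef -fcB; try exact: u_L2.
by apply: (@Hp_coef0 R 3); apply: HpB; exact: u_Hp3.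
Qed.

Lemma ucoef_cwithin k : cwithin `[0, T]%classic (fun t => ucoef t k).
Proof.
suff H (p : R[i] -> R) : (forall z w, `|p z - p w| <= nc (z - w)) ->
    {within `[0, T], continuous (fun t => p (ucoef t k))}.
  split; apply: H => z w.
    by rewrite -ReN -ReD; exact: nc_Re.
  by rewrite -ImN -ImD; exact: nc_Im.
move=> pL; apply/subspace_continuousP => t /= tI.
have tT : 0 <= t <= T by move: tI; rewrite in_itv.
apply/cvgrPdist_lt => eps e0.
have [_ /cvgrPdist_lt/(_ _ e0)] := u_Hp tI.
rewrite /prop_near1 /within/= => /nbhs_ballP[del /= d0 Hd].
apply/nbhs_ballP; exists del => //= s /Hd Hs sI.
have sT : 0 <= s <= T by move: sI; rewrite in_itv.
rewrite -normrN opprB.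
apply: (le_lt_trans (pL _ _)); apply: (le_lt_trans (ucoef_diff k sT tT)).
by have := Hs sI; rewrite sub0r normrN ger0_norm ?normH_ge0.
Qed.

Lemma u_wd t j : 0 <= t <= T -> (j <= 3)%N ->
  L2 (wd j (toC (u t))) /\ forall k, fc (wd j (toC (u t))) k = (0 +i* k%:~R) ^+ j * ucoef t k.
Proof.
move=> tT j3; have [Lw ww] := Hp_wd (u_Hp3 tT) j3; split=> // k.
by apply: fc_weak_derivative => //; exact: u_L2.
Qed.

Lemma nl_L2 t : 0 <= t <= T -> L2 (fun x => toC (u t) x * wd 1 (toC (u t)) x).
Proof.
move=> tT; apply: L2_mulcont; first by apply: ccont_toC; exact: u_continuous.
by have [] := u_wd tT (isT : (1 <= 3)%N).
Qed.

(** Taking a coefficient is bounded on L2, so the L2 limit of the difference quotients passes to it;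
    moreover [- (ik)^3 = i k^3]. *)
Lemma ucoef_cder k t : 0 < t < T -> cder (fun t => ucoef t k) t
  ((0 +i* k%:~R ^+ 3) * ucoef t k - nlcoef t k).
Proof.
move=> tT'; have tT : 0 <= t <= T by case/andP: tT' => a b; rewrite !ltW.
have tI : t \in `]0, T] by rewrite in_itv/=; case/andP: tT' => -> /ltW ->.
set d := _ - _.
have [L3 f3] := u_wd tT (isT : (3 <= 3)%N).
have quot eps : 0 < eps -> exists2 del, 0 < del & forall s, s != t -> `|s - t| < del ->
    nc ((ucoef s k - ucoef t k) / (s - t)%:C - d) < eps.
  move=> e0; have [del d0 Hd] : exists2 del, 0 < del & forall s, ball t del s ->
      s != t -> s \in `[0, T] ->
      `|0 - normL2 (fun x => (toC (u s) x - toC (u t) x) / (s - t)%:C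
        + wd 3 (toC (u t)) x + toC (u t) x * wd 1 (toC (u t)) x)| < eps.
    have /cvgrPdist_lt/(_ _ e0) := u_KdV tI.
    by rewrite /prop_near1 /within/= => /nbhs_ballP[del /= d0 Hd]; exists del.
  case/andP: tT' => t0 tT1.
  (* This radius keeps [s] inside the time interval, so the limit restricted to that interval yields
     a two-sided derivative. *)
  exists (Num.min del (Num.min t (T - t))).
    by rewrite !lt_min d0 t0 subr_gt0.
  move=> s st; rewrite !lt_min => /and3P[sd s1 s2].
  have sT : 0 <= s <= T.
    by move: s1 s2; rewrite !ltr_norml => /andP[h1 h2] /andP[h3 h4]; apply/andP; split; lra.
  have bs : ball t del s by rewrite /ball/= distrC.
  have sI : s \in `[0, T] by rewrite in_itv.
  have := Hd s bs st sI; rewrite sub0r normrN ger0_norm ?normL2_ge0//.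
  apply: le_lt_trans.
  set G := (X in normL2 X).
  have LG : L2 G.
    apply: L2D; last exact: nl_L2.
    apply: L2D; last exact: L3.
    have -> : (fun x => (toC (u s) x - toC (u t) x) / (s - t)%:C) =
        fun x => (s - t)%:C^-1 * (toC (u s) x - toC (u t) x).
      by apply/funext => x; rewrite mulrC.
    by apply: L2Z; apply: L2B; exact: u_L2.
  suff -> : (ucoef s k - ucoef t k) / (s - t)%:C - d = fc G k by exact: fc_le.
  rewrite /G fcD; [|apply: L2D; last exact: L3|exact: nl_L2]; last first.
    have -> : (fun x => (toC (u s) x - toC (u t) x) / (s - t)%:C) =
        fun x => (s - t)%:C^-1 * (toC (u s) x - toC (u t) x).
      by apply/funext => x; rewrite mulrC.
    by apply: L2Z; apply: L2B; exact: u_L2.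
  have LB : L2 (fun x => toC (u s) x - toC (u t) x) by apply: L2B; exact: u_L2.
  have -> : (fun x => (toC (u s) x - toC (u t) x) / (s - t)%:C + wd 3 (toC (u t)) x) =
      fun x => (s - t)%:C^-1 * (toC (u s) x - toC (u t) x) + wd 3 (toC (u t)) x.
    by apply/funext => x; rewrite [_ / _]mulrC.
  rewrite fcD//; last exact: L2Z.
  rewrite fcZ// fcB; [|exact: u_L2|exact: u_L2].
  rewrite f3 -/(nlcoef t k) /d mulrC.
  have -> : (0 +i* k%:~R) ^+ 3 = - (0 +i* k%:~R ^+ 3) :> R[i].
    by rewrite !exprS expr0; apply: complex_ext; rewrite !(ReM, ImM, ReN, ImN)/=; ring.
  by rewrite -/(ucoef s k) -/(ucoef t k); ring.
have ReC (x : R) : Re x%:C = x by [].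
have ImC (x : R) : Im x%:C = 0 by [].
split; apply: is_derive_quotient => eps /quot[del d0 Hd]; exists del => // s st sd;
  apply: le_lt_trans (Hd s st sd).
  apply: le_trans (nc_Re _); rewrite [in leRHS]ReD ReN.
  have -> : (s - t)%:C^-1 = ((s - t)^-1)%:C :> R[i] by rewrite -fmorphV.
  by rewrite [Re (_ * _)]ReM ReC ImC mulr0 subr0 ReD ReN.
apply: le_trans (nc_Im _); rewrite [in leRHS]ImD ImN.
have -> : (s - t)%:C^-1 = ((s - t)^-1)%:C :> R[i] by rewrite -fmorphV.
by rewrite [Im (_ * _)]ImM ReC ImC mulr0 add0r ImD ImN.
Qed.

(** The essential supremum says nothing about a fixed time. A finite partial sum is continuous in
    time, hence its almost everywhere bound holds everywhere. *)
Lemma ucoef_bound (K : R) t j (s : seq int) : LinftyH T 3 (fun t => toC (u t)) = K%:E ->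
  0 <= t <= T -> (j <= 3)%N -> uniq s ->
  \sum_(k <- s) (`|k%:~R| ^+ j * nc (ucoef t k)) ^+ 2 <= K ^+ 2.
Proof.
move=> KE tT j3 us.
pose phi t := \sum_(k <- s) `|k%:~R| ^+ (2 * j) * (Re (ucoef t k) * Re (ucoef t k) + Im (ucoef t k) * Im (ucoef t k)).
have phiE t' : \sum_(k <- s) (`|k%:~R| ^+ j * nc (ucoef t' k)) ^+ 2 = phi t'.
  by apply: eq_bigr => k _; rewrite exprMn nc_sqr -exprM mulnC -!expr2.
have cphi : {within `[0, T], continuous phi}.
  apply: within_sumseq => k x; apply: cvgM; first exact: cvg_cst.
  have [cr ci] := ucoef_cwithin k.
  by apply: cvgD; apply: cvgM; [exact: cr|exact: cr|exact: ci|exact: ci].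
have ae : {ae (@lebesgue_measure R), forall t, `]0, T[%classic t -> normH 3 (toC (u t)) <= K}.
  by apply: Linfty_ae; rewrite -KE.
rewrite phiE; apply: (ae_le_closed T_gt0 cphi ae) => // t' t'T nK; rewrite -phiE.
have t'T' : 0 <= t' <= T by case/andP: t'T => a b; rewrite !ltW.
apply: (le_trans (Hp_coef (u_Hp3 t'T') j3 us)).
by rewrite ler_pXn2r ?nnegrE ?normH_ge0// (le_trans (normH_ge0 _ _) nK).
Qed.

(** The essential bounds are removed twice: in space because a trigonometric polynomial is
    continuous, in time because it has finitely many continuous coefficients. The boolean [b]
    selects the sign, to reach the absolute value. *)
Lemma proj_bound (C_S K1 : R) N t x : (0 < N)%N -> 0 <= C_S ->
  (forall (v : R -> R[i]) (N : nat), Hp 1 v -> (0 < N)%N ->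
      (Linfty Omega (fun x => nc (projN N v x)) <= (C_S * normH 1 v)%:E)%E) ->
  LinftyH T 1 (fun t => toC (u t)) = K1%:E -> 0 <= t <= T ->
  `|re (tp (idx N) (ucoef t)) x| <= C_S * K1.
Proof.
move=> N0 C0 HC KE tT.
have ae : {ae (@lebesgue_measure R), forall t, `]0, T[%classic t -> normH 1 (toC (u t)) <= K1}.
  by apply: Linfty_ae; rewrite -KE.
have good t' (b : bool) : 0 < t' < T -> normH 1 (toC (u t')) <= K1 ->
    (-1) ^+ b * re (tp (idx N) (ucoef t')) x <= C_S * K1.
  move=> t'T nK; have t'T' : 0 <= t' <= T by case/andP: t'T => a1 a2; rewrite !ltW.
  have Hv : Hp 1 (toC (u t')).
    have [p1 p2 p3] := u_Hp3 t'T'; split => // j j1; apply: p3.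
    exact: leq_trans j1 _.
  have := HC _ N Hv N0; rewrite projN_fc; last exact: u_L2.
  move/Linfty_ae => aex.
  have [m Hm] := shift_into_period x.
  have ptp : Defs.periodic (re (tp (idx N) (ucoef t'))).
    move=> y; rewrite /re /tp; congr (complex.Re _).
    by apply: eq_bigr => k _; rewrite mode_periodic.
  rewrite -(periodic_int x m ptp).
  apply: (@ae_le_closed _ (- pi) pi (C_S * K1)
     (fun y => (-1) ^+ b * re (tp (idx N) (ucoef t')) y) _ _ _ aex).
  - by have := pi_gt0 R; lra.
  - apply: continuous_subspaceT => y; apply: cvgM; first exact: cvg_cst.
    exact: (ccont_tp _ _).1.
  - move=> y _ Hy; apply: (@le_trans _ _ (nc (tp (idx N) (ucoef t') y))).
      apply: (le_trans (ler_norm _)); rewrite normrM normrX normrN1 expr1n mul1r.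
      exact: nc_Re.
    by apply: (le_trans Hy); rewrite ler_wpM2l.
  - by move: Hm; rewrite ler_norml.
have cphi (b : bool) : {within `[0, T], continuous
    (fun t => (-1) ^+ b * re (tp (idx N) (ucoef t)) x)}.
  have E t' : re (tp (idx N) (ucoef t')) x = \sum_(k <- idx N)
     (Re (ucoef t' k) * Re (mode k x) - Im (ucoef t' k) * Im (mode k x)).
    by rewrite /re /tp Re_sum; apply: eq_bigr => k _; rewrite ReM.
  have -> : (fun t => (-1) ^+ b * re (tp (idx N) (ucoef t)) x) =
     (fun t => (-1) ^+ b * \sum_(k <- idx N)
     (Re (ucoef t k) * Re (mode k x) - Im (ucoef t k) * Im (mode k x))).
    by apply/funext => t'; rewrite E.
  have cs : {within `[0, T], continuous (fun t => \sum_(k <- idx N)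
     (Re (ucoef t k) * Re (mode k x) - Im (ucoef t k) * Im (mode k x)))}.
    apply: within_sumseq => k z; have [cr ci] := ucoef_cwithin k.
    by apply: cvgB; apply: cvgM; [exact: cr|exact: cvg_cst|exact: ci|exact: cvg_cst].
  by move=> z; apply: cvgM; [exact: cvg_cst|exact: cs].
have g (b : bool) := ae_le_closed T_gt0 (cphi b) ae (good^~ b) tT.
have := g true; have := g false; rewrite expr0 expr1 mul1r mulN1r => h1 h2.
by rewrite ler_norml; apply/andP; split; lra.
Qed.

(** Replacing [u] by [P_L u] in the first factor makes the product a finite convolution; each
    coefficient moves by at most the uniform error of [P_L u] times the L2 norm of the
    derivative. *)
Lemma nlcoef_approx (Q : R) t eps : 0 <= t <= T ->
  l1b (fun k => jb k * nc (ucoef t k)) Q -> 0 < eps ->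
  exists L0, forall L, (L0 <= L)%N -> forall k,
    nc (nlcoef t k - nlsum (ucoef t) (ucoef t) (idx L) k) <= eps.
Proof.
move=> tT aQ e0; have Q0 := l1b_ge0 aQ.
have [Lg fg] := u_wd tT (isT : (1 <= 3)%N); set g := wd 1 _ in Lg fg.
have Lu := u_L2 tT; have cu := ccont_toC (u_continuous tT).
pose A := Q * normL2 g.
have A0 : 0 <= A by rewrite mulr_ge0 ?normL2_ge0.
have [L0 HL0] : exists L0, forall L, (L0 <= L)%N -> mesh L * A <= eps.
  exists (Num.truncn (2 * pi * A / eps)) => L L0L.
  have : 2 * pi * A / eps < L.+1%:R.
    by apply: (lt_le_trans (truncnS_gt _)); rewrite ler_nat.
  rewrite ltr_pdivrMr// => h.
  rewrite /mesh mulrAC ler_pdivrMr ?P_gt0//.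
  apply: (le_trans (ltW h)); rewrite mulrC ler_pM2l// ler_nat; lia.
exists L0 => L LL k.
have E : nlsum (ucoef t) (ucoef t) (idx L) k =
    fc (fun x => tp (idx L) (ucoef t) x * g x) k.
  have -> : (fun x => tp (idx L) (ucoef t) x * g x) =
     fun x => \sum_(j <- idx L) ucoef t j * (mode j x * g x).
    by apply/funext => x; rewrite /tp mulr_suml; apply: eq_bigr => j _; rewrite mulrA.
  have Lm j : L2 (fun x => mode j x * g x) by apply: L2_mulcont => //; exact: ccont_mode.
  rewrite fc_sum; last by move=> j; exact: L2Z.
  by apply: eq_bigr => j _; rewrite fcZ// fc_modeM fg expr1.
have ctp := ccont_tp (idx L) (ucoef t).
rewrite E /nlcoef -/g -fcB; [|exact: L2_mulcont|exact: L2_mulcont].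
have -> : (fun x => toC (u t) x * g x - tp (idx L) (ucoef t) x * g x) =
    fun x => (toC (u t) x - tp (idx L) (ucoef t) x) * g x.
  by apply/funext => x; rewrite mulrBl.
have cd : ccont (fun x => toC (u t) x - tp (idx L) (ucoef t) x) by exact: ccontB.
apply: (le_trans (fc_le k (L2_mulcont cd Lg))).
apply: (le_trans _ (HL0 L LL)); rewrite /A mulrA.
apply: normL2_mul_sup => //; first by rewrite mulr_ge0// ltW// mesh_gt0.
move=> x; apply: tail_sup => //; [exact: u_continuous|exact: u_periodic].
Qed.

End KdVCoefficients.

(** * Weighted bounds for the quadratic term *)

Section ConvolutionBounds.
Context {R : realType}.
Implicit Types (a b c : int -> R[i]) (Q h : R) (k j : int) (s : seq int).

Definition wt (p : nat) a k : R := jb k ^+ p * nc (a k).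

Definition H3b a Q := l2b (wt 3 a) Q.

Lemma wt_ge0 p a k : 0 <= wt p a k.
Proof. by rewrite mulr_ge0 ?nc_ge0 ?exprn_ge0 ?jb_ge0. Qed.

Lemma wt_le p q a k : (p <= q)%N -> wt p a k <= wt q a k.
Proof. by move=> pq; rewrite ler_wpM2r ?nc_ge0// ler_weXn2l// jb_ge1. Qed.

Lemma wtS p a k : wt p.+1 a k = jb k * wt p a k.
Proof. by rewrite /wt exprS mulrA. Qed.

Lemma wt0 a k : wt 0 a k = nc (a k). Proof. by rewrite /wt expr0 mul1r. Qed.
Lemma wt1 a k : wt 1 a k = jb k * nc (a k). Proof. by rewrite /wt expr1. Qed.

Lemma wt_l2b a Q p : H3b a Q -> (p <= 3)%N -> l2b (wt p a) Q.
Proof.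
by move=> aQ p3; apply: l2b_le aQ => k; rewrite ger0_norm ?wt_ge0// wt_le.
Qed.

Lemma wt_l1b a Q p : H3b a Q -> (p <= 2)%N -> l1b (wt p a) (2 * Q).
Proof.
move=> aQ p2; apply: (@l1b_le _ _ (wt 2 a)); first by move=> k; exact: wt_le.
by apply: l1b_of_l2b; apply: l2b_le aQ => k; rewrite (wtS 2) ger0_norm// mulr_ge0 ?jb_ge0 ?wt_ge0.
Qed.

(** Each factor has three weights to spend. The one measured in l^1 gives one of them up, whence
    [p <= 2] and [q <= 3]. *)
Lemma conv12 s a b p q Q : uniq s -> H3b a Q -> H3b b Q -> (p <= 2)%N -> (q <= 3)%N ->
  l2b (conv s (wt p a) (wt q b)) (2 * Q * Q).
Proof.
move=> us aQ bQ p2 q3; apply: young12 => //; [exact: wt_ge0|exact: wt_l1b|exact: wt_l2b].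
Qed.

Lemma conv_sum_le s (f : int -> R) (g1 g2 g3 g4 : int -> R) k :
  (forall j, f j <= g1 j * g2 (k - j) + g3 j * g4 (k - j)) ->
  \sum_(j <- s) f j <= conv s g1 g2 k + conv s g3 g4 k.
Proof. by move=> H; rewrite /conv -big_split/=; apply: ler_sum. Qed.

Lemma nc_ik (x : R) (z : R[i]) : nc ((0 +i* x) * z) = `|x| * nc z.
Proof. by rewrite ncM nc_imag. Qed.

Lemma nlsum_weighted s a Q : uniq s -> H3b a Q ->
  l2b (fun k => jb k * nc (nlsum a a s k)) (4 * Q ^+ 2).
Proof.
move=> us aQ; apply: (@l2b_weaken _ _ (2 * Q * Q + 2 * Q * Q)).
  by rewrite le_eqVlt; apply/orP; left; apply/eqP; ring.
apply: l2b_le (l2b_add (@conv12 s a a 1 1 Q us aQ aQ isT isT)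
                       (@conv12 s a a 0 2 Q us aQ aQ isT isT)) => k.
rewrite ger0_norm ?mulr_ge0 ?jb_ge0 ?nc_ge0//.
apply: (@le_trans _ _ (\sum_(j <- s) jb k * (nc (a j) * (`|(k - j)%:~R| * nc (a (k - j)))))).
  rewrite -mulr_sumr ler_wpM2l ?jb_ge0//; apply: (le_trans (nc_sum _ _ _)).
  by apply: ler_sum => j _; rewrite ncM nc_ik.
apply: conv_sum_le => j; rewrite !wt1 wt0 /wt.
apply: (@le_trans _ _ ((jb j + jb (k - j)) * (nc (a j) * (jb (k - j) * nc (a (k - j)))))).
  apply: ler_pM; rewrite ?jb_ge0 ?mulr_ge0 ?nc_ge0 ?jb_split//.
  by rewrite ler_wpM2l ?nc_ge0// ler_wpM2r ?nc_ge0// abs_le_jb.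
by rewrite le_eqVlt; apply/orP; left; apply/eqP; ring.
Qed.

(** In the bilinear splitting the derivative may fall on the difference [a - c], so the hypothesis
    on [del] carries one weight. *)
Lemma nlsum_diff s a c Q (del : R) : uniq s -> H3b a Q -> H3b c Q ->
  l2b (fun k => jb k * nc (a k - c k)) del ->
  l2b (fun k => nc (nlsum a a s k - nlsum c c s k)) (4 * Q * del).
Proof.
move=> us aQ cQ dd.
have d0 : l2b (fun k => nc (a k - c k)) del.
  by apply: l2b_le dd => k; rewrite ger0_norm ?nc_ge0// ler_peMl ?nc_ge0// jb_ge1.
have y1 : l2b (conv s (fun k => nc (a k - c k)) (wt 1 a)) (del * (2 * Q)).
  by apply: young21 => //; [exact: wt_ge0|exact: wt_l1b].
have y2 : l2b (conv s (wt 0 c) (fun k => jb k * nc (a k - c k))) (2 * Q * del).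
  by apply: young12 => //; [exact: wt_ge0|exact: wt_l1b].
apply: (@l2b_weaken _ _ (del * (2 * Q) + 2 * Q * del)).
  by rewrite le_eqVlt; apply/orP; left; apply/eqP; ring.
apply: l2b_le (l2b_add y1 y2) => k; rewrite ger0_norm ?nc_ge0//.
rewrite /nlsum -sumrB; apply: (le_trans (nc_sum _ _ _)); apply: conv_sum_le => j.
rewrite wt0 wt1.
have -> : a j * ((0 +i* (k - j)%:~R) * a (k - j)) - c j * ((0 +i* (k - j)%:~R) * c (k - j)) =
  (a j - c j) * ((0 +i* (k - j)%:~R) * a (k - j)) +
  c j * ((0 +i* (k - j)%:~R) * (a (k - j) - c (k - j))) by ring.
apply: (le_trans (ncD _ _)); rewrite !ncM !nc_imag; apply: lerD;
  by rewrite ler_wpM2l ?nc_ge0// ler_wpM2r ?nc_ge0// abs_le_jb.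
Qed.

(* k^3 - j^3 - (k-j)^3 = 3kj(k-j): rotating both factors and undoing the
   rotation of the product moves each term by a phase of this size. *)
Lemma nlsum_phase s b Q (sig : R) : 0 <= sig -> uniq s -> H3b b Q ->
  let c k := cexpi (sig * k%:~R ^+ 3) * b k in
  l2b (fun k => nc (cexpi (- (sig * k%:~R ^+ 3)) * nlsum c c s k - nlsum b b s k))
    (12 * Q ^+ 2 * sig).
Proof.
move=> sig0 us bQ c.
have y := l2b_scale (mulr_ge0 (ler0n R 3) sig0)
  (l2b_add (@conv12 s b b 2 2 Q us bQ bQ isT isT) (@conv12 s b b 1 3 Q us bQ bQ isT isT)).
apply: (@l2b_weaken _ _ (3%:R * sig * (2 * Q * Q + 2 * Q * Q))).
  by rewrite le_eqVlt; apply/orP; left; apply/eqP; ring.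
apply: l2b_le y => k; rewrite ger0_norm ?nc_ge0//.
rewrite /nlsum mulr_sumr -sumrB; apply: (le_trans (nc_sum _ _ _)).
rewrite mulrDr /conv !mulr_sumr -big_split/=; apply: ler_sum => j _.
set x : R := j%:~R; set y : R := (k - j)%:~R.
have kxy : k%:~R = x + y by rewrite /x /y -intrD subrKC.
have -> : cexpi (- (sig * k%:~R ^+ 3)) * (c j * ((0 +i* y) * c (k - j))) -
    b j * ((0 +i* y) * b (k - j)) =
    (cexpi (- (3 * sig * (x + y) * x * y)) - 1) * (b j * ((0 +i* y) * b (k - j))).
  rewrite /c -/x -/y kxy.
  have -> : - (3 * sig * (x + y) * x * y) =
     - (sig * (x + y) ^+ 3) + sig * x ^+ 3 + sig * y ^+ 3 by ring.
  by rewrite !cexpiD; ring.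
rewrite !ncM nc_imag.
apply: (@le_trans _ _ (3 * sig * ((jb j + jb (k - j)) * jb j * jb (k - j)) *
    (nc (b j) * (jb (k - j) * nc (b (k - j)))))).
  apply: ler_pM; rewrite ?nc_ge0 ?mulr_ge0 ?nc_ge0//.
    apply: (le_trans (cexpi_sub1 _)); rewrite normrN !normrM.
    rewrite (ger0_norm sig0) ger0_norm ?ler0n// -!mulrA ler_wpM2l ?ler0n// ler_wpM2l//.
    rewrite !mulrA; apply: ler_pM; rewrite ?mulr_ge0 ?jb_ge0// ?abs_le_jb//.
    apply: ler_pM; rewrite ?abs_le_jb// -kxy.
    by apply: le_trans (jb_split k j); exact: abs_le_jb.
  by rewrite ler_wpM2l ?nc_ge0// ler_wpM2r ?nc_ge0// abs_le_jb.
by rewrite /wt le_eqVlt; apply/orP; left; apply/eqP; ring.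
Qed.

Definition trunc N b k : R[i] := if k \in idx N then b k else 0.

Lemma trunc_le N b k : nc (trunc N b k) <= nc (b k).
Proof. by rewrite /trunc; case: ifP => // _; rewrite nc0 nc_ge0. Qed.

Lemma trunc_diff N b k : nc (b k - trunc N b k) <= mesh N * (jb k * nc (b k)).
Proof.
rewrite /trunc; have h0 := ltW (mesh_gt0 N : 0 < mesh N :> R).
case: ifPn => kN.
  by rewrite subrr nc0; apply: mulr_ge0 => //; rewrite mulr_ge0 ?jb_ge0 ?nc_ge0.
rewrite subr0 mulrA ler_peMl ?nc_ge0//; apply: (le_trans (mesh_out kN)).
by rewrite ler_wpM2l// abs_le_jb.
Qed.

Lemma nlsum_trunc s b Q N : uniq s -> H3b b Q ->
  l2b (fun k => nc (nlsum b b s k - nlsum (trunc N b) (trunc N b) s k)) (4 * Q ^+ 2 * mesh N).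
Proof.
move=> us bQ; have h0 := ltW (mesh_gt0 N : 0 < mesh N :> R).
have y := l2b_scale h0 (l2b_add (@conv12 s b b 1 1 Q us bQ bQ isT isT)
  (@conv12 s b b 0 2 Q us bQ bQ isT isT)).
apply: (@l2b_weaken _ _ (mesh N * (2 * Q * Q + 2 * Q * Q))).
  by rewrite le_eqVlt; apply/orP; left; apply/eqP; ring.
apply: l2b_le y => k; rewrite ger0_norm ?nc_ge0//.
rewrite /nlsum -sumrB; apply: (le_trans (nc_sum _ _ _)).
rewrite mulrDr /conv !mulr_sumr -big_split/=; apply: ler_sum => j _.
set v := trunc N b; rewrite wt0 !wt1.
have -> : b j * ((0 +i* (k - j)%:~R) * b (k - j)) - v j * ((0 +i* (k - j)%:~R) * v (k - j)) =
  (b j - v j) * ((0 +i* (k - j)%:~R) * b (k - j)) +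
  v j * ((0 +i* (k - j)%:~R) * (b (k - j) - v (k - j))) by ring.
apply: (le_trans (ncD _ _)); rewrite !ncM !nc_imag; apply: lerD.
  rewrite [leRHS]mulrA; apply: ler_pM; rewrite ?mulr_ge0 ?nc_ge0//.
    exact: trunc_diff.
  by rewrite ler_wpM2r ?nc_ge0// abs_le_jb.
apply: (@le_trans _ _ (nc (b j) * (jb (k - j) * (mesh N * (jb (k - j) * nc (b (k - j))))))).
  apply: ler_pM; rewrite ?mulr_ge0 ?nc_ge0 ?trunc_le//.
  by apply: ler_pM; rewrite ?nc_ge0 ?abs_le_jb ?trunc_diff.
by rewrite /wt le_eqVlt; apply/orP; left; apply/eqP; ring.
Qed.

(** The Fourier coefficients of the square of [tp (idx N) b]. *)
Definition sqcoef N b k : R[i] := \sum_(j <- idx N) trunc N b j * trunc N b (k - j).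

Lemma sum_trunc N b (F : int -> R[i]) s : uniq s -> {subset idx N <= s} ->
  \sum_(j <- s) trunc N b j * F j = \sum_(j <- idx N) trunc N b j * F j.
Proof.
move=> us sub; rewrite (bigID (mem (idx N)))/= [X in _ + X]big1 ?addr0; last first.
  by move=> j /negPf jN; rewrite /trunc jN mul0r.
rewrite -big_filter; apply: perm_big; apply: uniq_perm; rewrite ?filter_uniq ?idx_uniq//.
by move=> j; rewrite mem_filter; case: (boolP (j \in idx N)) => // /sub ->.
Qed.

Lemma idx_subset N M : (N <= M)%N -> {subset idx N <= idx M}.
Proof. by move=> NM k; rewrite !mem_idx => kN; exact: leq_trans kN NM. Qed.

(* The sum is symmetric under [j <-> k - j], so the weight [k - j] averages to [k / 2]. *)
Lemma nlsum_symmetric N L b k : (N <= L)%N ->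
  nlsum (trunc N b) (trunc N b) (idx L) k = (0 +i* (k%:~R / 2)) * sqcoef N b k.
Proof.
move=> NL; set v := trunc N b; have subk l : k - (k - l) = l by lia.
have big s F : uniq s -> {subset idx N <= s} ->
    \sum_(j <- s) v j * F j = \sum_(j <- idx N) v j * F j by exact: sum_trunc.
rewrite /nlsum big ?idx_uniq//; last exact: idx_subset.
have refl (G : int -> R[i]) : \sum_(j <- idx N) v j * (v (k - j) * G j) =
    \sum_(j <- idx N) v j * (v (k - j) * G (k - j)).
  (* [idx N] is not stable under [j -> k - j]; the sum is extended by zeros to a finite list that
     is. *)
  pose M := (N + absz k)%N; pose s := idx M ++ [seq (k - j)%R | j <- idx M].
  pose t := undup s.
  have st j : j \in t -> k - j \in t.
    rewrite !mem_undup !mem_cat => /orP[jM|/mapP[l lM ->]]; apply/orP.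
      by right; apply/mapP; exists j.
    by left; rewrite subk.
  have sub : {subset idx N <= t}.
    move=> j jN; rewrite mem_undup mem_cat (@idx_subset N M)//; exact: leq_addr.
  rewrite -!(big t) ?undup_uniq//.
  have pt : perm_eq t [seq (k - j)%R | j <- t].
    apply: uniq_perm; rewrite ?undup_uniq//.
      by rewrite map_inj_uniq ?undup_uniq// => x y /addrI/oppr_inj.
    move=> j; apply/idP/mapP => [jt|[l lt ->]]; last exact: st.
    by exists (k - j); rewrite ?st// subk.
  rewrite [LHS](perm_big _ pt) [LHS]big_map; apply: eq_bigr => j _.
  by rewrite subk mulrCA.
have E1 : \sum_(j <- idx N) v j * ((0 +i* (k - j)%:~R) * v (k - j)) =
   \sum_(j <- idx N) v j * (v (k - j) * (0 +i* (k - j)%:~R)).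
  by apply: eq_bigr => j _; rewrite [_ * v (k - j)]mulrC.
have E2 : \sum_(j <- idx N) v j * ((0 +i* (k - j)%:~R) * v (k - j)) =
   \sum_(j <- idx N) v j * (v (k - j) * (0 +i* j%:~R)).
  rewrite E1 refl; apply: eq_bigr => j _; congr (_ * (_ * (0 +i* _%:~R))).
  by rewrite subk.
set S := \sum_(j <- idx N) _ in E1 E2 *.
have : S + S = (0 +i* k%:~R) * sqcoef N b k.
  rewrite {1}E1 E2 -big_split/= /sqcoef mulr_sumr; apply: eq_bigr => j _.
  rewrite -mulrDr -mulrDr -/v.
  have -> : (0 +i* (k - j)%:~R) + (0 +i* j%:~R) = 0 +i* k%:~R :> R[i].
    by apply: complex_ext => /=; rewrite ?addr0// -intrD subrK.
  by rewrite mulrA mulrC.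
move=> SS; apply: (@mulfI _ (2 : R[i])); first by rewrite pnatr_eq0.
have -> : 2 * S = S + S by ring.
rewrite SS mulrA; congr (_ * _).
have -> : 2 = 2%:C :> R[i] by rewrite rmorph_nat.
by apply: complex_ext => /=; field.
Qed.

(** Two weights are needed: one pays for the derivative, the other is traded for a factor [h] in the
    aliasing estimate. *)
Lemma sqcoef_l2b N b Q : H3b b Q -> l2b (fun k => jb k ^+ 2 * nc (sqcoef N b k)) (8 * Q ^+ 2).
Proof.
move=> bQ; have us := idx_uniq N; have h2 : 0 <= 2 :> R by exact: ler0n.
have y := l2b_scale h2 (l2b_add (@conv12 (idx N) b b 2 0 Q us bQ bQ isT isT)
  (@conv12 (idx N) b b 0 2 Q us bQ bQ isT isT)).
apply: (@l2b_weaken _ _ (2 * (2 * Q * Q + 2 * Q * Q))).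
  by rewrite le_eqVlt; apply/orP; left; apply/eqP; ring.
apply: l2b_le y => k; rewrite ger0_norm ?mulr_ge0 ?exprn_ge0 ?jb_ge0 ?nc_ge0//.
apply: (@le_trans _ _ (jb k ^+ 2 * \sum_(j <- idx N) nc (b j) * nc (b (k - j)))).
  rewrite ler_wpM2l ?exprn_ge0 ?jb_ge0//; apply: (le_trans (nc_sum _ _ _)).
  by apply: ler_sum => j _; rewrite ncM; apply: ler_pM; rewrite ?nc_ge0 ?trunc_le.
rewrite mulrDr /conv !mulr_sumr -big_split/=; apply: ler_sum => j _.
rewrite !wt0 /wt.
have K2 : (jb k : R) ^+ 2 <= 2 * jb j ^+ 2 + 2 * jb (k - j) ^+ 2.
  apply: (@le_trans _ _ ((jb j + jb (k - j) : R) ^+ 2)).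
    by rewrite ler_pXn2r ?nnegrE ?addr_ge0 ?jb_ge0// jb_split.
  have := sqr_ge0 (jb j - jb (k - j) : R); lra.
have := ler_wpM2r (mulr_ge0 (nc_ge0 (b j)) (nc_ge0 (b (k - j)))) K2; lra.
Qed.

End ConvolutionBounds.

(** * Symbol error and aliasing of the discrete flux *)

Section Aliasing.
Context {R : realType}.
Implicit Types (b : int -> R[i]) (h : R) (k : int) (N : nat).

Lemma sq_tp N b x : tp (idx N) b x ^+ 2 = tp (idx (2 * N)) (sqcoef N b) x.
Proof.
set v := trunc N b.
have tpv y : tp (idx N) b y = \sum_(j <- idx N) v j * mode j y.
  by apply: eq_big_seq => j jN; rewrite /v /trunc jN.
rewrite /tp /sqcoef -/v; under [RHS]eq_bigr do rewrite mulr_suml.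
rewrite exchange_big/= -/(tp (idx N) b x) expr2 {1}tpv mulr_suml.
apply: eq_big_seq => j jN.
transitivity (v j * mode j x * \sum_(l <- [seq (m - j)%R | m <- idx (2 * N)]) v l * mode l x).
  congr (_ * _); rewrite tpv; apply/esym; apply: sum_trunc.
    by rewrite map_inj_uniq ?idx_uniq// => y z /addIr.
  move=> l lN; apply/mapP; exists (l + j); last by rewrite addrK.
  by move: lN jN; rewrite !mem_idx; lia.
rewrite big_map mulr_sumr; apply: eq_bigr => m _.
have -> : mode m x = mode j x * mode (m - j) x by rewrite modeM subrKC.
ring.
Qed.

Lemma delta0_tp h s b :
  delta0 h (tp s b) = tp s (fun k => (0 +i* (sin (k%:~R * h) / h)) * b k).
Proof.
apply/funext => x; rewrite /delta0 /tp -sumrB mulr_suml.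
apply: eq_bigr => k _; rewrite !modeD.
have -> : mode k (- h) = conjc (mode k h) :> R[i].
  by rewrite -modeN /mode mulrNz mulrN mulNr.
have -> : 0 +i* (sin (k%:~R * h) / h) = (mode k h - conjc (mode k h)) * (2 * h)^-1%:C.
  apply: complex_ext => /=; first by ring.
  by rewrite invfM; move: h^-1 => i; field.
have -> : (2 * h)%:C^-1 = (2 * h)^-1%:C :> R[i] by rewrite -fmorphV.
ring.
Qed.

(** Since [|l - k| <= 3 N < 2 (2 N + 1)], a frequency of the square can fold at most once, on either
    side. *)
Lemma alias_pair N k l : k \in idx N -> l \in idx (2 * N) -> k <> l ->
  ((2 * N + 1)%N%:Z %| l - k)%Z ->
  l = k + (2 * N + 1)%N%:Z \/ l = k - (2 * N + 1)%N%:Z.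
Proof.
rewrite !mem_idx => kN lN kl; have hP : (0 < 2 * N + 1)%N by lia.
have {kN lN}lk : (absz (l - k) < 2 * (2 * N + 1))%N by lia.
move: (2 * N + 1)%N hP lk => P hP lk Plk.
have Dm : (P %| l - k - P%:Z)%Z by rewrite rpredB ?dvdzz.
have Dp : (P %| l - k + P%:Z)%Z by rewrite rpredD ?dvdzz.
case: (ltP k l) => kl'.
  by left; have := dvdz_lt_eq0 Dm; lia.
by right; have := dvdz_lt_eq0 Dp; lia.
Qed.

(* The coefficients of (1/2) I_N delta_x^0 (v^2) for v in X_N. *)
Definition fluxcoef N b k : R[i] :=
  2^-1%:C * dft N (delta0 (mesh N) (fun y => tp (idx N) b y ^+ 2)) k.

(** The first term is the symbol error [|sin (k h) / h - k| <= h k^2]. The other two are aliases: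
    they lie outside [idx N], so their symbol is at most [|l| <= h l^2]. *)
Lemma alias_bound N L b k : (N <= L)%N -> k \in idx N ->
  let g l := mesh N * (jb l ^+ 2 * nc (sqcoef N b l)) in
  is_true (nc (fluxcoef N b k - nlsum (trunc N b) (trunc N b) (idx L) k) <=
    2^-1 * (g k + g (k + (2 * N + 1)%N%:Z) + g (k - (2 * N + 1)%N%:Z))).
Proof.
move=> NL kN g; set h := mesh N in g *; set P := (2 * N + 1)%N%:Z.
have h0 : 0 < h by exact: mesh_gt0.
pose d l := (0 +i* (sin (l%:~R * h) / h)) * sqcoef N b l.
have g0 l : 0 <= g l.
  by apply: mulr_ge0; [exact: ltW|rewrite mulr_ge0 ?exprn_ge0 ?jb_ge0 ?nc_ge0].
rewrite /fluxcoef nlsum_symmetric// -/h.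
have -> : (fun y => tp (idx N) b y ^+ 2) = tp (idx (2 * N)) (sqcoef N b).
  by apply/funext => y; rewrite sq_tp.
rewrite delta0_tp dft_tp -/d -/P.
have k2N : k \in idx (2 * N) by apply: (@idx_subset N) => //; lia.
pose rest : R[i] := \sum_(l <- idx (2 * N) | l != k)
  (if (P %| l - k)%Z then d l * mode (l - k) (- pi) else 0).
have -> : \sum_(l <- idx (2 * N) | (P %| l - k)%Z) d l * mode (l - k) (- pi) = d k + rest.
  by rewrite big_mkcond (bigD1_seq k) ?idx_uniq// subrr dvdz0 mode0 mulr1.
have -> : 2^-1%:C * (d k + rest) - (0 +i* (k%:~R / 2)) * sqcoef N b k =
  2^-1%:C * ((0 +i* (sin (k%:~R * h) / h - k%:~R)) * sqcoef N b k + rest).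
  have -> : (0 +i* (k%:~R / 2)) = 2^-1%:C * (0 +i* k%:~R) :> R[i].
    by apply: complex_ext => /=; field.
  have -> : (0 +i* (sin (k%:~R * h) / h - k%:~R)) = (0 +i* (sin (k%:~R * h) / h)) - (0 +i* k%:~R) :> R[i].
    by apply: complex_ext => /=; ring.
  rewrite /d; ring.
rewrite ncM nc_real ger0_norm ?invr_ge0// ler_wpM2l ?invr_ge0//.
apply: (le_trans (ncD _ _)); rewrite -addrA; apply: lerD.
  rewrite nc_ik /g mulrA ler_wpM2r ?nc_ge0//.
  have -> : sin (k%:~R * h) / h - k%:~R = (sin (k%:~R * h) - k%:~R * h) / h.
    by field; exact: lt0r_neq0.
  rewrite normrM (@ger0_norm _ h^-1) ?invr_ge0 ?(ltW h0)// distrC.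
  rewrite ler_pdivrMr//; apply: (le_trans (sin_sub_le _)).
  have -> : h * jb k ^+ 2 * h = jb k ^+ 2 * h ^+ 2 by ring.
  rewrite exprMn ler_wpM2r ?sqr_ge0// -(@real_normK _ k%:~R) ?num_real//.
  by rewrite ler_pXn2r ?nnegrE ?jb_ge0// abs_le_jb.
have dg l : l \in idx (2 * N) -> l != k -> (P %| l - k)%Z -> nc (d l) <= g l.
  move=> lN lk Plk; have lout : l \notin idx N.
    apply/negP => lN'; have := dvdz_lt_eq0 Plk.
    move: lN' kN lk; rewrite !mem_idx /P => a1 a2 a3 a4.
    move/eqP: a3; apply; suff : l - k = 0 by lia.
    by apply: a4; lia.
  rewrite /d nc_ik /g mulrA ler_wpM2r ?nc_ge0//.
  rewrite normrM (@ger0_norm _ h^-1) ?invr_ge0 ?(ltW h0)// ler_pdivrMr//.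
  apply: (le_trans (abs_sin_le _)); rewrite normrM (@ger0_norm _ h) ?(ltW h0)//.
  rewrite ler_wpM2r ?(ltW h0)//; apply: (@le_trans _ _ (h * `|l%:~R| * `|l%:~R|)).
    by rewrite ler_peMl// mesh_out.
  rewrite -mulrA ler_wpM2l ?(ltW h0)// expr2.
  by apply: ler_pM; rewrite ?abs_le_jb.
rewrite /rest; apply: (le_trans (nc_sum _ _ _)).
apply: (@le_trans _ _ (\sum_(l <- [seq l <- idx (2 * N) | (l != k) && (P %| l - k)%Z]) g l)).
  rewrite big_filter big_mkcondr/= [leRHS]big_seq_cond [leLHS]big_seq_cond.
  apply: ler_sum => l /andP[lN lk]; case: ifP => Plk; last by rewrite nc0.
  by rewrite ncM nc_mode mulr1 dg.
have -> : g (k + P) + g (k - P) = \sum_(l <- [:: (k + P)%R; (k - P)%R]) g l.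
  by rewrite !big_cons big_nil addr0.
apply: sum_sub_le => //; first by rewrite filter_uniq ?idx_uniq.
move=> l; rewrite mem_filter => /andP[/andP[/eqP lk Plk] lN]; rewrite !inE.
by have [->|->] := alias_pair kN lN (fun e => lk (esym e)) Plk; rewrite eqxx ?orbT.
Qed.

Lemma flux_l2b N b Q : H3b b Q ->
  l2b (fun k => 2^-1 * (mesh N * (jb k ^+ 2 * nc (sqcoef N b k)) +
     mesh N * (jb (k + (2 * N + 1)%N%:Z) ^+ 2 * nc (sqcoef N b (k + (2 * N + 1)%N%:Z))) +
     mesh N * (jb (k - (2 * N + 1)%N%:Z) ^+ 2 * nc (sqcoef N b (k - (2 * N + 1)%N%:Z)))))
    (12 * Q ^+ 2 * mesh N).
Proof.
move=> bQ; have h0 := ltW (mesh_gt0 N : 0 < mesh N :> R).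
have y := l2b_scale h0 (sqcoef_l2b N bQ).
have half : 0 <= 2^-1 :> R by rewrite invr_ge0 ler0n.
have := l2b_scale half (l2b_add (l2b_add y (l2b_shift (2 * N + 1)%N%:Z y))
  (l2b_shift (- (2 * N + 1)%N%:Z) y)).
by apply: l2b_weaken; rewrite le_eqVlt; apply/orP; left; apply/eqP; field.
Qed.

End Aliasing.

(** * Passage to the limit and the local error *)

Section LimitInL2.
Context {R : realType}.

(** A bound that holds up to [eps * W] for every [eps] survives in the limit: on a finite list the
    weights [W], however large, have a finite norm. *)
Lemma l2_limit (I : eqType) (s : seq I) (f W : I -> R) (D : R) : 0 <= D ->
  (forall k, 0 <= f k) ->
  (forall eps, 0 < eps -> exists g : I -> R,
     (forall k, k \in s -> f k <= g k + eps * W k) /\ \sum_(k <- s) g k ^+ 2 <= D ^+ 2) ->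
  \sum_(k <- s) f k ^+ 2 <= D ^+ 2.
Proof.
move=> D0 f0 H.
pose V := Num.sqrt (\sum_(k <- s) W k ^+ 2).
have V0 : 0 <= V by exact: sqrtr_ge0.
have VE : V ^+ 2 = \sum_(k <- s) W k ^+ 2.
  by rewrite sqr_sqrtr//; apply: sumr_ge0 => k _; exact: sqr_ge0.
apply/ler_addgt0Pr => eta eta0.
pose M := 2 * D * V + V ^+ 2 + 1.
have M1 : 1 <= M by rewrite lerDr addr_ge0 ?sqr_ge0// !mulr_ge0.
pose eps := Num.min 1 (eta / M).
have M0 : 0 < M by exact: lt_le_trans M1.
have eps0 : 0 < eps by rewrite lt_min ltr01 divr_gt0.
have eps1 : eps <= 1 by rewrite ge_min lexx.
have epsM : eps * M <= eta by rewrite -ler_pdivlMr// ge_min lexx orbT.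
have [g [fg gD]] := H _ eps0.
apply: (@le_trans _ _ (\sum_(k <- s) (g k + eps * W k) ^+ 2)).
  rewrite big_seq [leRHS]big_seq; apply: ler_sum => k ks.
  by rewrite ler_pXn2r ?nnegrE// ?fg// (le_trans (f0 k))// fg.
apply: (@le_trans _ _ ((D + eps * V) ^+ 2)).
  apply: minkowski_le => //; first by rewrite mulr_ge0// ltW.
  under eq_bigr do rewrite exprMn.
  by rewrite -mulr_sumr exprMn VE.
have -> : (D + eps * V) ^+ 2 = D ^+ 2 + eps * (2 * D * V + eps * V ^+ 2) by ring.
rewrite lerD2l; apply: le_trans epsM; rewrite ler_wpM2l ?(ltW eps0)// /M.
have := ler_wpM2r (sqr_ge0 V) eps1; lra.
Qed.

End LimitInL2.

Section LocalError.
Context {R : realType} (T : R) (u : R -> R -> R) (K : R).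
Hypothesis T_gt0 : 0 < T.
Hypothesis u_cont : forall t, t \in `[0, T] -> continuous (u t).
Hypothesis u_Hp : C_Hp T 3 (fun t => toC (u t)).
Hypothesis u_KdV : KdV_solution T (fun t => toC (u t)).
Hypothesis u_K : LinftyH T 3 (fun t => toC (u t)) = K%:E.
Implicit Types (k : int) (t : R).

(** From [(1 + x)^3 <= 4 (1 + x^3)], where the zeroth and the third derivative each contribute at
    most [|K|]. *)
Definition Qc : R := 8 * `|K|.

Lemma Qc_ge0 : 0 <= Qc. Proof. by rewrite mulr_ge0. Qed.

Lemma ucoef_H3b t : 0 <= t <= T -> H3b (ucoef u t) Qc.
Proof.
move=> tT.
have lb j : (j <= 3)%N -> l2b (fun k => `|k%:~R| ^+ j * nc (ucoef u t k)) `|K|.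
  move=> j3; split=> // s us; rewrite real_normK ?num_real//.
  exact: (ucoef_bound T_gt0 u_Hp u_K).
have y := l2b_scale (ler0n R 4) (l2b_add (lb 0 isT) (lb 3 isT)).
apply: (@l2b_weaken _ _ (4%:R * (`|K| + `|K|))).
  by rewrite /Qc le_eqVlt; apply/orP; left; apply/eqP; ring.
apply: l2b_le y => k; rewrite ger0_norm ?wt_ge0// expr0 mul1r.
rewrite -[X in X + _]mul1r -mulrDl mulrA ler_wpM2r ?nc_ge0//.
rewrite /jb; set x := `|_|; have x0 : 0 <= x by exact: normr_ge0.
have -> : 4%:R * (1 + x ^+ 3) = (1 + x) ^+ 3 + 3 * (x + 1) * (x - 1) ^+ 2 by ring.
by rewrite lerDl mulr_ge0 ?sqr_ge0// mulr_ge0// addr_ge0.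
Qed.

Lemma nlcoef_weighted t s : 0 <= t <= T -> uniq s ->
  \sum_(k <- s) (jb k * nc (nlcoef u t k)) ^+ 2 <= (4 * Qc ^+ 2) ^+ 2.
Proof.
move=> tT us; have aQ := ucoef_H3b tT.
have a1 : l1b (fun k => jb k * nc (ucoef u t k)) (2 * Qc).
  by apply: l1b_le (wt_l1b aQ (isT : (1 <= 2)%N)) => k; rewrite wt1.
apply: (@l2_limit _ _ _ _ (fun k => jb k)).
- by rewrite mulr_ge0 ?sqr_ge0.
- by move=> k; rewrite mulr_ge0 ?jb_ge0 ?nc_ge0.
move=> eps e0; have [L HL] := nlcoef_approx T_gt0 u_cont u_Hp tT a1 e0.
exists (fun k => jb k * nc (nlsum (ucoef u t) (ucoef u t) (idx L) k)); split.
  move=> k _; rewrite [eps * _]mulrC -mulrDr ler_wpM2l ?jb_ge0//.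
  rewrite -[nlcoef u t k](subrK (nlsum (ucoef u t) (ucoef u t) (idx L) k)).
  by apply: (le_trans (ncD _ _)); rewrite addrC lerD2l HL.
by have [_] := nlsum_weighted (idx_uniq L) aQ; apply.
Qed.

Lemma cderZ (c : R) f t d : cder f t d -> cder (fun s => c%:C * f s) t (c%:C * d).
Proof.
move=> [dr di]; have ReC z : Re (c%:C * z) = c * Re z by rewrite ReM/= mul0r subr0.
have ImC z : Im (c%:C * z) = c * Im z by rewrite ImM/= mul0r addr0.
split.
  have -> : re (fun s => c%:C * f s) = c \*: re f by apply/funext => s; rewrite /re ReC.
  by apply: is_derive_eq; rewrite ReC.
have -> : im (fun s => c%:C * f s) = c \*: im f by apply/funext => s; rewrite /im ImC.
by apply: is_derive_eq; rewrite ImC.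
Qed.

Lemma cwithinZ (A : set R) (c : R) f : cwithin A f -> cwithin A (fun s => c%:C * f s).
Proof.
move=> [cr ci]; have ReC z : Re (c%:C * z) = c * Re z by rewrite ReM/= mul0r subr0.
have ImC z : Im (c%:C * z) = c * Im z by rewrite ImM/= mul0r addr0.
split.
  have -> : re (fun s => c%:C * f s) = fun s => c * re f s.
    by apply/funext => s; rewrite /re ReC.
  by move=> x; apply: cvgM; [exact: cvg_cst|exact: cr].
have -> : im (fun s => c%:C * f s) = fun s => c * im f s.
  by apply/funext => s; rewrite /im ImC.
by move=> x; apply: cvgM; [exact: cvg_cst|exact: ci].
Qed.

Definition twisted t k : R -> R[i] :=
  fun s => cexpi (- (k%:~R ^+ 3 * (s - t))) * ucoef u s k.

Lemma twisted_cder t k s : 0 < s < T ->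
  cder (twisted t k) s (cexpi (- (k%:~R ^+ 3 * (s - t))) * - nlcoef u s k).
Proof.
move=> sT; have := cder_rotation t (k%:~R ^+ 3) (ucoef_cder u_cont u_Hp u_KdV k sT).
by rewrite addrAC subrr add0r.
Qed.

Lemma twisted_cwithin t0 t1 t k : 0 <= t0 -> t1 <= T ->
  cwithin `[t0, t1]%classic (twisted t k).
Proof.
move=> t00 t1T; apply: (@cwithin_subset _ _ `[0, T]%classic).
  by move=> x /=; rewrite !in_itv/= => /andP[a b]; apply/andP; split; lra.
exact/cwithin_rotation/ucoef_cwithin.
Qed.

(** The solution leaves the free flow at a rate given by the nonlinear term, which is bounded with
    one weight. This supplies the [del] of [nlsum_diff]. *)
Lemma twisted_diff t t1 : 0 <= t -> t <= t1 -> t1 <= T ->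
  l2b (fun k => jb k * nc (ucoef u t1 k - cexpi ((t1 - t) * k%:~R ^+ 3) * ucoef u t k))
    (4 * Qc ^+ 2 * (t1 - t)).
Proof.
move=> t0 tt1 t1T; have D0 : 0 <= 4 * Qc ^+ 2 by rewrite mulr_ge0 ?sqr_ge0.
split; first by rewrite mulr_ge0 ?subr_ge0.
move=> s us.
have := @mean_value_l2 R int s (fun k x => (jb k)%:C * twisted t k x)
  (fun k x => (jb k)%:C * (cexpi (- (k%:~R ^+ 3 * (x - t))) * - nlcoef u x k))
  t t1 (4 * Qc ^+ 2) tt1 D0.
have E k : nc ((jb k)%:C * twisted t k t1 - (jb k)%:C * twisted t k t) =
    jb k * nc (ucoef u t1 k - cexpi ((t1 - t) * k%:~R ^+ 3) * ucoef u t k).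
  rewrite -mulrBr ncM nc_real ger0_norm ?jb_ge0//; congr (_ * _).
  rewrite /twisted subrr mulr0 oppr0 cexpi0 mul1r [(t1 - t) * _]mulrC.
  set th := _ * (t1 - t).
  have -> : cexpi (- th) * ucoef u t1 k - ucoef u t k =
      cexpi (- th) * (ucoef u t1 k - cexpi th * ucoef u t k).
    by rewrite mulrBr [_ * (cexpi th * _)]mulrA cexpiNK mul1r.
  by rewrite ncM nc_cexpi mul1r.
under eq_bigr do rewrite E.
apply.
- by move=> k; apply: cwithinZ; exact: twisted_cwithin.
- move=> k x /andP[x0 x1]; apply: cderZ; apply: twisted_cder.
  by apply/andP; split; lra.
- move=> x /andP[x0 x1].
  have xT : 0 <= x <= T by apply/andP; split; lra.
  under eq_bigr do rewrite !ncM nc_cexpi mul1r ncN nc_real ger0_norm ?jb_ge0//.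
  exact: nlcoef_weighted.
Qed.

(** Coefficients of the time increment: [16 Q^3] from [nlsum_diff] with [twisted_diff], and [12 Q^2]
    from the phases. Coefficient of [h]: [4 Q^2] from truncation plus [12 Q^2] from the flux. *)
Definition lte_const : R := 16 * Qc ^+ 3 + 16 * Qc ^+ 2.

Lemma lte_const_ge0 : 0 <= lte_const.
Proof. by rewrite addr_ge0// mulr_ge0// exprn_ge0// Qc_ge0. Qed.

Lemma local_error N t t1 : 0 <= t -> t <= t1 -> t1 <= T ->
  \sum_(k <- idx N) nc (cexpi (- (k%:~R ^+ 3 * (t1 - t))) * ucoef u t1 k - ucoef u t k
      + (t1 - t)%:C * fluxcoef N (ucoef u t) k) ^+ 2 <=
  (lte_const * (t1 - t + mesh N) * (t1 - t)) ^+ 2.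
Proof.
move=> t0 tt1 t1T; set b := ucoef u t; have Q0 := Qc_ge0.
have h0 := ltW (mesh_gt0 N : 0 < mesh N :> R).
have tT : 0 <= t <= T by apply/andP; split; lra.
have bQ : H3b b Qc by exact: ucoef_H3b.
pose D := lte_const * (t1 - t + mesh N).
have D0 : 0 <= D by rewrite mulr_ge0 ?lte_const_ge0// addr_ge0// subr_ge0.
have := @mean_value_l2 R int (idx N)
  (fun k x => twisted t k x + (x - t)%:C * fluxcoef N b k)
  (fun k x => cexpi (- (k%:~R ^+ 3 * (x - t))) * - nlcoef u x k + fluxcoef N b k)
  t t1 D tt1 D0.
have E k : twisted t k t1 + (t1 - t)%:C * fluxcoef N b k -
    (twisted t k t + (t - t)%:C * fluxcoef N b k) =
    cexpi (- (k%:~R ^+ 3 * (t1 - t))) * ucoef u t1 k - b k + (t1 - t)%:C * fluxcoef N b k.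
  rewrite /twisted subrr mulr0 oppr0 cexpi0 mul1r mul0r addr0 -/b; ring.
under eq_bigr do rewrite E.
apply.
- by move=> k; apply: cwithin_affine; exact: twisted_cwithin.
- move=> k x /andP[x0 x1]; apply: cder_affine; apply: twisted_cder.
  by apply/andP; split; lra.
move=> x /andP[x0 x1]; set sig := x - t.
have sig0 : 0 <= sig by rewrite /sig; lra.
have xT : 0 <= x <= T by apply/andP; split; lra.
pose a' := ucoef u x; pose c k := cexpi (sig * k%:~R ^+ 3) * b k.
have aQ : H3b a' Qc by exact: ucoef_H3b.
have cQ : H3b c Qc.
  by apply: l2b_le bQ => k; rewrite ger0_norm ?wt_ge0// /wt /c ncM nc_cexpi mul1r.
have a1 : l1b (fun k => jb k * nc (a' k)) (2 * Qc).
  by apply: l1b_le (wt_l1b aQ (isT : (1 <= 2)%N)) => k; rewrite wt1.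
apply: (@l2_limit _ _ _ _ (fun=> 1)) => //; first by move=> k; exact: nc_ge0.
move=> eps e0; have [L0 HL] := nlcoef_approx T_gt0 u_cont u_Hp xT a1 e0.
(* [L0] makes the convolution accurate up to [eps]; [N <= L] lets it contain every frequency of the
   truncated product. *)
pose L := maxn L0 N; have {}HL := HL L (leq_maxl _ _).
have us := idx_uniq L.
have dQ : l2b (fun k => jb k * nc (a' k - c k)) (4 * Qc ^+ 2 * sig).
  by apply: twisted_diff => //; lra.
have y1 := nlsum_diff us aQ cQ dQ.
have y2 := nlsum_phase sig0 us bQ; rewrite -/c in y2.
have y3 := nlsum_trunc N us bQ.
have y4 := flux_l2b N bQ.
pose G k := nc (nlsum a' a' (idx L) k - nlsum c c (idx L) k)
  + nc (cexpi (- (sig * k%:~R ^+ 3)) * nlsum c c (idx L) k - nlsum b b (idx L) k)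
  + nc (nlsum b b (idx L) k - nlsum (trunc N b) (trunc N b) (idx L) k)
  + 2^-1 * (mesh N * (jb k ^+ 2 * nc (sqcoef N b k)) +
     mesh N * (jb (k + (2 * N + 1)%N%:Z) ^+ 2 * nc (sqcoef N b (k + (2 * N + 1)%N%:Z))) +
     mesh N * (jb (k - (2 * N + 1)%N%:Z) ^+ 2 * nc (sqcoef N b (k - (2 * N + 1)%N%:Z)))).
have [_ GD] : l2b G D.
  apply: l2b_weaken (l2b_add (l2b_add (l2b_add y1 y2) y3) y4); rewrite /D /lte_const.
  have sx : sig <= t1 - t by rewrite /sig; lra.
  have K1 : 0 <= 16 * Qc ^+ 3 + 12 * Qc ^+ 2.
    by rewrite addr_ge0// mulr_ge0// exprn_ge0.
  have h1 := ler_wpM2l K1 sx.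
  have K2 : 0 <= 16 * Qc ^+ 3 * mesh N by rewrite mulr_ge0// mulr_ge0// exprn_ge0.
  have K3 : 0 <= 4 * Qc ^+ 2 * (t1 - t) by rewrite mulr_ge0 ?subr_ge0// mulr_ge0// exprn_ge0.
  lra.
exists G; split; last exact: (GD _ (idx_uniq N)).
move=> k kN; rewrite mulr1 -/sig.
set ph := cexpi (- (k%:~R ^+ 3 * sig)).
have phE : ph = cexpi (- (sig * k%:~R ^+ 3)) by rewrite /ph mulrC.
have nph : nc ph = 1 by exact: nc_cexpi.
set S1 := nlsum a' a' (idx L) k; set S2 := nlsum c c (idx L) k.
set S3 := nlsum b b (idx L) k; set S4 := nlsum (trunc N b) (trunc N b) (idx L) k.
(* From right to left: the finite convolution, the exact solution replaced by the free flow, the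
   phases removed, the truncation to X_N, the discrete flux. The first of these is the [eps]
   term. *)
have -> : ph * - nlcoef u x k + fluxcoef N b k = (fluxcoef N b k - S4) - (S3 - S4)
    - (ph * S2 - S3) - ph * (S1 - S2) - ph * (nlcoef u x k - S1) by ring.
have n5 := HL k; rewrite -/S1 in n5.
have n4 := alias_bound b (leq_maxr L0 N) kN; rewrite -/L -/S4 /= in n4.
apply: (le_trans (ncB _ _)); rewrite [nc (ph * (nlcoef _ _ _ - _))]ncM nph mul1r; apply: lerD n5.
apply: (le_trans (ncB _ _)); rewrite [nc (ph * (S1 - S2))]ncM nph mul1r.
apply: (@le_trans _ _ ((2^-1 * (mesh N * (jb k ^+ 2 * nc (sqcoef N b k)) +
     mesh N * (jb (k + (2 * N + 1)%N%:Z) ^+ 2 * nc (sqcoef N b (k + (2 * N + 1)%N%:Z))) +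
     mesh N * (jb (k - (2 * N + 1)%N%:Z) ^+ 2 * nc (sqcoef N b (k - (2 * N + 1)%N%:Z)))))
   + nc (S3 - S4) + nc (ph * S2 - S3) + nc (S1 - S2))).
  rewrite lerD2r; apply: (le_trans (ncB _ _)); rewrite lerD2r.
  by apply: (le_trans (ncB _ _)); rewrite lerD2r.
rewrite /G -phE -/S1 -/S2 -/S3 -/S4.
by rewrite le_eqVlt; apply/orP; left; apply/eqP; ring.
Qed.

End LocalError.

(** * The scheme on coefficients and on nodal values *)

Section Scheme.
Context {R : realType}.
Implicit Types (a b : int -> R[i]) (k : int) (N : nat) (c tau h : R).

Lemma conjcN (z : R[i]) : conjc (- z) = - conjc z. Proof. by case: z. Qed.

Lemma tpB s a b : tp s (fun k => a k - b k) = fun x => tp s a x - tp s b x.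
Proof.
by apply/funext => x; rewrite /tp -sumrB; apply: eq_bigr => k _; rewrite mulrBl.
Qed.

(* One step of the scheme, on Fourier coefficients, before the Airy rotation. *)
Definition prestep N c tau a k : R[i] :=
  a k - tau%:C * fluxcoef N a k + (c * tau * mesh N / 2 * sym2 (mesh N) k)%:C * a k.

Lemma uN_step N c tau u0 n a : uN N c tau u0 n = tp (idx N) a ->
  uN N c tau u0 n.+1 = tp (idx N) (fun k => cexpi (tau * k%:~R ^+ 3) * prestep N c tau a k).
Proof.
move=> E; apply/funext => x /=; rewrite E interpN_dft delta2_tp !airyN_tp.
rewrite /tp !mulr_sumr -sumrB -big_split; apply: eq_bigr => k _.
rewrite /prestep /fluxcoef /=.
have -> : (tau / 2)%:C = tau%:C * 2^-1%:C :> R[i] by exact: cplxM.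
rewrite (cplxM (c * tau * mesh N / 2)); ring.
Qed.

Lemma sym2N h k : sym2 h (- k) = sym2 h k.
Proof. by rewrite /sym2 mulrNz mulNr cosN. Qed.

Lemma dft_herm N (v : R -> R[i]) : (forall x, Im (v x) = 0) -> herm (dft N v).
Proof.
move=> vr k; rewrite /dft conjcM conjc_sumM.
have -> : conjc (2 * N + 1)%:R^-1 = (2 * N + 1)%:R^-1 :> R[i] by rewrite conjc_inv conjc_nat.
congr (_ * _); apply: eq_bigr => j _; congr (_ * _).
  by move: (vr (xnode N j%:Z)); case: (v _) => p q /= ->; rewrite oppr0.
by rewrite -modeN.
Qed.

Lemma delta0_real h (w : R -> R[i]) x : (forall y, Im (w y) = 0) ->
  delta0 h (fun y => w y ^+ 2) x =
  ((Re (w (x + h)) ^+ 2 - Re (w (x - h)) ^+ 2) / (2 * h))%:C.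
Proof.
move=> wr; have wE y : w y = (Re (w y))%:C by apply: complex_ext => //=; exact: wr.
rewrite /delta0 {1}[w (x + h)]wE {1}[w (x - h)]wE.
have -> : (2 * h)%:C^-1 = (2 * h)^-1%:C :> R[i] by rewrite -fmorphV.
by apply: complex_ext => /=; ring.
Qed.

Lemma flux_herm N a : herm a -> herm (fluxcoef N a).
Proof.
move=> ha k; rewrite /fluxcoef conjcM conjc_real dft_herm//.
by move=> x; rewrite delta0_real// => y; exact: herm_real.
Qed.

Lemma prestep_herm N c tau a : herm a -> herm (prestep N c tau a).
Proof.
move=> ha k; rewrite /prestep flux_herm// ha sym2N.
by rewrite !conjcD conjcN !conjcM !conjc_real.
Qed.

Lemma airy_herm tau a : herm a -> herm (fun k => cexpi (tau * k%:~R ^+ 3) * a k).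
Proof.
move=> ha k; rewrite ha conjcM cexpiJ; congr (cexpi _ * _).
by rewrite mulrNz; ring.
Qed.

Definition nodal N a (j : int) : R := re (tp (idx N) a) (xnode N j).

Lemma tp_periodic s a : Defs.periodic (tp s a).
Proof. by move=> y; rewrite /tp; apply: eq_bigr => k _; rewrite mode_periodic. Qed.

Lemma nodal_nper N a : nper (2 * N + 1) (nodal N a).
Proof. by move=> j; rewrite /nodal /re periodic_nper//; exact: tp_periodic. Qed.

Lemma xnodeS N j : xnode N j + mesh N = xnode N (j + 1) :> R.
Proof. by rewrite xnodeD mul1r. Qed.

Lemma xnodeP N j : xnode N j - mesh N = xnode N (j - 1) :> R.
Proof. by rewrite xnodeD mulrNz mulN1r. Qed.

Lemma nodalB N a b j : nodal N (fun k => a k - b k) j = nodal N a j - nodal N b j.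
Proof. by rewrite /nodal tpB /re ReD ReN. Qed.

(** At the nodes the interpolation is invisible, so the spectral step coincides there with a finite
    difference step. *)
Lemma nodal_prestep N c tau a (j : nat) : (j <= 2 * N)%N -> herm a ->
  let w := nodal N a in let lam := tau / mesh N in
  nodal N (prestep N c tau a) j%:Z = w j%:Z - lam / 4 * (w (j%:Z + 1) ^+ 2 - w (j%:Z - 1) ^+ 2)
    + c * lam / 2 * (w (j%:Z + 1) - 2 * w j%:Z + w (j%:Z - 1)).
Proof.
move=> jN ha w lam; pose h : R := mesh N; have h0 : h != 0 by rewrite gt_eqF// mesh_gt0.
have hr y : Im (tp (idx N) a y) = 0 by exact: herm_real.
have E : tp (idx N) (prestep N c tau a) (xnode N j%:Z) =
   tp (idx N) a (xnode N j%:Z)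
   - (tau / 2)%:C * delta0 h (fun y => tp (idx N) a y ^+ 2) (xnode N j%:Z)
   + (c * tau * h / 2)%:C * delta2 h (tp (idx N) a) (xnode N j%:Z).
  rewrite -(tp_dft_node (delta0 h (fun y => tp (idx N) a y ^+ 2)) jN) delta2_tp.
  rewrite /tp !mulr_sumr -sumrB -big_split; apply: eq_bigr => k _.
  rewrite /prestep /fluxcoef -/h /=.
  have -> : (tau / 2)%:C = tau%:C * 2^-1%:C :> R[i] by exact: cplxM.
  rewrite (cplxM (c * tau * h / 2)); ring.
have d2 : delta2 h (tp (idx N) a) (xnode N j%:Z) =
    ((w (j%:Z + 1) - 2 * w j%:Z + w (j%:Z - 1)) / h ^+ 2)%:C.
  rewrite /delta2 xnodeS xnodeP.
  have wE i : tp (idx N) a (xnode N i) = (w i)%:C by apply: complex_ext => //=; exact: hr.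
  rewrite !wE.
  have -> : (h ^+ 2)%:C^-1 = (h ^+ 2)^-1%:C :> R[i] by rewrite -fmorphV.
  have -> : 2 = 2%:C :> R[i] by rewrite rmorph_nat.
  by apply: complex_ext => /=; ring.
have ReCC (p q : R) : Re (p%:C * q%:C) = p * q by rewrite /= mul0r subr0.
have ReW i : Re (tp (idx N) a (xnode N i)) = w i by [].
rewrite {1}/nodal /re E d2 delta0_real// xnodeS xnodeP !ReD ReN !ReCC !ReW /lam -/h.
by field.
Qed.

Lemma sum_nodal N a : herm a ->
  \sum_(k <- idx N) nc (a k) ^+ 2 =
  (2 * N + 1)%:R^-1 * nsum (2 * N + 1) (fun j => nodal N a j ^+ 2).
Proof.
move=> ha; have P0 : (2 * N + 1)%:R != 0 :> R by rewrite gt_eqF// P_gt0.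
apply: (mulfI P0); rewrite mulrA divff// mul1r -discrete_parseval.
by apply: eq_bigr => j _; rewrite nc_sqr herm_real// expr0n addr0.
Qed.

Lemma herm_sub a b : herm a -> herm b -> herm (fun k => a k - b k).
Proof. by move=> ha hb k; rewrite ha hb conjcD conjcN. Qed.

Lemma node_index_le N (j : 'I_(2 * N + 1)) : (j <= 2 * N)%N.
Proof. by rewrite -ltnS; apply: leq_trans (ltn_ord j) _; rewrite addn1. Qed.

(** Discrete Parseval carries the energy estimate to the coefficients. [E] is the plain sum over
    nodes, larger than the sum over coefficients by the factor [2 N + 1 = 2 pi / h]; this is why
    smallness relative to powers of [h] is required. *)
Lemma sum_prestep N c tau a b (B M1 : R) : herm a -> herm b -> 0 < c -> 0 < tau ->
  tau <= mesh N / c -> (mesh N : R) <= 1 -> 0 <= B -> 0 <= M1 -> 2 * M1 ^+ 2 <= c ^+ 2 ->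
  (forall j, `|nodal N b j| <= M1) ->
  (forall j, `|nodal N b (j + 1) - nodal N b j| <= B * mesh N) ->
  let E := (2 * N + 1)%:R * \sum_(k <- idx N) nc (a k - b k) ^+ 2 in
  E <= 1 -> 40 * E <= c ^+ 2 -> E ^+ 2 <= mesh N ->
  \sum_(k <- idx N) nc (prestep N c tau a k - prestep N c tau b k) ^+ 2 <=
  (1 + stab_const B c * tau) * \sum_(k <- idx N) nc (a k - b k) ^+ 2.
Proof.
move=> ha hb c0 tau0 tauh h1 B0 M0 Mc vM vB E E1 Ec Eh.
have h0 : 0 < mesh N :> R by exact: mesh_gt0.
pose e k := a k - b k.
have he : herm e by exact: herm_sub.
have P0 := P_gt0 N : 0 < (2 * N + 1)%:R :> R.
have EE : E = nsum (2 * N + 1) (fun j => nodal N e j ^+ 2).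
  by rewrite /E sum_nodal// mulrA divff ?mul1r// gt_eqF.
pose lam := tau / mesh N.
have S := @lf_stability R (2 * N + 1) lam c (mesh N) B M1 (nodal N b) (nodal N e).
rewrite -EE in S.
rewrite (sum_nodal N (herm_sub (prestep_herm N c tau ha) (prestep_herm N c tau hb))).
rewrite -(ler_pM2l P0) mulrA divff ?gt_eqF// mul1r mulrCA -/E.
have -> : nsum (2 * N + 1) (fun j => nodal N (fun k => prestep N c tau a k - prestep N c tau b k) j ^+ 2)
   = nsum (2 * N + 1) (fun j => lf_step lam c (nodal N b) (nodal N e) j ^+ 2).
  apply: eq_bigr => j _; congr (_ ^+ 2); have jN := node_index_le j.
  rewrite nodalB !nodal_prestep// /lf_step /lam !nodalB; ring.
have lh : lam * mesh N = tau by rewrite /lam divfK// gt_eqF.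
rewrite lh in S; apply: S => //.
- by rewrite addn1 /= oddM.
- by rewrite /lam divr_ge0// ltW.
- by rewrite /lam mulrA ler_pdivrMr// mul1r mulrC -ler_pdivlMr.
- by rewrite h0.
- rewrite -[leLHS]mul1r ler_pdivrMr// mulrC mesh_period; have := pi_ge2 R; lra.
- exact: nodal_nper.
- exact: nodal_nper.
Qed.

Lemma nodal_lipschitz N b (Q : R) j : H3b b Q ->
  `|nodal N b (j + 1) - nodal N b j| <= 2 * Q * mesh N.
Proof.
move=> bQ; have h0 : 0 < mesh N :> R by exact: mesh_gt0.
rewrite /nodal -xnodeS /re -ReN -ReD; apply: (le_trans (nc_Re _)).
have -> : tp (idx N) b (xnode N j + mesh N) - tp (idx N) b (xnode N j) =
    \sum_(k <- idx N) b k * (mode k (xnode N j) * (mode k (mesh N) - 1)).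
  by rewrite /tp -sumrB; apply: eq_bigr => k _; rewrite modeD; ring.
apply: (le_trans (nc_sum _ _ _)).
apply: (@le_trans _ _ (\sum_(k <- idx N) wt 1 b k * mesh N)).
  apply: ler_sum => k _; rewrite !ncM nc_mode mul1r wt1 mulrC -mulrA [nc (b k) * _]mulrC mulrA.
  rewrite ler_wpM2r ?nc_ge0//; apply: (le_trans (cexpi_sub1 _)).
  by rewrite normrM (ger0_norm (ltW h0)) ler_wpM2r ?(ltW h0)// abs_le_jb.
rewrite -mulr_suml ler_wpM2r ?(ltW h0)//.
exact: (wt_l1b bQ (isT : (1 <= 2)%N) (idx_uniq N)).
Qed.

Lemma sym2_le h k : 0 < h -> `|sym2 h k| <= jb k ^+ 2.
Proof.
move=> h0; rewrite /sym2 normrM [`|(h ^+ 2)^-1|]ger0_norm ?invr_ge0 ?sqr_ge0//.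
rewrite ler_pdivrMr ?exprn_gt0//.
have -> : 2 * cos (k%:~R * h) - 2 = - (2 * (1 - cos (k%:~R * h))) by ring.
rewrite normrN ger0_norm ?mulr_ge0 ?oneBcos_ge0//.
have := oneBcos_le (k%:~R * h); rewrite exprMn => H.
apply: (@le_trans _ _ (k%:~R ^+ 2 * h ^+ 2)); first lra.
rewrite ler_wpM2r ?sqr_ge0// -(@real_normK _ k%:~R) ?num_real//.
by rewrite ler_pXn2r ?nnegrE ?jb_ge0// abs_le_jb.
Qed.

End Scheme.

(** * Error propagation and the induction on time steps *)

Section Convergence.
Context {R : realType} (T : R) (u : R -> R -> R) (K : R).
Hypothesis T_gt0 : 0 < T.
Hypothesis u_cont : forall t, t \in `[0, T] -> continuous (u t).
Hypothesis u_Hp : C_Hp T 3 (fun t => toC (u t)).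
Hypothesis u_KdV : KdV_solution T (fun t => toC (u t)).
Hypothesis u_K : LinftyH T 3 (fun t => toC (u t)) = K%:E.
Context (c M1 : R) (N : nat).
Hypothesis c_gt0 : 0 < c.
Hypothesis M1_ge0 : 0 <= M1.
Hypothesis M1_c : 2 * M1 ^+ 2 <= c ^+ 2.
Hypothesis u_M1 : forall t x, 0 <= t <= T -> `|re (tp (idx N) (ucoef u t)) x| <= M1.

Local Notation h := (mesh N : R).
Local Notation Q := (Qc K).
Local Notation C1 := (stab_const (2 * Q) c).
Local Notation C2 := (lte_const K + c / 2 * Q).

Lemma stab_const_ge0 (B : R) : 0 <= B -> 0 <= stab_const B c.
Proof.
move=> B0; have c1 : 0 <= c^-1 by rewrite invr_ge0 ltW.
rewrite /stab_const; apply: addr_ge0; last first.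
  apply: mulr_ge0; last by rewrite invr_ge0 exprn_ge0// ltW.
  by apply: mulr_ge0; [exact: ler0n|apply: exprn_ge0; exact: ler0n].
apply: addr_ge0; last by apply: mulr_ge0 => //; exact: ler0n.
by rewrite addr_ge0 ?mulr_ge0 ?sqr_ge0.
Qed.

Let Q0 : 0 <= Q := Qc_ge0 K.
Let h0 : 0 < h := mesh_gt0 N.

Lemma C2_ge0 : 0 <= C2.
Proof. by rewrite addr_ge0 ?lte_const_ge0// !mulr_ge0// ltW. Qed.

Let l1u t : 0 <= t <= T -> l1b (fun k => jb k * nc (ucoef u t k)) (2 * Q).
Proof.
move=> tT; have aQ := ucoef_H3b T_gt0 u_Hp u_K tT.
by apply: l1b_le (wt_l1b aQ (isT : (1 <= 2)%N)) => k; rewrite wt1.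
Qed.

Let tail t x : 0 <= t <= T -> nc (toC (u t) x - tp (idx N) (ucoef u t) x) <= h * (2 * Q).
Proof.
move=> tT; apply: tail_sup; last exact: l1u.
- exact: (u_continuous u_cont).
- exact: (u_periodic u_Hp).
Qed.

(** At the nodes the interpolant equals [u0], so the difference from [P_N u0] is the Fourier tail
    there; its maximum bound suffices, by discrete Parseval. *)
Lemma initial_error (u0 : R -> R) : u 0 = u0 ->
  \sum_(k <- idx N) nc (dft N (toC u0) k - ucoef u 0 k) ^+ 2 <= (2 * Q * h) ^+ 2.
Proof.
move=> uE; have P0 := P_gt0 N : 0 < (2 * N + 1)%:R :> R.
rewrite -(ler_pM2l P0) -discrete_parseval.
have -> : (2 * N + 1)%:R * (2 * Q * h) ^+ 2 = \sum_(j < 2 * N + 1) (2 * Q * h) ^+ 2.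
  by rewrite sumr_const card_ord mulr_natl.
apply: ler_sum => j _; have jN := node_index_le j.
rewrite tpB tp_dft_node// ler_pXn2r ?nnegrE ?nc_ge0//; last first.
  by apply: mulr_ge0; [rewrite mulr_ge0|exact: ltW].
have T0 : 0 <= (0 : R) <= T by apply/andP; split; [exact: lexx|exact: ltW].
by rewrite mulrC -uE; exact: tail.
Qed.

(** Three contributions: the stability of the step, the local error of the flux, and the viscosity
    acting on the exact solution, which [local_error] does not contain. The last is at most
    [c tau h / 2 * Q] by the bound on [sym2], whence the summand [c / 2 * Q] of the consistency
    constant. *)
Lemma one_step_error tau t a (eps : R) : herm a -> 0 <= t -> 0 < tau -> t + tau <= T ->
  tau <= h / c -> h <= 1 -> 0 <= eps ->
  \sum_(k <- idx N) nc (a k - ucoef u t k) ^+ 2 <= eps ^+ 2 ->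
  (2 * N + 1)%:R * eps ^+ 2 <= 1 -> 40 * ((2 * N + 1)%:R * eps ^+ 2) <= c ^+ 2 ->
  ((2 * N + 1)%:R * eps ^+ 2) ^+ 2 <= h ->
  \sum_(k <- idx N) nc (cexpi (tau * k%:~R ^+ 3) * prestep N c tau a k
     - ucoef u (t + tau) k) ^+ 2 <=
  ((1 + C1 * tau) * eps + tau * (C2 * (tau + h))) ^+ 2.
Proof.
move=> ha t0 tau0 tT tauh h1 eps0 aeps E1 Ec Eh.
have tT' : 0 <= t <= T by apply/andP; split; lra.
pose b := ucoef u t; pose b' := ucoef u (t + tau).
have hb : herm b by exact: (ucoef_herm u_cont).
have bQ : H3b b Q := ucoef_H3b T_gt0 u_Hp u_K tT'.
have P0 := P_gt0 N : 0 < (2 * N + 1)%:R :> R.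
pose E := (2 * N + 1)%:R * \sum_(k <- idx N) nc (a k - b k) ^+ 2.
have E0 : 0 <= E.
  by apply: mulr_ge0; [exact: ltW|apply: sumr_ge0 => k _; exact: sqr_ge0].
have EE : E <= (2 * N + 1)%:R * eps ^+ 2 by rewrite ler_pM2l.
have B0 : 0 <= 2 * Q by rewrite mulr_ge0.
have C10 := stab_const_ge0 B0.
have st : \sum_(k <- idx N) nc (prestep N c tau a k - prestep N c tau b k) ^+ 2 <=
    ((1 + C1 * tau) * eps) ^+ 2.
  have := @sum_prestep R N c tau a b (2 * Q) M1 ha hb c_gt0 tau0 tauh h1 B0 M1_ge0 M1_c.
  move=> /(_ _ (fun j => nodal_lipschitz N j bQ)) H.
  apply: (le_trans (H _ _ _ _)).
  - by move=> j; exact: u_M1.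
  - exact: le_trans E1.
  - by apply: le_trans Ec; rewrite ler_pM2l.
  - by apply: le_trans Eh; rewrite ler_pXn2r ?nnegrE// (le_trans E0).
  have k1 : 1 <= 1 + C1 * tau by rewrite lerDl mulr_ge0// ltW.
  have k0 : 0 <= 1 + C1 * tau by exact: le_trans k1.
  rewrite exprMn; apply: ler_pM => //; first by apply: sumr_ge0 => k _; exact: sqr_ge0.
  by rewrite expr2 ler_peMl.
have le := local_error T_gt0 u_cont u_Hp u_KdV u_K N t0 (_ : t <= t + tau) tT.
have {}le := le _; have tt : t + tau - t = tau by ring.
rewrite tt in le.
have {}le : \sum_(k <- idx N) nc (cexpi (- (k%:~R ^+ 3 * tau)) * b' k - b k +
    tau%:C * fluxcoef N b k) ^+ 2 <= (lte_const K * (tau + h) * tau) ^+ 2.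
  by apply: le; rewrite lerDl ltW.
have ct0 : 0 <= c * tau by apply: mulr_ge0; exact: ltW.
have [z zE] : exists z : R, z = c * tau * h / 2 by eexists.
have z0 : 0 <= z.
  by rewrite zE; apply: mulr_ge0; [apply: mulr_ge0 ct0 (ltW h0)|rewrite invr_ge0].
pose s k : R[i] := (z * sym2 h k)%:C * b k.
have sb : \sum_(k <- idx N) nc (s k) ^+ 2 <= (z * Q) ^+ 2.
  have [_ H] := l2b_scale z0 (wt_l2b bQ (isT : (2 <= 3)%N)).
  apply: le_trans (H _ (idx_uniq N)); apply: ler_sum => k _.
  have w0 := wt_ge0 2 b k.
  rewrite ler_pXn2r ?nnegrE ?nc_ge0 ?(mulr_ge0 z0 w0)//.
  rewrite /s ncM nc_real normrM (ger0_norm z0) -mulrA ler_wpM2l// /wt.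
  by rewrite ler_wpM2r ?nc_ge0// sym2_le.
have L0 : 0 <= lte_const K * (tau + h) * tau.
  apply: mulr_ge0; last exact: ltW.
  by apply: mulr_ge0; [exact: lte_const_ge0|rewrite addr_ge0// ltW].
have S0 : 0 <= z * Q by rewrite mulr_ge0.
have m1 := minkowski_le L0 S0 le sb.
have A0 : 0 <= (1 + C1 * tau) * eps.
  by rewrite mulr_ge0// addr_ge0// mulr_ge0// ltW.
have m2 := minkowski_le A0 (addr_ge0 L0 S0) st m1.
apply: le_trans (le_trans m2 _).
  apply: ler_sum => k _; rewrite ler_pXn2r ?nnegrE ?nc_ge0 ?addr_ge0 ?nc_ge0//.
  have -> : cexpi (tau * k%:~R ^+ 3) * prestep N c tau a k - b' k =
      cexpi (tau * k%:~R ^+ 3) * ((prestep N c tau a k - prestep N c tau b k) -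
       (cexpi (- (k%:~R ^+ 3 * tau)) * b' k - b k + tau%:C * fluxcoef N b k - s k)).
    have ce : cexpi (tau * k%:~R ^+ 3) * cexpi (- (k%:~R ^+ 3 * tau)) = 1.
      by rewrite -cexpiD mulrC subrr cexpi0.
    have eb : b' k = cexpi (tau * k%:~R ^+ 3) * (cexpi (- (k%:~R ^+ 3 * tau)) * b' k).
      by rewrite mulrA ce mul1r.
    rewrite {1}eb /s zE {3}/prestep; ring.
  rewrite ncM nc_cexpi mul1r; apply: (le_trans (ncB _ _)); rewrite lerD2l.
  exact: ncB.
have k3 : 0 <= c / 2 * Q * tau * tau.
  have -> : c / 2 * Q * tau * tau = c * tau * (Q * tau) / 2 by ring.
  by rewrite divr_ge0// mulr_ge0// mulr_ge0// ltW.
have r0 : 0 <= (1 + C1 * tau) * eps + tau * (C2 * (tau + h)).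
  apply: addr_ge0 => //; apply: mulr_ge0; first exact: ltW.
  by apply: mulr_ge0; [exact: C2_ge0|rewrite addr_ge0// ltW].
rewrite ler_pXn2r ?nnegrE//; last by apply: addr_ge0 => //; exact: addr_ge0.
rewrite zE lerD2l -subr_ge0.
by have -> : tau * (C2 * (tau + h)) - (lte_const K * (tau + h) * tau + c * tau * h / 2 * Q) =
  c / 2 * Q * tau * tau by ring.
Qed.

Definition err_const : R := expR (C1 * T) * (2 * Q + T * C2).

(** Since [tau <= h / c], the error [err_const * (tau + h)] is at most [err_const2 * h], the form in
    which the smallness conditions are tested. *)
Definition err_const2 : R := err_const * (c^-1 + 1).

Lemma err_const_ge0 : 0 <= err_const.
Proof.
apply: mulr_ge0; first exact: expR_ge0.
by rewrite addr_ge0 ?mulr_ge0 ?C2_ge0// ltW.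
Qed.

Lemma growth_bound tau (n : nat) : 0 < tau -> n%:R * tau <= T ->
  (1 + C1 * tau) ^+ n * (2 * Q * h + n%:R * tau * (C2 * (tau + h))) <= err_const * (tau + h).
Proof.
move=> tau0 nT; have C20 := C2_ge0.
have C10 : 0 <= C1 by apply: stab_const_ge0; rewrite mulr_ge0.
have th0 : 0 <= tau + h by rewrite addr_ge0// ltW.
rewrite /err_const -[leRHS]mulrA; apply: ler_pM.
- by rewrite exprn_ge0// addr_ge0// mulr_ge0// ltW.
- apply: addr_ge0; first by apply: mulr_ge0; [rewrite mulr_ge0|exact: ltW].
  by apply: mulr_ge0; [apply: mulr_ge0 => //; exact: ltW|exact: mulr_ge0].
- apply: (@le_trans _ _ (expR (C1 * tau) ^+ n)).
    have G0 : 0 <= 1 + C1 * tau by rewrite addr_ge0// mulr_ge0// ltW.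
    by rewrite lerXn2r ?nnegrE ?expR_ge0// expR_ge1Dx.
  by rewrite -expRM_natl ler_expR mulrCA ler_wpM2l.
- rewrite [leRHS]mulrDl; apply: lerD.
    by rewrite ler_wpM2l ?(mulr_ge0 _ Q0)// lerDr ltW.
  by rewrite -[leRHS]mulrA ler_wpM2r// mulr_ge0.
Qed.

(** The conditions on [h] are those of the energy estimate with [E] replaced by
    [8 * err_const2 ^+ 2 * h]: namely [E <= 1], [40 * E <= c ^+ 2] and [E ^+ 2 <= h]. The constant
    in them is fixed by [T], [K] and [c] before the induction starts. *)
Lemma scheme_error tau (u0 : R -> R) (n : nat) : u 0 = u0 -> 0 < tau -> tau <= h / c ->
  h <= 1 -> 8 * err_const2 ^+ 2 * h <= 1 -> 320 * err_const2 ^+ 2 * h <= c ^+ 2 ->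
  64 * err_const2 ^+ 4 * h <= 1 -> n%:R * tau <= T ->
  exists a, [/\ herm a, uN N c tau (toC u0) n = tp (idx N) a &
    \sum_(k <- idx N) nc (a k - ucoef u (n%:R * tau) k) ^+ 2 <=
    ((1 + C1 * tau) ^+ n * (2 * Q * h + n%:R * tau * (C2 * (tau + h)))) ^+ 2].
Proof.
move=> uE tau0 tauh h1 s1 s2 s3.
have C20 := C2_ge0.
have C10 : 0 <= C1 by apply: stab_const_ge0; rewrite mulr_ge0.
have th0 : 0 <= tau + h by rewrite addr_ge0// ltW.
have G0 : 0 <= 1 + C1 * tau by rewrite addr_ge0// mulr_ge0// ltW.
have G1 : 1 <= 1 + C1 * tau by rewrite lerDl mulr_ge0// ltW.
elim: n => [|n IH] nT.
  exists (dft N (toC u0)); split.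
  - by apply: dft_herm => x.
  - by rewrite /= interpN_dft.
  - by rewrite expr0 !mul0r addr0 mul1r; exact: initial_error.
have nT' : n%:R * tau <= T.
  by apply: le_trans nT; rewrite ler_wpM2r ?(ltW tau0)// ler_nat.
have [a [ha aE aerr]] := IH nT'.
set eps := _ * (2 * Q * h + _) in aerr.
have n0 : 0 <= n%:R * tau by rewrite mulr_ge0// ltW.
have D0 : 0 <= 2 * Q * h + n%:R * tau * (C2 * (tau + h)).
  apply: addr_ge0; first by apply: mulr_ge0; [rewrite mulr_ge0|exact: ltW].
  by apply: mulr_ge0 => //; exact: mulr_ge0.
have eps0 : 0 <= eps by rewrite mulr_ge0// exprn_ge0.
have epsM : eps <= err_const2 * h.
  apply: (le_trans (growth_bound tau0 nT')).
  rewrite /err_const2 -mulrA ler_wpM2l ?err_const_ge0//.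
  by rewrite mulrDl mul1r lerD2r mulrC.
have M20 : 0 <= err_const2.
  by rewrite mulr_ge0 ?err_const_ge0// addr_ge0// invr_ge0 ltW.
(* Since [(2 N + 1) h = 2 pi <= 8], the number of nodes consumes one of the two powers of [h]. *)
have PE : (2 * N + 1)%:R * eps ^+ 2 <= 8 * err_const2 ^+ 2 * h.
  apply: (@le_trans _ _ ((2 * N + 1)%:R * (err_const2 * h) ^+ 2)).
    rewrite ler_wpM2l// ler_pXn2r ?nnegrE//.
    by apply: mulr_ge0 => //; exact: ltW.
  have -> : (2 * N + 1)%:R * (err_const2 * h) ^+ 2 =
    ((2 * N + 1)%:R * h) * (err_const2 ^+ 2 * h) by ring.
  have pi8 : 2 * pi <= 8 :> R by have := @pihalf_lt2 R; lra.
  rewrite mesh_period -[leRHS]mulrA; apply: ler_wpM2r pi8.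
  by apply: mulr_ge0; [exact: sqr_ge0|exact: ltW].
have PE0 : 0 <= (2 * N + 1)%:R * eps ^+ 2 by rewrite mulr_ge0 ?sqr_ge0.
have tn : n%:R * tau + tau = n.+1%:R * tau by rewrite -natr1 mulrDl mul1r.
have step := @one_step_error tau (n%:R * tau) a eps ha n0 tau0.
rewrite tn in step.
have {}step := step nT tauh h1 eps0 aerr (le_trans PE s1).
have e2 : 40 * ((2 * N + 1)%:R * eps ^+ 2) <= c ^+ 2.
  by apply: le_trans s2; have := PE; lra.
have e3 : ((2 * N + 1)%:R * eps ^+ 2) ^+ 2 <= h.
  apply: (@le_trans _ _ ((8 * err_const2 ^+ 2 * h) ^+ 2)).
    rewrite ler_pXn2r ?nnegrE// (le_trans PE0)//.
  have -> : (8 * err_const2 ^+ 2 * h) ^+ 2 = h * (64 * err_const2 ^+ 4 * h) by ring.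
  by rewrite ler_piMr// ltW.
have {}step := step e2 e3.
exists (fun k => cexpi (tau * k%:~R ^+ 3) * prestep N c tau a k); split.
- by apply: airy_herm; exact: prestep_herm.
- exact: uN_step.
apply: (le_trans step).
have X0 : 0 <= tau * (C2 * (tau + h)).
  by apply: mulr_ge0; [exact: ltW|exact: mulr_ge0].
have Gn : 1 <= (1 + C1 * tau) ^+ n.+1 by rewrite exprn_ege1.
have ge1 : 0 <= (1 + C1 * tau) * eps + tau * (C2 * (tau + h)).
  by apply: addr_ge0 => //; exact: mulr_ge0.
have le1 : (1 + C1 * tau) * eps + tau * (C2 * (tau + h)) <=
    (1 + C1 * tau) ^+ n.+1 * (2 * Q * h + n.+1%:R * tau * (C2 * (tau + h))).
  have -> : 2 * Q * h + n.+1%:R * tau * (C2 * (tau + h)) =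
    (2 * Q * h + n%:R * tau * (C2 * (tau + h))) + tau * (C2 * (tau + h)).
    by rewrite -tn; ring.
  by rewrite /eps mulrA -exprS [leRHS]mulrDr lerD2l ler_peMl.
by rewrite ler_pXn2r ?nnegrE// (le_trans ge1).
Qed.

(** The part inside X_N is measured by Parseval, the rest by the maximum of the Fourier tail. The
    factor 4 is the root of [2 * 2 * 4], with [pi <= 4]. *)
Lemma final_error a t (eps : R) : 0 <= t <= T -> 0 <= eps ->
  \sum_(k <- idx N) nc (a k - ucoef u t k) ^+ 2 <= eps ^+ 2 ->
  normL2 (tp (idx N) a \- toC (u t)) <= 4 * (eps + 2 * Q * h).
Proof.
move=> tT eps0 aeps.
have qh0 : 0 <= 2 * Q * h by apply: mulr_ge0; [rewrite mulr_ge0|exact: ltW].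
have cu : ccont (toC (u t)) by apply: ccont_toC; exact: (u_continuous u_cont).
have -> : tp (idx N) a \- toC (u t) = fun x => tp (idx N) (fun k => a k - ucoef u t k) x
    + (tp (idx N) (ucoef u t) x - toC (u t) x).
  by apply/funext => x; rewrite /= tpB; ring.
have cd : ccont (fun x => tp (idx N) (ucoef u t) x - toC (u t) x).
  by apply: ccontB => //; exact: ccont_tp.
rewrite -(@ler_pXn2r _ 2%N) ?nnegrE ?normL2_ge0//; last first.
  by rewrite mulr_ge0// addr_ge0.
apply: (le_trans (normL2D_sqr (L2_tp _ _) (ccont_L2 cd))).
have pi0 : 0 <= 2 * pi :> R by rewrite mulr_ge0// pi_ge0.
have b1 : normL2 (tp (idx N) (fun k => a k - ucoef u t k)) ^+ 2 <= 2 * pi * eps ^+ 2.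
  by rewrite parseval_tp ?idx_uniq// ler_wpM2l.
have b2 : normL2 (fun x => tp (idx N) (ucoef u t) x - toC (u t) x) ^+ 2 <=
    2 * pi * (2 * Q * h) ^+ 2.
  apply: normL2_sup => // x; rewrite -ncN opprB mulrC; exact: tail.
have pi4 : pi <= 4 :> R by have := @pihalf_lt2 R; lra.
have S0 : 0 <= eps ^+ 2 + (2 * Q * h) ^+ 2 by rewrite addr_ge0 ?sqr_ge0.
have := ler_wpM2r S0 pi4; have := mulr_ge0 eps0 qh0; lra.
Qed.

End Convergence.

Theorem theorem2p1 (R : realType) (C_S : R) (C_S_gt0 : 0 < C_S)
    (C_SP : forall (v : R -> R[i]) (N : nat), Hp 1 v -> (0 < N)%N ->
      (Linfty Omega (fun x => Normc.normc (projN N v x))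
        <= (C_S * normH 1 v)%:E)%E)
    (T c K : R) (T_gt0 : 0 < T) :
  exists h0 M : R, [/\ 0 < h0, 0 < M &
    forall (u0 : R -> R) (u : R -> R -> R),
      (forall t, t \in `[0, T] -> continuous (u t)) ->
      C_Hp T 3 (fun t => toC (u t)) ->
      KdV_solution T (fun t => toC (u t)) ->
      u 0 = u0 ->
      LinftyH T 3 (fun t => toC (u t)) = K%:E ->
      let M1 := C_S * fine (LinftyH T 1 (fun t => toC (u t))) in
      let c0 := Num.sqrt 2 * M1 in
      0 < c0 -> c0 < c ->
      forall (N : nat) (tau : R), (0 < N)%N -> mesh N <= h0 ->
        0 < tau -> tau <= mesh N / c ->
      forall n : nat, n%:R * tau <= T ->
        normL2 (uN N c tau (toC u0) n \- toC (u (n%:R * tau)))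
          <= M * (tau + mesh N)].
Proof.
case: (lerP c 0) => [c_le0|c_gt0].
  (* Here [0 < c0 < c] is impossible, so any positive constants serve. *)
  exists 1, 1; split=> // u0 u _ _ _ _ _ M1 c0 c0_gt0 c0c.
  by have := lt_trans c0_gt0 (lt_le_trans c0c c_le0); rewrite ltxx.
(* [D] adds up nonnegative terms, one per smallness condition on [h], so [h <= 1 / D] implies them
   all. *)
pose m2 := err_const2 T K c; pose D := 1 + 8 * m2 ^+ 2 + 320 * m2 ^+ 2 / c ^+ 2 + 64 * m2 ^+ 4.
have c2 : 0 < c ^+ 2 by rewrite exprn_gt0.
have A1 : 0 <= 8 * m2 ^+ 2 by rewrite mulr_ge0 ?sqr_ge0.
have A2 : 0 <= 320 * m2 ^+ 2 / c ^+ 2.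
  by rewrite divr_ge0 ?sqr_ge0//; apply: mulr_ge0; [exact: ler0n|exact: sqr_ge0].
have A3 : 0 <= 64 * m2 ^+ 4 by apply: mulr_ge0; [exact: ler0n|exact: exprn_even_ge0].
have D_gt0 : 0 < D by rewrite /D; lra.
have e0 := err_const_ge0 K T_gt0 c_gt0; have Q0 := Qc_ge0 K.
have eQ : 0 <= err_const T K c + 2 * Qc K by rewrite addr_ge0// mulr_ge0.
(* The summand 1 keeps the error constant positive even for [K = 0], where the rest vanishes. *)
exists D^-1, (4 * (err_const T K c + 2 * Qc K) + 1); split.
- by rewrite invr_gt0.
- by rewrite ltr_pwDr// mulr_ge0.
move=> u0 u u_cont u_Hp u_KdV uE u_K M1 c0 c0_gt0 c0c N tau N_gt0 hD tau_gt0 tauh n nT.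
have h_gt0 : 0 < mesh N :> R by exact: mesh_gt0.
have hD1 : mesh N * D <= 1 by rewrite -ler_pdivlMr// mul1r.
have {hD1} bnd (z : R) : z <= D -> z * mesh N <= 1.
  by move=> zD; apply: le_trans hD1; rewrite mulrC ler_pM2l.
have s2_gt0 : 0 < Num.sqrt 2 :> R by rewrite sqrtr_gt0.
have M1_gt0 : 0 < M1 by rewrite -(pmulr_rgt0 _ s2_gt0).
have M1_c : 2 * M1 ^+ 2 <= c ^+ 2.
  have <- : c0 ^+ 2 = 2 * M1 ^+ 2 by rewrite exprMn sqr_sqrtr.
  by rewrite ler_pXn2r ?nnegrE ?ltW.
(* [fine] sends an infinite value to 0, so the positivity of [M1] forces the norm to be finite. *)
have K1E : LinftyH T 1 (fun t => toC (u t)) =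
    (fine (LinftyH T 1 (fun t => toC (u t))))%:E.
  move: M1_gt0; rewrite /M1 pmulr_rgt0//.
  by case: (LinftyH _ _ _) => //= ; rewrite ltxx.
have u_M1 t x : 0 <= t <= T -> `|re (tp (idx N) (ucoef u t)) x| <= M1.
  exact: (proj_bound T_gt0 u_Hp _ N_gt0 (ltW C_S_gt0) C_SP K1E).
have h1 : mesh N <= 1 :> R by rewrite -[leLHS]mul1r; apply: bnd; rewrite /D; lra.
have s1 : 8 * m2 ^+ 2 * mesh N <= 1 by apply: bnd; rewrite /D; lra.
have s2 : 320 * m2 ^+ 2 * mesh N <= c ^+ 2.
  rewrite -[leRHS]mul1r -ler_pdivrMr// mulrAC.
  by apply: bnd; rewrite /D; lra.
have s3 : 64 * m2 ^+ 4 * mesh N <= 1 by apply: bnd; rewrite /D; lra.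
have [a [_ -> aerr]] := scheme_error T_gt0 u_cont u_Hp u_KdV u_K c_gt0 (ltW M1_gt0) M1_c
  u_M1 uE tau_gt0 tauh h1 s1 s2 s3 nT.
have G := growth_bound K N c_gt0 tau_gt0 nT.
set eps := (X in X ^+ 2) in aerr; rewrite -/eps in G.
have th_gt0 : 0 < tau + mesh N by rewrite addr_gt0.
have nt0 : 0 <= n%:R * tau by rewrite mulr_ge0// ltW.
have nt : 0 <= n%:R * tau <= T by rewrite nt0.
have eps0 : 0 <= eps.
  have C0 := C2_ge0 K c_gt0.
  have S0 : 0 <= stab_const (2 * Qc K) c by apply: stab_const_ge0 => //; rewrite mulr_ge0.
  apply: mulr_ge0; first by rewrite exprn_ge0// addr_ge0// mulr_ge0// ltW.
  by apply: addr_ge0; apply: mulr_ge0 => //; rewrite ?(ltW h_gt0)// mulr_ge0// ltW.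
apply: (le_trans (final_error T_gt0 u_cont u_Hp u_K nt eps0 aerr)).
have Qt := mulr_ge0 Q0 (ltW tau_gt0).
rewrite [leRHS]mulrDl mul1r -mulrA; lra.
Qed.
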